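(* Let $n\in\{2,3\}$, $\Omega\Subset\mathbb R^n$ open, and let $u_\varepsilon\in X$ be such that $\bar\alpha:=\limsup_{\varepsilon\to0}\mathcal W_\varepsilon(u_\varepsilon)<\infty$. Then there exists $\varepsilon_0>0$ such that for all $\varepsilon<\varepsilon_0$: 1. $\|u_\varepsilon\|_{L^\infty(\mathbb R^n)}\le C$, where $C$ is a constant depending only on $\bar\alpha$ and $n$. 2. $u_\varepsilon$ is $1/2$-Hölder continuous on $\varepsilon$-balls, i.e. $$|u_\varepsilon(x)-u_\varepsilon(y)|\le\frac{C}{\sqrt\varepsilon}\,|x-y|^{1/2}\qquad\forall\,x\in\mathbb R^n,\ y\in B(x,\varepsilon),$$ where again the constant $C$ depends only on $\bar\alpha$ and $n$.
   Context: $X=\{u\in W^{2,2}_{loc}(\mathbb R^n): u\equiv -1 \text{ outside }\Omega\}=-1+W^{2,2}_0(\Omega)$; functions in $X$ are identified with their continuous representatives. The double-well potential is $W(s)=\frac14(s^2-1)^2$, $c_0=\int_{-1}^1\sqrt{2W(s)}\,ds=2\sqrt2/3$, and for $u\in X$, $\varepsilon>0$, $$\mathcal W_\varepsilon(u)=\frac1{c_0}\int_\Omega\frac1\varepsilon\Big(\varepsilon\Delta u-\frac1\varepsilon W'(u)\Big)^2dx .$$ $B(x,r)$ denotes the ball of radius $r$ around $x$. *)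

(* Defs.v *)
From HB Require Import structures.
From mathcomp Require Import all_boot all_order all_algebra.
From mathcomp Require Import all_classical all_reals all_analysis.

Set Implicit Arguments.
Unset Strict Implicit.
Unset Printing Implicit Defensive.

Import Order.TTheory GRing.Theory Num.Theory.
Import numFieldNormedType.Exports.

Local Open Scope classical_set_scope.
Local Open Scope ring_scope.

(* R^n is 'rV[R]_n. The library only gives it the sup norm (with its topology),
   so the product sigma-algebra, the Lebesgue measure and the Euclidean norm are
   introduced here. *)

Definition rV_display : measure_display -> measure_display.
Proof. exact. Qed.

Section measurable_rV.
Context {d} {T : sigmaRingType d}.
Variable n : nat.

Let coord : 'I_n -> 'rV[T]_n -> T := fun i x => x ord0 i.

Let rV_set0 : g_sigma_preimage coord set0.
Proof. exact: sigma_algebra0. Qed.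

Let rV_setC A : g_sigma_preimage coord A -> g_sigma_preimage coord (~` A).
Proof. exact: sigma_algebraC. Qed.

Let rV_bigcup (F : _^nat) : (forall i, g_sigma_preimage coord (F i)) ->
  g_sigma_preimage coord (\bigcup_i (F i)).
Proof. exact: sigma_algebra_bigcup. Qed.

HB.instance Definition _ := @isMeasurable.Build (rV_display d)
  'rV[T]_n (g_sigma_preimage coord) rV_set0 rV_setC rV_bigcup.

End measurable_rV.

Lemma measurable_coord d (T : sigmaRingType d) n (i : 'I_n) :
  measurable_fun [set: 'rV[T]_n] (fun x : 'rV[T]_n => x ord0 i).
Proof.
move=> _ A mA; rewrite setTI; apply: sub_sigma_algebra => /=.
rewrite -bigcup_seq/=; exists i => /=; first by rewrite mem_index_enum.
by exists A => //; rewrite setTI.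
Qed.

Lemma measurable_fun_rV d1 d2 (T1 : measurableType d1) (T2 : measurableType d2)
    n    (f : T1 -> 'rV[T2]_n) :
  (forall i, measurable_fun [set: T1] (fun x => f x ord0 i)) ->
  measurable_fun [set: T1] f.
Proof.
move=> mf; apply: (measurability
  (\big[setU/set0]_(i < n) preimage_set_system setT
     (fun x : 'rV[T2]_n => x ord0 i) measurable)) => //.
move=> _ [B + <-]; rewrite -bigcup_seq/= => -[i _ [A mA <-]].
by rewrite !setTI -comp_preimage -[X in measurable X]setTI; exact: mf.
Qed.

Section lebesgue_rV.
Context {R : realType}.

Definition rV_cons n (p : measurableTypeR R * 'rV[R]_n) : 'rV[R]_n.+1 :=
  \row_i (if unlift ord0 i is Some j then p.2 ord0 j else p.1).

Lemma measurable_rV_cons n :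
  measurable_fun [set: measurableTypeR R * 'rV[R]_n] (@rV_cons n).
Proof.
apply: measurable_fun_rV => i.
under eq_fun do rewrite mxE.
case: (unlift ord0 i) => [j|]; last exact: measurable_fst.
exact: (@measurableT_comp _ _ _ _ _ _ (fun x : 'rV[R]_n => x ord0 j) _ snd
  (measurable_coord j) (measurable_snd)).
Qed.

Definition lebesgue_rV_step n (m : {sigma_finite_measure set 'rV[R]_n -> \bar R})
    : set 'rV[R]_n.+1 -> \bar R :=
  pushforward (lebesgue_measure \x m)%E (@rV_cons n).

Section step.
Variables (n : nat) (m : {sigma_finite_measure set 'rV[R]_n -> \bar R}).

Let pre_measurable (A : set 'rV[R]_n.+1) :
  measurable A -> measurable (@rV_cons n @^-1` A).
Proof. by move=> mA; rewrite -[X in measurable X]setTI; exact: measurable_rV_cons. Qed.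

Let step0 : lebesgue_rV_step m set0 = 0%E.
Proof. by rewrite /lebesgue_rV_step /pushforward preimage_set0 measure0. Qed.

Let step_ge0 A : (0 <= lebesgue_rV_step m A)%E.
Proof. by rewrite /lebesgue_rV_step /pushforward; apply: measure_ge0. Qed.

Let step_sigma_additive : semi_sigma_additive (lebesgue_rV_step m).
Proof.
move=> F mF tF mUF; rewrite /lebesgue_rV_step /pushforward preimage_bigcup.
apply: measure_semi_sigma_additive.
- by move=> k; exact: pre_measurable.
- apply/trivIsetP => /= i j _ _ ij; rewrite -preimage_setI.
  by move/trivIsetP : tF => /(_ _ _ _ _ ij) ->//; rewrite preimage_set0.
- by rewrite -preimage_bigcup; exact: pre_measurable.
Qed.

HB.instance Definition _ := isMeasure.Build _ _ _ (lebesgue_rV_step m)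
  step0 step_ge0 step_sigma_additive.

Let step_sigma_finite : sigma_finite setT (lebesgue_rV_step m).
Proof.
have /sigma_finiteP[F [TF ndF Foo]] := sigma_finiteT (@lebesgue_measure R).
have /sigma_finiteP[G [TG ndG Goo]] := sigma_finiteT m.
pose h (x : 'rV[R]_n.+1) : measurableTypeR R * 'rV[R]_n :=
  (x ord0 ord0, \row_j x ord0 (lift ord0 j)).
have hK : cancel (@rV_cons n) h.
  move=> [a v]; rewrite /h /rV_cons mxE unlift_none; congr pair.
  by apply/rowP => j; rewrite !mxE liftK.
have mh : measurable_fun [set: 'rV[R]_n.+1] h.
  apply/measurable_fun_pair; first exact: measurable_coord.
  apply: measurable_fun_rV => i; under eq_fun do rewrite mxE.
  exact: measurable_coord.
exists (fun k => h @^-1` (F k `*` G k)).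
  rewrite -preimage_bigcup (_ : \bigcup_k _ = setT) ?preimage_setT//.
  rewrite -setXTT TF TG predeqE => -[x y]; split.
    by move=> [k _ []/= ? ?]; split; exists k.
  move=> [/= [k _ Fx] [l _ Gy]]; exists (maxn k l) => //; split.
  - by move: x Fx; exact/subsetPset/ndF/leq_maxl.
  - by move: y Gy; exact/subsetPset/ndG/leq_maxr.
move=> k; have [mF Fk] := Foo k; have [mG Gk] := Goo k; split.
  by rewrite -[X in measurable X]setTI; apply: mh => //; exact: measurableX.
rewrite /lebesgue_rV_step /pushforward -comp_preimage.
rewrite (_ : h \o _ = id); last by apply/funext => p; exact: hK.
by rewrite preimage_id product_measure1E// lte_mul_pinfty// ge0_fin_numE.
Qed.

HB.instance Definition _ := Measure_isSigmaFinite.Build _ _ _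
  (lebesgue_rV_step m) step_sigma_finite.

End step.

Fixpoint lebesgue_rV n : {sigma_finite_measure set 'rV[R]_n -> \bar R} :=
  match n with
  | 0 => \d_(0 : 'rV[R]_0)
  | n'.+1 => lebesgue_rV_step (lebesgue_rV n')
  end.

Lemma lebesgue_rV_box n (A : 'I_n -> set R) : (forall i, measurable (A i)) ->
  lebesgue_rV n [set x | forall i, A i (x ord0 i)]
  = (\prod_(i < n) lebesgue_measure (A i))%E.
Proof.
elim: n A => [|n IHn] A mA.
  rewrite big_ord0 /= diracE mem_set//=; by case.
have mB : measurable [set x : 'rV[R]_n | forall i, A (lift ord0 i) (x ord0 i)].
  rewrite [X in measurable X](_ : _ = \bigcap_(i in [set: 'I_n])
      ((fun x : 'rV[R]_n => x ord0 i) @^-1` A (lift ord0 i))).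
    apply: fin_bigcap_measurable => // i _.
    by rewrite -[X in measurable X]setTI; exact: measurable_coord.
  by apply/seteqP; split => [x xA i _|x xA i]; exact: xA.
rewrite big_ord_recl -(IHn (fun i => A (lift ord0 i)))// -product_measure1E//.
rewrite /= /lebesgue_rV_step /pushforward; congr (product_measure1 _ _ _).
apply/seteqP; split => -[a v] /= H.
  split; first by have := H ord0; rewrite mxE unlift_none.
  by move=> i; have := H (lift ord0 i); rewrite mxE liftK.
move=> i; rewrite mxE; case: unliftP => [j ->|->]; first exact: H.2.
exact: H.1.
exact: mA.
Qed.

End lebesgue_rV.

Section sobolev.
Context {R : realType} (n : nat).
Implicit Types (u v phi : 'rV[R]_n -> R) (s : seq 'I_n).

Local Notation mu := (@lebesgue_rV R n).

Definition enorm (x : 'rV[R]_n) : R := Num.sqrt (\sum_i x ord0 i ^+ 2).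

Definition eball (x : 'rV[R]_n) (r : R) : set 'rV[R]_n :=
  [set y | enorm (y - x) < r].

(* A multi-index of length k is encoded by a list of k directions:
   pderivs [:: i; j] f is d_i (d_j f). *)
Definition pderivs s (f : 'rV[R]_n -> R) : 'rV[R]_n -> R :=
  foldr (fun i g => fun x => 'D_(delta_mx ord0 i) g x) f s.

Definition smooth phi := forall s, continuous (pderivs s phi) /\
  forall i x, derivable (pderivs s phi) x (delta_mx ord0 i).

Definition test_function phi :=
  smooth phi /\ compact (closure [set x | phi x != 0]).

(* The functions of L^p_loc(R^n), for a finite exponent p. *)
Definition Lloc (p : R) v := measurable_fun setT v /\
  forall K : set 'rV[R]_n, compact K ->
    (\int[mu]_(x in K) ((`|v x| `^ p)%:E) < +oo)%E.

Definition weak_derivative s u v := [/\ Lloc 1 u, Lloc 1 v &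
  forall phi, test_function phi ->
    \int[mu]_x (u x * pderivs s phi x) =
    (-1) ^+ size s * \int[mu]_x (v x * phi x)].

Definition W22loc u := Lloc 2 u /\
  forall s, (size s <= 2)%N -> exists2 v, weak_derivative s u v & Lloc 2 v.

(* Weak derivatives are unique almost everywhere; this picks one of them
   (and 0 if there is none). *)
Definition wderiv s u : 'rV[R]_n -> R := xget (cst 0) [set v | weak_derivative s u v].

Definition wlaplacian u (x : 'rV[R]_n) : R := \sum_i wderiv [:: i; i] u x.

Definition X_space (Omega : set 'rV[R]_n) : set ('rV[R]_n -> R) :=
  [set u | [/\ continuous u, W22loc u & forall x, ~ Omega x -> u x = -1]].

End sobolev.

Definition double_well {R : realType} (s : R) : R := (s ^+ 2 - 1) ^+ 2 / 4.

Definition c0 {R : realType} : R :=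
  \int[lebesgue_measure]_(s in `[-1, 1]) Num.sqrt (2 * double_well s).

Definition diffuse_willmore {R : realType} n (Omega : set 'rV[R]_n) (eps : R)
    (u : 'rV[R]_n -> R) : \bar R :=
  ((c0^-1)%:E * \int[lebesgue_rV n]_(x in Omega)
     (eps^-1 * (eps * wlaplacian u x - eps^-1 * derive1 double_well (u x)) ^+ 2)%:E)%E.

(* Main.v *)
(* The energy bound says that Laplacian u = e^-2 W'(u) + f with ||f||_2 <= L e^(-1/2).
   For a suitable kernel eta_s of mass independent of s, the average A_s(x) of u around x
   at scale s satisfies A_s'(x) = s^(1-n) \int (Laplacian u) b_s(. - x) with a radial
   bump b_s. Integrating in s the difference of these identities at two points gives, for
   n <= 3, a 1/2-Hoelder bound for u at any scale l <= 1 in terms of sup |u|, of the sup of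
   e^-2 W'(u) and of L.
   Let |u| have its maximum M at x0, say u(x0) = M. The Hoelder bound at scale l = e/M
   yields u >= M/2 on a ball of radius k l, where e^-2 W'(u) >= c e^-2 M^3; there A_s(x0)
   would grow beyond M = max u unless M <= C L. The Hoelder bound at scale l = e is then
   the second claim.
   Outside Omega the equation is free: u = -1 there, and a weak second derivative d_ii u
   in L^1_loc of a continuous u vanishes a.e. on each level set of u. On almost every line,
   a point of the level set is isolated or a limit of others; in the second case, testing
   with hat functions having their knots in the level set shows that d_ii u vanishes at
   the point if it is a Lebesgue point. *)
Require Import Defs.
From mathcomp Require Import all_boot all_order all_algebra.
From mathcomp Require Import all_classical all_reals all_analysis.
From mathcomp Require Import measurable_realfun ess_sup_inf.
From mathcomp Require Import ring lra.

Set Implicit Arguments.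
Unset Strict Implicit.
Unset Printing Implicit Defensive.

Import Order.TTheory GRing.Theory Num.Theory.
Import numFieldNormedType.Exports.

Local Open Scope classical_set_scope.
Local Open Scope ring_scope.

(** Spherical means would require surface measure, so averages are taken against smooth kernels.
    With a profile psi built from exp(-1/t), the bump is b_s = psi(1 - |.|^2/s^2) and the averaging
    kernel is 2 s^(-n) psi'(1 - |.|^2/s^2). The formula for A_s' is then an algebraic identity
    between kernels, followed by differentiation under the integral. The restriction n <= 3 and the
    exponent 1/2 have one origin: on a ball of radius s the L^2 source contributes s^(1-n) s^(n/2)
    to A_s', which for s <= 1 is at most s^(-1/2), and the integral of s^(-1/2) is of order s^(1/2).
    The scale l = e/M is the one at which l^2 e^(-2) M^3 = M, so every term of the Hoelder bound is
    comparable to M, and e disappears from the final inequality. The boundary of Omega is arbitrary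
    and may have positive measure. The energy does not see it, and testing outside the closure does
    not reach it either. Hence the argument on level sets, which holds at almost every point where u
    = -1. *)

Lemma near0_norm_le {R : realType} (e : R) : 0 < e ->
  \forall x \near nbhs (0 : R), `|x| <= e.
Proof. by move=> e0; exact: (@cvgr0_norm_le R R R (nbhs (0:R)) _ id cvg_id _ e0). Qed.

(** * Smooth bump functions *)

Section expinv.
Context {R : realType}.
Implicit Types (p : {poly R}) (t : R).

(* The functions [p(1/t) exp(-1/t)], extended by 0, are closed under differentiation:
   this is what makes every bump below smooth. *)
Definition pexpinv p t : R := if 0 < t then p.[t^-1] * expR (- t^-1) else 0.

(** With x = 1/t one has d/dt = - x^2 d/dx, which sends p(x) exp(-x) to x^2 (p - p')(x) exp(-x). *)
Definition pexpinv_next p : {poly R} := 'X^2 * (p - p^`()).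

Lemma pexpinv_le0 p t : t <= 0 -> pexpinv p t = 0.
Proof. by rewrite /pexpinv ltNge => ->. Qed.

Lemma horner_le_pow p : exists2 C : R, 0 <= C &
  forall x, 1 <= x -> `|p.[x]| <= C * x ^+ size p.
Proof.
elim/poly_ind: p => [|p c [C C0 IH]].
  by exists 0 => // x _; rewrite horner0 normr0 mul0r.
exists (C + `|c|) => [|x x1]; first by rewrite addr_ge0.
rewrite hornerMXaddC (le_trans (ler_normD _ _))// normrM size_MXaddC.
case: ifPn => [/andP[/eqP-> /eqP->]|_] .
  by rewrite horner0 !normr0 mul0r !addr0 expr0 mulr1.
rewrite mulrDl lerD//.
  rewrite exprSr mulrA (ger0_norm (_ : 0 <= x)) ?(le_trans _ x1)//.
  by rewrite ler_wpM2r ?IH// (le_trans _ x1).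
by rewrite ler_peMr// exprn_ege1.
Qed.

(** From exp(x/m) >= x/m follows exp(-x) <= (m/x)^m. With m = [size p] + 2 and x = 1/t this absorbs
    the growth of p(1/t) and leaves t^2, which is what differentiability at 0 requires. *)
Lemma pexpinv_bound p : exists2 C : R, 0 <= C &
  forall t, t <= 1 -> `|pexpinv p t| <= C * t ^+ 2.
Proof.
have [C C0 Cp] := horner_le_pow p.
pose m := (size p).+2.
exists (C * m%:R ^+ m) => [|t t1]; first by rewrite mulr_ge0// exprn_ge0.
rewrite /pexpinv; case: ifPn => t0; last first.
  by rewrite normr0 mulr_ge0 ?sqr_ge0// mulr_ge0// exprn_ge0.
have x1 : 1 <= t^-1 by rewrite invf_ge1.
rewrite normrM (ger0_norm (expR_ge0 _)).
apply: (@le_trans _ _ (C * t^-1 ^+ size p * (m%:R * t) ^+ m)).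
  apply: ler_pM => //; first exact: Cp.
  rewrite expRN -[leRHS]invrK lef_pV2 ?posrE ?expR_gt0 ?invr_gt0 ?exprn_gt0 ?mulr_gt0 ?ltr0n//.
  rewrite -exprVn invfM mulrC.
  have -> : t^-1 = t^-1 / m%:R * m%:R by rewrite divfK// pnatr_eq0.
  rewrite expRM_natr mulfK ?pnatr_eq0//.
  apply: lerXn2r; rewrite ?nnegrE ?expR_ge0 ?divr_ge0// ?invr_ge0 ?(ltW t0)//.
  by rewrite (le_trans _ (expR_ge1Dx _))// lerDr.
rewrite exprMn /m -mulrA [X in C * X]mulrCA -(mulrA C) ler_wpM2l//.
rewrite ler_wpM2l ?exprn_ge0//.
by rewrite -addn2 exprD mulrA -exprMn mulVf ?gt_eqF// expr1n mul1r.
Qed.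

Lemma is_derive_pexpinv p t : is_derive t 1 (pexpinv p) (pexpinv (pexpinv_next p) t).
Proof.
have [t0|t0|->] := ltgtP t 0.
- rewrite (pexpinv_le0 _ (ltW t0)).
  apply: near_eq_is_derive (is_derive_cst (0:R) t 1).
  near=> x; rewrite pexpinv_le0//; apply/ltW; near: x.
  exact: lt_nbhsl.
- have := @is_derive1_comp R (horner p) (fun y => y^-1) t _ _ _
    (is_deriveV (f:=id) (lt0r_neq0 t0) (is_derive_id t (1:R))).
  move=> /(_ _ (is_derive_poly p _)) D1.
  have D2 : is_derive t 1 (fun y : R => expR (- y^-1)) (expR (- t^-1) * t^-2).
    have := @is_derive1_comp R expR (- (fun y => y^-1)) t _ _ (is_derive_expR _)
      (is_deriveN (is_deriveV (f:=id) (lt0r_neq0 t0) (is_derive_id t (1:R)))).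
    by rewrite /= scaleNr opprK [_ *: _]mulr1.
  have D3 := is_deriveM D1 D2.
  apply: near_eq_is_derive.
    2: apply: is_derive_eq D3 _; rewrite /pexpinv t0 /pexpinv_next.
    2: rewrite !hornerE /=; rewrite /GRing.scale/=; field; exact: lt0r_neq0.
  near=> x; rewrite /pexpinv ifT//; near: x; exact: lt_nbhsr.
- rewrite [pexpinv _ 0]pexpinv_le0//.
  have [C C0 Cp] := pexpinv_bound p.
  (* At 0 the difference quotient is [pexpinv p z / z], of order |z| by the quadratic bound. *)
  apply/is_derive1_caratheodory; exists (fun z => pexpinv p z / z); split.
  + move=> z; rewrite [pexpinv p 0]pexpinv_le0// !subr0.
    have [->|z0] := eqVneq z 0; first by rewrite mulr0 pexpinv_le0.
    by rewrite divfK.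
  + suff : pexpinv p z / z @[z --> (0:R)] --> (0:R).
      by rewrite /prop_for/continuous_at (pexpinv_le0 _ (lexx 0))// mul0r.
    apply/cvgr0Pnorm_le => e e0; near=> z.
    have [->|z0] := eqVneq z 0; first by rewrite invr0 mulr0 normr0 ltW.
    rewrite normrM normfV ler_pdivrMr ?normr_gt0//.
    apply: (le_trans (Cp _ _)).
      by apply: (le_trans (ler_norm _)); near: z; exact: (near0_norm_le ltr01).
    rewrite -[z ^+ 2]real_normK ?num_real// expr2 mulrA ler_wpM2r//.
    rewrite (@le_trans _ _ ((C+1) * `|z|))// ?ler_wpM2r// ?lerDl//.
    rewrite mulrC -ler_pdivlMr ?ltr_wpDl//.
    near: z; apply: (near0_norm_le (_ : 0 < e / (C + 1))).
    by rewrite divr_gt0// ltr_wpDl.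
  + by rewrite invr0 mulr0.
Unshelve. all: by end_near. Qed.

Definition expinv : R -> R := pexpinv 1.

End expinv.

(** * Directional derivatives and functions of class C^k *)

Section directional.
Context {R : realType} {V : normedModType R}.
Implicit Types (f g : V -> R) (x v : V).

Lemma is_derive_line f x v (c : R) :
  (forall h : R, f (h *: v + x) = h * c + f x) -> is_derive x v f c.
Proof.
move=> fE.
have cvgc : h^-1 *: ((f \o shift x) (h *: v) - f x) @[h --> 0^'] --> c.
  apply: cvg_near_cst; near=> h.
  rewrite /= fE addrK /GRing.scale/= mulKf//.
  by near: h; exact: nbhs_dnbhs_neq.
split; first by apply/cvg_ex; exists c.
exact/cvg_lim.
Unshelve. all: by end_near. Qed.

(** Restricting [f] to the line through [x] with direction [v] reduces this to the chain rule in one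
    variable, so that a directional derivative of [f] suffices. *)
Lemma is_derive_comp_dir (h : R -> R) f x v (a b : R) :
  is_derive (f x) 1 h a -> is_derive x v f b -> is_derive x v (h \o f) (a * b).
Proof.
move=> hD [fd fD].
pose g (t : R) := f (t *: v + x).
have gE : (fun t : R => t^-1 *: ((g \o shift 0) (t *: 1) - g 0)) =
    (fun t : R => t^-1 *: ((f \o shift x) (t *: v) - f x)).
  apply/funext => t; rewrite /g/= scale0r add0r.
  by rewrite addr0 [t *: 1]mulr1.
have gD : is_derive (0:R) (1:R) g b.
  by split; [rewrite /derivable gE|rewrite -fD /derive gE].
have hgD : is_derive (0:R) (1:R) (h \o g) (a * b).
  by apply: is_derive1_comp; rewrite /g scale0r add0r.
have hgE : (fun t : R => t^-1 *: (((h \o g) \o shift 0) (t *: 1) - (h \o g) 0)) =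
    (fun t : R => t^-1 *: (((h \o f) \o shift x) (t *: v) - (h \o f) x)).
  apply/funext => t; rewrite /g/= scale0r add0r.
  by rewrite addr0 [t *: 1]mulr1.
case: hgD; rewrite /derivable hgE => d1 d2.
split; first exact: d1.
by rewrite -d2 /derive hgE.
Qed.

Lemma is_derive_ext f g x v (c : R) : f =1 g -> is_derive x v f c -> is_derive x v g c.
Proof. by move=> /funext->. Qed.

End directional.

Section Ck.
Context {R : realType} {V : normedModType R} {I : Type} (d : I -> V).
Implicit Types (f g : V -> R) (x : V).

(** An inductive substitute for [smooth]: unlike lists of partial derivatives, it passes to
    products, inverses and compositions by induction on [k]. The family [d] of directions is a
    parameter, to cover both R^n and R. *)
Fixpoint Ck (k : nat) f : Prop := continuous f /\
  if k is k'.+1 then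
    (forall i x, derivable f x (d i)) /\ (forall i, Ck k' (fun x => 'D_(d i) f x))
  else True.

Lemma Ck_continuous k f : Ck k f -> continuous f.
Proof. by case: k => [|k] []. Qed.

Lemma Ck_inv k f : Ck k.+1 f -> [/\ continuous f,
  forall i x, derivable f x (d i) & forall i, Ck k (fun x => 'D_(d i) f x)].
Proof. by move=> [? [? ?]]. Qed.

Lemma CkS k f : Ck k.+1 f -> Ck k f.
Proof.
by elim: k f => [f []//|k IH f [cf [df Df]]]; split => //; split => // i; exact: IH.
Qed.

Lemma Ck_derive k f (g : I -> V -> R) : continuous f ->
  (forall i x, is_derive x (d i) f (g i x)) -> (forall i, Ck k (g i)) -> Ck k.+1 f.
Proof.
move=> cf fg gk; split => //; split => [i x|i]; first by have [] := fg i x.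
rewrite (_ : (fun x => _) = g i)//; apply/funext => x.
by have [] := fg i x.
Qed.

Lemma Ck_cst k (c : R) : Ck k (cst c).
Proof.
elim: k c => [|k IH] c; first by split => // x; exact: cvg_cst.
apply: (@Ck_derive _ _ (fun _ => cst 0)) => // x.
exact: cvg_cst.
Qed.

Lemma Ck_affine k f (c : I -> R) : continuous f ->
  (forall i x (h : R), f (h *: d i + x) = h * c i + f x) -> Ck k f.
Proof.
case: k => [|k] cf fc; first by [].
apply: (@Ck_derive _ _ (fun i => cst (c i))) => //.
  by move=> i x; apply: is_derive_line => h.
by move=> i; exact: Ck_cst.
Qed.

Lemma CkD k f g : Ck k f -> Ck k g -> Ck k (fun x => f x + g x).
Proof.
elim: k f g => [|k IH] f g.
  by move=> [cf _] [cg _]; split => // x; apply: cvgD; [exact: cf|exact: cg].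
move=> /Ck_inv[cf df Df] /Ck_inv[cg dg Dg].
apply: (@Ck_derive _ _ (fun i x => 'D_(d i) f x + 'D_(d i) g x)).
- by move=> x; apply: cvgD; [exact: cf|exact: cg].
- by move=> i x; apply: is_deriveD; exact/derivableP.
- by move=> i; exact: (IH _ _ (Df i) (Dg i)).
Qed.

Lemma CkM k f g : Ck k f -> Ck k g -> Ck k (fun x => f x * g x).
Proof.
elim: k f g => [|k IH] f g.
  by move=> [cf _] [cg _]; split => // x; apply: cvgM; [exact: cf|exact: cg].
move=> fk gk; have [cf df Df] := Ck_inv fk; have [cg dg Dg] := Ck_inv gk.
apply: (@Ck_derive _ _ (fun i x => f x * 'D_(d i) g x + g x * 'D_(d i) f x)).
- by move=> x; apply: cvgM; [exact: cf|exact: cg].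
- by move=> i x; apply: is_deriveM; exact/derivableP.
- by move=> i; apply: CkD; apply: IH => //; exact: CkS.
Qed.

Lemma CkZ k (c : R) f : Ck k f -> Ck k (fun x => c * f x).
Proof. by move=> fk; apply: CkM => //; exact: Ck_cst. Qed.

Lemma Ck_sum k (J : Type) (r : seq J) (F : J -> V -> R) :
  (forall j, Ck k (F j)) -> Ck k (fun x => \sum_(j <- r) F j x).
Proof.
move=> Fk; elim: r => [|j r IH].
  by under eq_fun do rewrite big_nil; exact: Ck_cst.
by under eq_fun do rewrite big_cons; exact: CkD.
Qed.

Lemma Ck_prod k (J : Type) (r : seq J) (F : J -> V -> R) :
  (forall j, Ck k (F j)) -> Ck k (fun x => \prod_(j <- r) F j x).
Proof.
move=> Fk; elim: r => [|j r IH].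
  by under eq_fun do rewrite big_nil; exact: Ck_cst.
by under eq_fun do rewrite big_cons; exact: CkM.
Qed.

Lemma CkV k f : (forall x, f x != 0) -> Ck k f -> Ck k (fun x => (f x)^-1).
Proof.
move=> f0; elim: k => [|k IH].
  by move=> [cf _]; split => // x; apply: cvgV => //; exact: cf.
move=> fk; have [cf df Df] := Ck_inv fk.
apply: (@Ck_derive _ _ (fun i x => (-1) * ((f x)^-1 * ((f x)^-1 * 'D_(d i) f x)))).
- by move=> x; apply: cvgV => //; exact: cf.
- move=> i x; have fD : is_derive x (d i) f ('D_(d i) f x) by exact/derivableP.
  have gD : is_derive (f x) 1 (fun y : R => y^-1) (- (f x) ^- 2 *: 1).
    exact: (is_deriveV (f := id)).
  have := is_derive_comp_dir gD fD.
  suff -> : - f x ^- 2 *: (1 : R) * 'D_(d i) f x =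
    (-1) * ((f x)^-1 * ((f x)^-1 * 'D_(d i) f x)) by [].
  rewrite [_ *: _]mulr1 mulN1r mulNr; congr (- _).
  by rewrite mulrA; congr (_ * _); rewrite -invfM -expr2.
- by move=> i; apply: CkZ; do 2!(apply: CkM; first exact/IH/CkS); exact: Df.
Qed.

Lemma continuous_pexpinv (p : {poly R}) : continuous (pexpinv p).
Proof.
move=> t; apply/differentiable_continuous/derivable1_diffP.
by have [] := is_derive_pexpinv p t.
Qed.

Lemma Ck_pexpinv k (p : {poly R}) f : Ck k f -> Ck k (fun x => pexpinv p (f x)).
Proof.
elim: k p => [|k IH] p.
  move=> [cf _]; split => // x.
  by apply: continuous_comp; [exact: cf|exact: continuous_pexpinv].
move=> fk; have [cf df Df] := Ck_inv fk.
apply: (@Ck_derive _ _ (fun i x => pexpinv (pexpinv_next p) (f x) * 'D_(d i) f x)).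
- by move=> x; apply: continuous_comp; [exact: cf|exact: continuous_pexpinv].
- move=> i x; apply: is_derive_comp_dir; first exact: is_derive_pexpinv.
  exact/derivableP.
- by move=> i; apply: CkM; [exact/IH/CkS|exact: Df].
Qed.

End Ck.

Section smooth_rV.
Context {R : realType} {n : nat}.
Local Notation e := (fun i : 'I_n => delta_mx ord0 i : 'rV[R]_n).

Lemma Ck_smooth (f : 'rV[R]_n -> R) : (forall k, Ck e k f) -> smooth f.
Proof.
(* The last entry of the list is the innermost derivative, so the induction peels the list from its
   end. *)
move=> fk s; elim/last_ind: s f fk => [|s i IH] f fk.
  by split; [exact: (Ck_continuous (fk 0%N))|have [_ [df _]] := fk 1%N].
rewrite /pderivs foldr_rcons; apply: IH => k.
by have [_ _ Df] := Ck_inv (fk k.+1); exact: Df.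
Qed.

Lemma is_derive_coord (i j : 'I_n) (x : 'rV[R]_n) :
  is_derive x (delta_mx ord0 j) (fun y : 'rV[R]_n => y ord0 i) (i == j)%:R.
Proof. by apply: is_derive_line => h; rewrite !mxE eqxx. Qed.

Lemma Ck_coord k (i : 'I_n) : Ck e k (fun y : 'rV[R]_n => y ord0 i).
Proof.
apply: (@Ck_affine _ _ _ _ _ _ (fun j => (i == j)%:R)).
  exact: coord_continuous.
by move=> j x h; rewrite !mxE eqxx.
Qed.

Definition smooth1 (a : R -> R) := forall k, Ck (fun _ : unit => 1 : R) k a.

Lemma smooth1_derivable a : smooth1 a -> forall t : R, is_derive t (1 : R) a (derive1 a t).
Proof.
move=> ak t; rewrite derive1E; apply/derivableP.
by have [_ [da _]] := ak 1%N; exact: (da tt).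
Qed.

Lemma smooth1_derive1 a : smooth1 a -> smooth1 (derive1 a).
Proof.
move=> ak k; have [_ _ Da] := Ck_inv (ak k.+1).
rewrite (_ : derive1 a = (fun x : R => 'D_1 a x)); first exact: (Da tt).
by apply/boolp.funext => t; rewrite derive1E.
Qed.

Lemma smooth1_continuous a : smooth1 a -> continuous a.
Proof. by move=> ak; exact: (Ck_continuous (ak 0%N)). Qed.

Lemma is_derive_comp_coord (a : R -> R) (i j : 'I_n) (x : 'rV[R]_n) : smooth1 a ->
  is_derive x (delta_mx ord0 j) (fun y : 'rV[R]_n => a (y ord0 i))
    (derive1 a (x ord0 i) * (i == j)%:R).
Proof.
move=> as1; apply: (@is_derive_comp_dir _ _ a).
  exact: smooth1_derivable.
exact: is_derive_coord.
Qed.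

Lemma Ck_comp_coord k (a : R -> R) (i : 'I_n) : smooth1 a ->
  Ck e k (fun y : 'rV[R]_n => a (y ord0 i)).
Proof.
have cc b : smooth1 b -> continuous (fun y : 'rV[R]_n => b (y ord0 i)).
  move=> b1 x; apply: continuous_comp; first exact: coord_continuous.
  exact: smooth1_continuous.
elim: k a => [|k IH] a as1; first by split => //; exact: cc.
refine (@Ck_derive _ _ _ _ _ _ (fun j (x : 'rV[R]_n) => derive1 a (x ord0 i) * (i == j)%:R) _ _ _).
- exact: cc.
- by move=> j x; exact: is_derive_comp_coord.
- by move=> j; apply: CkM; [exact/IH/smooth1_derive1|exact: Ck_cst].
Qed.

End smooth_rV.

(** * Cubes and radial bumps *)

Section cube.
Context {R : realType} {n : nat}.
Implicit Types (c x y : 'rV[R]_n) (r : R).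

Definition cube c r : set 'rV[R]_n := [set y | forall i, `|y ord0 i - c ord0 i| <= r].

Lemma cubeE c r :
  cube c r = [set y | forall i, `[c ord0 i - r, c ord0 i + r]%classic (y ord0 i)].
Proof.
apply/seteqP; split => y /= H i; have := H i; rewrite in_itv/= ler_distl//.
Qed.

Lemma compact_cube c r : compact (cube c r).
Proof.
rewrite cubeE; apply: (@rV_compact R n (fun i => `[c ord0 i - r, c ord0 i + r]%classic)).
by move=> i; exact: segment_compact.
Qed.

Lemma closed_cube c r : closed (cube c r).
Proof.
apply: compact_closed; last exact: compact_cube.
exact: norm_hausdorff.
Qed.

Lemma test_function_cube (phi : 'rV[R]_n -> R) c r : smooth phi ->
  (forall x, phi x != 0 -> cube c r x) -> test_function phi.
Proof.
move=> sphi supp; split => //.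
apply: (subclosed_compact (@closed_closure _ _) (@compact_cube c r)).
by rewrite closureE => x; apply; split => //; exact: closed_cube.
Qed.

End cube.

Section radial.
Context {R : realType} {n : nat}.
Implicit Types (p : {poly R}) (s : R) (x y : 'rV[R]_n).

Definition sqd x y : R := \sum_i (y ord0 i - x ord0 i) ^+ 2.

(** [rk 1 s x] is the bump b_s around [x], supported in the Euclidean ball of radius [s]. Its
    derivatives involve the same expression with [p] replaced by [pexpinv_next p], hence the
    parameter. *)
Definition rk p s x y : R := pexpinv p (1 - sqd x y / s ^+ 2).

Definition p1 : {poly R} := pexpinv_next 1.
Definition p2 : {poly R} := pexpinv_next p1.

Lemma sqd_ge0 x y : 0 <= sqd x y.
Proof. by apply: sumr_ge0 => i _; exact: sqr_ge0. Qed.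

Lemma sqd_coord x y i : (y ord0 i - x ord0 i) ^+ 2 <= sqd x y.
Proof.
by rewrite /sqd (bigD1 i)//= lerDl; apply: sumr_ge0 => j _; exact: sqr_ge0.
Qed.

Lemma rk_arg_le1 s x y : 1 - sqd x y / s ^+ 2 <= 1.
Proof. by rewrite gerBl mulr_ge0 ?sqd_ge0// invr_ge0 sqr_ge0. Qed.

Lemma rk_supp_sqd p s x y : 0 < s -> rk p s x y != 0 -> sqd x y < s ^+ 2.
Proof.
move=> s0; apply: contra_neqT; rewrite -leNgt => ss.
by rewrite /rk pexpinv_le0// subr_le0 ler_pdivlMr ?exprn_gt0// mul1r.
Qed.

Lemma sqd_cube s x y : 0 < s -> sqd x y < s ^+ 2 -> cube x s y.
Proof.
move=> s0 d i; rewrite -(@ler_pXn2r _ 2)// ?nnegrE// ?(ltW s0)//.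
by rewrite real_normK ?num_real// (le_trans (sqd_coord _ _ _))// ltW.
Qed.

Lemma rk_supp p s x y : 0 < s -> rk p s x y != 0 -> cube x s y.
Proof. by move=> s0 /(rk_supp_sqd s0); exact: sqd_cube. Qed.

Lemma is_derive_sqd x y i :
  is_derive y (delta_mx ord0 i) (sqd x) (2 * (y ord0 i - x ord0 i)).
Proof.
have D : is_derive y (delta_mx ord0 i)
    (\sum_(j < n) (fun z : 'rV[R]_n => (z ord0 j - x ord0 j) ^+ 2))
    (\sum_(j < n) (2 * (y ord0 j - x ord0 j) * (j == i)%:R)).
  apply: is_derive_sum => j.
  have := @is_derive_comp_dir R _ (fun t : R => t ^+ 2)
     (fun z : 'rV[R]_n => z ord0 j - x ord0 j) y (delta_mx ord0 i)
     (2 * (y ord0 j - x ord0 j)) (j == i)%:R.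
  apply.
    have := is_deriveX 2 (is_derive_id (y ord0 j - x ord0 j) (1 : R)).
    by rewrite expr1 [_ *: _]mulr1.
  have := is_deriveB (is_derive_coord j i y) (is_derive_cst (x ord0 j) y (delta_mx ord0 i)).
  by rewrite subr0.
have -> : 2 * (y ord0 i - x ord0 i) = \sum_(j < n) (2 * (y ord0 j - x ord0 j) * (j == i)%:R).
  rewrite (bigD1 i)//= eqxx mulr1 big1 ?addr0// => j /negbTE ->.
  by rewrite mulr0.
by apply: is_derive_ext D => z; rewrite fct_sumE.
Qed.

Lemma Ck_sqd k x : Ck (fun i : 'I_n => delta_mx ord0 i) k (sqd x).
Proof.
rewrite (_ : sqd x = fun y => \sum_(i < n)
    (y ord0 i - x ord0 i) * (y ord0 i - x ord0 i)); last first.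
  by apply/boolp.funext => y; apply: eq_bigr => i _; rewrite expr2.
apply: Ck_sum => i; apply: CkM; apply: CkD; (exact: Ck_coord || exact: Ck_cst).
Qed.

Lemma Ck_rk k p s x : Ck (fun i : 'I_n => delta_mx ord0 i) k (rk p s x).
Proof.
apply: Ck_pexpinv; apply: CkD; first exact: Ck_cst.
rewrite (_ : (fun y => _) = fun y => - (s ^- 2) * sqd x y); last first.
  by apply/boolp.funext => y; rewrite mulNr mulrC.
by apply: CkZ; exact: Ck_sqd.
Qed.

Lemma continuous_rk p s x : continuous (rk p s x).
Proof. exact: (Ck_continuous (Ck_rk 0 p s x)). Qed.

Lemma test_function_rk p s x : 0 < s -> test_function (rk p s x).
Proof.
move=> s0; apply: (@test_function_cube _ _ _ x s).
  by apply: Ck_smooth => k; exact: Ck_rk.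
by move=> y; exact: rk_supp.
Qed.

Lemma is_derive_rk p s x y i : is_derive y (delta_mx ord0 i) (rk p s x)
  (rk (pexpinv_next p) s x y * (- (2 * (y ord0 i - x ord0 i) / s ^+ 2))).
Proof.
apply: (is_derive_comp_dir (is_derive_pexpinv _ _)).
have := is_deriveB (is_derive_cst (1:R) y (delta_mx ord0 i)) (is_deriveZ (s ^- 2) (is_derive_sqd x y i)).
rewrite sub0r [_ *: _]mulrC; apply: is_derive_ext => z /=.
by change (1 - s ^- 2 * sqd x z = 1 - sqd x z / s ^+ 2); rewrite [s ^- 2 * _]mulrC.
Qed.

Lemma pderivs2_rk p s x y i : pderivs [:: i; i] (rk p s x) y =
  4 * (y ord0 i - x ord0 i) ^+ 2 / s ^+ 4 * rk (pexpinv_next (pexpinv_next p)) s x y -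
  2 / s ^+ 2 * rk (pexpinv_next p) s x y.
Proof.
rewrite /pderivs/=.
have -> : 'D_(delta_mx ord0 i) (rk p s x) = (fun z =>
    rk (pexpinv_next p) s x z * (- (2 * (z ord0 i - x ord0 i) / s ^+ 2))).
  by apply/boolp.funext => z; have [] := is_derive_rk p s x z i.
have D2 : is_derive y (delta_mx ord0 i)
   (fun z : 'rV[R]_n => - (2 * (z ord0 i - x ord0 i) / s ^+ 2)) (- (2 / s ^+ 2)).
  apply: is_derive_line => h; rewrite !mxE !eqxx mulr1; ring.
have [_ ->] := is_deriveM (is_derive_rk (pexpinv_next p) s x y i) D2.
rewrite /GRing.scale/=; set a := rk _ _ _ _; set b := rk _ _ _ _.
by have -> : s ^- 4 = s ^- 2 * s ^- 2 by [rewrite -invfM -exprD]; ring.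
Qed.

(** The Laplacian of [rk 1 s x], see [sum_pderivs2_rk]. *)
Definition lapk s x y : R :=
  4 * sqd x y / s ^+ 4 * rk p2 s x y - 2 * n%:R / s ^+ 2 * rk p1 s x y.

Lemma sum_pderivs2_rk s x y : \sum_i pderivs [:: i; i] (rk 1 s x) y = lapk s x y.
Proof.
under eq_bigr do rewrite pderivs2_rk.
rewrite big_split/= -mulr_suml; congr (_ + _).
  by rewrite -mulr_suml -mulr_sumr.
rewrite sumr_const card_ord -mulr_natl; ring.
Qed.

(* The power of [s] makes the [s]-derivative of [eta] a multiple of the Laplacian of the
   bump [rk 1 s x], see [is_derive_eta]. *)
Definition eta s x y : R := 2 * s ^- n * rk p1 s x y.

(** Differentiating [s ^- n] produces the term of the Laplacian that carries the dimension, and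
    differentiating the profile produces the one with [p2]. *)
Lemma is_derive_eta s x y : 0 < s ->
  is_derive s 1 (fun t => eta t x y) (s * s ^- n * lapk s x y).
Proof.
move=> s0; have sN0 : s != 0 by rewrite gt_eqF.
have DV k : is_derive s 1 (fun t : R => t ^- k) (- (k%:R * s ^- k.+1)).
  have Xk : is_derive s 1 (fun t : R => t ^+ k) (k%:R * s ^+ k.-1).
    have := is_deriveX k (is_derive_id s (1 : R)).
    by rewrite [_ *: _]mulr1; apply: is_derive_ext => t; rewrite exprfctE.
  have := is_deriveV (f := fun t : R => t ^+ k) (expf_neq0 k sN0) Xk.
  move=> D; apply: (is_derive_eq D); rewrite /GRing.scale/=.
  case: k {Xk D} => [|k]; first by rewrite !mul0r oppr0 mulr0.
  by rewrite /= !exprS; field; rewrite sN0 expf_neq0.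
have D1 : is_derive s 1 (fun t : R => 1 - sqd x y / t ^+ 2) (2 * sqd x y * s ^- 3).
  have := is_deriveB (is_derive_cst (1:R) s (1:R)) (is_deriveZ (sqd x y) (DV 2)).
  move=> D; apply: (is_derive_eq D).
    rewrite sub0r /GRing.scale/=; ring.
have D2 := @is_derive1_comp R _ _ s _ _ (is_derive_pexpinv p1 _) D1.
have D3 := is_deriveM (is_deriveZ 2 (DV n)) D2.
rewrite /eta; apply: (is_derive_eq D3).
rewrite /GRing.scale/= /lapk /rk -/p2.
set a := pexpinv _ _; set b := pexpinv _ _.
rewrite -[2 *: s ^- n]/(2 * s ^- n) !exprS expr0; field; rewrite sN0 expf_neq0//.
Qed.

End radial.

(** * Lebesgue measure on row vectors *)

Section rV_measure.
Context {R : realType} {n : nat}.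
Local Notation mu := (@lebesgue_rV R n).
Implicit Types (c x y a b : 'rV[R]_n) (r : R) (f g F k : 'rV[R]_n -> R).

Definition obox a b : set 'rV[R]_n := [set y | forall i, a ord0 i < y ord0 i < b ord0 i].

Lemma measurable_coord_box (A : 'I_n -> set R) : (forall i, measurable (A i)) ->
  measurable [set y : 'rV[R]_n | forall i, A i (y ord0 i)].
Proof.
move=> mA; rewrite [X in measurable X](_ : _ = \bigcap_(i in [set: 'I_n])
      ((fun x : 'rV[R]_n => x ord0 i) @^-1` A i)).
  apply: fin_bigcap_measurable => // i _.
  by rewrite -[X in measurable X]setTI; exact: measurable_coord.
by apply/seteqP; split => [x xA i _|x xA i]; exact: xA.
Qed.

Lemma oboxE a b : obox a b =
  [set y | forall i, (`]a ord0 i, b ord0 i[%classic : set R) (y ord0 i)].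
Proof. by apply/seteqP; split => y /= H i; have := H i; rewrite in_itv. Qed.

Lemma measurable_obox a b : measurable (obox a b).
Proof.
rewrite oboxE.
exact: (measurable_coord_box (A := fun i => `]a ord0 i, b ord0 i[%classic)).
Qed.

(** The sigma-algebra is generated by the coordinates, so an open set has to be exhibited as a
    countable union of boxes; those with rational corners inside it are enough. *)
Lemma open_measurable_rV (U : set 'rV[R]_n) : open U -> measurable U.
Proof.
move=> oU.
pose rb (q : 'rV[rat]_n) : 'rV[R]_n := map_mx ratr q.
pose G (q : 'rV[rat]_n * 'rV[rat]_n) : set 'rV[R]_n :=
  if `[< obox (rb q.1) (rb q.2) `<=` U >] then obox (rb q.1) (rb q.2) else set0.
have -> : U = \bigcup_q G q.
  apply/seteqP; split => [x Ux|x [q _]]; last first.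
    by rewrite /G; case: ifPn => [/asboolP qU xq|_ []]; exact: qU.
  have /nbhs_ballP[e /= e0 eU] : nbhs x U by exact: (open_nbhs_nbhs (conj oU Ux)).
  have /choice[qa qaP] : forall i, exists q : rat, x ord0 i - e < ratr q < x ord0 i.
    move=> i; have /rat_in_itvoo[q] : x ord0 i - e < x ord0 i by rewrite gtrBl.
    by rewrite in_itv/= => qP; exists q.
  have /choice[qb qbP] : forall i, exists q : rat, x ord0 i < ratr q < x ord0 i + e.
    move=> i; have /rat_in_itvoo[q] : x ord0 i < x ord0 i + e by rewrite ltrDl.
    by rewrite in_itv/= => qP; exists q.
  exists (\row_i qa i, \row_i qb i) => //; rewrite /G ifT /=; last first.
    apply/asboolP => y yb; apply: eU; split => // i j; rewrite (ord1 i).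
    have := yb j; rewrite !mxE => /andP[ay yb'].
    have /andP[q1 q2] := qaP j; have /andP[q3 q4] := qbP j.
    by rewrite /ball/= distrC ltr_distl (lt_trans q1)//= (lt_trans yb').
  move=> i; rewrite !mxE.
  by have /andP[_ ->] := qaP i; have /andP[-> _] := qbP i.
apply: countable_bigcupT_measurable => [|q]; first exact: countableP.
by rewrite /G; case: ifP => _; [exact: measurable_obox|exact: measurable0].
Qed.

Lemma closed_measurable_rV (U : set 'rV[R]_n) : closed U -> measurable U.
Proof. by move/closed_openC/open_measurable_rV/measurableC; rewrite setCK. Qed.

Lemma continuous_measurable_rV f : continuous f -> measurable_fun setT f.
Proof.
move=> cf; apply: (measurability _ (RGenOpens.measurableE R)) => _ [_ [a [b ->] <-]].
rewrite setTI; apply: open_measurable_rV.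
apply: open_comp => [y _|]; [exact: cf|exact: interval_open].
Qed.

Lemma measurable_cube c r : measurable (cube c r).
Proof. by apply: closed_measurable_rV; exact: closed_cube. Qed.

Lemma lebesgue_cube c r : 0 <= r -> mu (cube c r) = ((2 * r) ^+ n)%:E.
Proof.
move=> r0; rewrite cubeE.
rewrite (@lebesgue_rV_box _ _ (fun i => `[c ord0 i - r, c ord0 i + r]%classic)); last by move=> i.
rewrite (eq_bigr (fun=> (2 * r)%:E)).
  by rewrite prodEFin prodr_const card_ord.
move=> i _; rewrite lebesgue_measure_itv/= lte_fin; case: ifPn => [_|].
  by rewrite -EFinB; congr (_ %:E); ring.
rewrite -leNgt => H; congr (_ %:E); lra.
Qed.

Lemma cube_lty c r : (mu (cube c r) < +oo)%E.
Proof.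
have [r0|r0] := leP 0 r; first by rewrite lebesgue_cube ?ltry.
apply: (@le_lt_trans _ _ (mu (cube c 0))); last by rewrite lebesgue_cube ?ltry.
apply: le_measure; rewrite ?inE; do 1?exact: measurable_cube.
by move=> y yc i; rewrite (le_trans (yc i))// ltW.
Qed.

Lemma Lloc1_integrable F c r : Lloc 1 F -> mu.-integrable (cube c r) (EFin \o F).
Proof.
move=> [mF FK]; apply/integrableP; split.
  by apply/measurable_EFinP; exact: measurable_funTS.
have := FK _ (@compact_cube _ _ c r).
by under eq_integral do rewrite powRr1//.
Qed.

Lemma continuous_bounded_cube f c r : continuous f ->
  exists2 C : R, 0 <= C & forall y, cube c r y -> `|f y| <= C.
Proof.
move=> cf; have := @compact_bounded _ _ (f @` cube c r).
move=> /(_ (continuous_compact _ _)); case.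
- by apply: continuous_subspaceT.
- exact: compact_cube.
- move=> C [Cr HC]; exists (`|C| + 1); first by rewrite addr_ge0.
  move=> y yc; apply: HC; last by exists y.
  by rewrite ltr_pwDr// ler_norm.
Qed.

Lemma integrable_cube_supp F k c r (b : R) : Lloc 1 F -> measurable_fun setT k ->
  (forall y, `|k y| <= b) -> (forall y, k y != 0 -> cube c r y) ->
  mu.-integrable setT (EFin \o (fun y => F y * k y)).
Proof.
move=> lF mk kb ks.
rewrite [X in mu.-integrable _ X](_ : _ = (EFin \o (fun y => F y * k y)) \_ (cube c r)).
  apply/(integrable_mkcond _ (measurable_cube c r)).
  have := @integrableMl _ _ _ mu (cube c r) (measurable_cube c r) (EFin \o F) k (Lloc1_integrable c r lF).
  apply; first exact: measurable_funTS.
  exists b; split; first exact: num_real.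
  by move=> x bx y _; rewrite /= (le_trans (kb y))// ltW.
apply/funext => y; rewrite patchE; case: ifPn => //.
rewrite notin_setE => yc; rewrite /=.
suff -> : k y = 0 by rewrite mulr0.
by apply/eqP; apply: contra_notT yc; exact: ks.
Qed.

Lemma Lloc1_continuous f : continuous f -> Lloc 1 f.
Proof.
move=> cf; split; first exact: continuous_measurable_rV.
move=> K cK; have mK : measurable K.
  by apply: closed_measurable_rV; apply: compact_closed => //; exact: norm_hausdorff.
have [c [r Kcr]] : exists c r, K `<=` cube c r.
  have [M [_ HM]] := compact_bounded cK.
  exists 0, (`|M| + 1) => y Ky i; rewrite mxE subr0.
  have := HM (`|M| + 1) _ y Ky; rewrite ltr_pwDr ?ler_norm// => /(_ isT).
  apply: le_trans; change (`|y ord0 i| <= mx_norm y); rewrite mx_normrE.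
  exact: (le_trans _ (le_bigmax _ (fun ij => `|y ij.1 ij.2|) (ord0, i))).
have [C C0 HC] := continuous_bounded_cube c r cf.
apply: (@le_lt_trans _ _ (\int[mu]_(x in K) (cst C%:E) x)%E).
  apply: ge0_le_integral => //.
  - apply/measurable_EFinP; under eq_fun do rewrite powRr1//.
    apply: measurable_funTS; apply: measurableT_comp => //.
    exact: continuous_measurable_rV.
  - by move=> x Kx; rewrite lee_fin powRr1// HC//; exact: Kcr.
rewrite integral_cst// lte_mul_pinfty// ?lee_fin//.
apply: le_lt_trans (cube_lty c r); apply: le_measure; rewrite ?inE//.
exact: measurable_cube.
Qed.

End rV_measure.

(** * Measures on R^n are determined by their values on open boxes *)

Section box_unique.
Context {R : realType} {n : nat}.

Definition oboxes : set (set 'rV[R]_n) := [set A | exists a b, A = obox a b].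

Lemma oboxes_setI : setI_closed oboxes.
Proof.
move=> A B [a [b ->]] [c [d ->]].
exists (\row_i Num.max (a ord0 i) (c ord0 i)), (\row_i Num.min (b ord0 i) (d ord0 i)).
apply/seteqP; split => x /=.
  by move=> [H1 H2] i; rewrite !mxE gt_max lt_min; case/andP: (H1 i) => -> ->; case/andP: (H2 i) => -> ->.
move=> H; split => i; have := H i; rewrite !mxE gt_max lt_min.
  by move=> /andP[/andP[-> _] /andP[-> _]].
by move=> /andP[/andP[_ ->] /andP[_ ->]].
Qed.

Definition bigbox (k : nat) : set 'rV[R]_n := obox (const_mx (- k%:R)) (const_mx k%:R).

Lemma bigbox_cover : \bigcup_k bigbox k = setT.
Proof.
rewrite -subTset => x _.
have [k kx] : exists k : nat, forall i, `|x ord0 i| < k%:R.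
  exists (Num.truncn (\sum_i `|x ord0 i|)).+1 => i.
  apply: le_lt_trans (truncnS_gt _).
  by rewrite (bigD1 i)//= lerDl sumr_ge0.
by exists k => // i; rewrite !mxE -ltr_norml.
Qed.

Lemma measurable_rV_oboxes : (@measurable _ 'rV[R]_n) = <<s oboxes >>.
Proof.
apply/seteqP; split; last first.
  apply: smallest_sub; first exact: sigma_algebra_measurable.
  by move=> A [a [b ->]]; exact: measurable_obox.
apply: smallest_sub; first exact: smallest_sigma_algebra.
move=> A; rewrite -bigcup_seq/= => -[i _ [B mB <-]]; rewrite setTI.
pose T := g_sigma_algebraType oboxes.
have : measurable_fun [set: T] (fun x : T => (x : 'rV[R]_n) ord0 i).
  apply: (measurability _ (RGenOpens.measurableE R)) => _ [_ [a [b ->]] <-].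
  rewrite setTI.
  have -> : ((fun x : 'rV[R]_n => x ord0 i) @^-1` `]a, b[) =
      \bigcup_k (obox (\row_j if j == i then a else - k%:R)
                      (\row_j if j == i then b else k%:R)).
    apply/seteqP; split => [x|x [k _ H]]; last first.
      by have := H i; rewrite !mxE eqxx /= in_itv.
    rewrite /= in_itv/= => xab.
    have : setT x by [].
    rewrite -bigbox_cover => -[k _ kx]; exists k => // j; rewrite !mxE.
    by case: eqP => [->//|_]; have := kx j; rewrite !mxE.
  apply: (@bigcupT_measurable _ T) => k; apply: sub_sigma_algebra.
  by eexists; eexists.
by move=> /(_ measurableT _ mB); rewrite setTI.
Qed.

Lemma obox_unique (m1 m2 : {measure set 'rV[R]_n -> \bar R}) :
  (forall a b, m1 (obox a b) = m2 (obox a b)) -> (forall k, (m1 (bigbox k) < +oo)%E) ->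
  forall A, measurable A -> m1 A = m2 A.
Proof.
move=> m12 fin A mA.
apply: (measure_unique oboxes bigbox) => //.
- exact: measurable_rV_oboxes.
- exact: oboxes_setI.
- by move=> k; eexists; eexists.
- exact: bigbox_cover.
- by move=> _ [a [b ->]].
Qed.

Lemma bigbox_lty k : (@lebesgue_rV R n (bigbox k) < +oo)%E.
Proof.
apply: le_lt_trans (cube_lty 0 k%:R).
apply: le_measure; rewrite ?inE; [exact: measurable_obox|exact: measurable_cube|].
by move=> x xk i; have := xk i; rewrite !mxE subr0 -ltr_norml => /ltW.
Qed.

End box_unique.

(** * Fubini's theorem along an arbitrary coordinate *)

Section insertion.
Context {R : realType} {n : nat} (i : 'I_n.+1).
Local Notation leb := (@lebesgue_measure R).
Local Notation mu := (@lebesgue_rV R n).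

(** Lebesgue measure is built by splitting off coordinate 0; inserting [t] at position [i] instead
    gives the lines in direction [i]. *)
Definition ins (p : measurableTypeR R * 'rV[R]_n) : 'rV[R]_n.+1 :=
  \row_j (if unlift i j is Some k then p.2 ord0 k else p.1).

Lemma ins_at t v : ins (t, v) ord0 i = t.
Proof. by rewrite mxE unlift_none. Qed.

Lemma ins_lift t v j : ins (t, v) ord0 (lift i j) = v ord0 j.
Proof. by rewrite mxE liftK. Qed.

Lemma measurable_ins : measurable_fun [set: measurableTypeR R * 'rV[R]_n] ins.
Proof.
apply: measurable_fun_rV => j.
under eq_fun do rewrite mxE.
case: (unlift i j) => [k|]; last exact: measurable_fst.
exact: (@measurableT_comp _ _ _ _ _ _ (fun x : 'rV[R]_n => x ord0 k) _ snd
  (measurable_coord k) (measurable_snd)).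
Qed.

(** On a box both measures are the product of the side lengths, taken in a different order, and
    boxes determine the measure. *)
Lemma lebesgue_ins (A : set 'rV[R]_n.+1) : measurable A ->
  @lebesgue_rV R n.+1 A = pushforward (leb \x mu)%E ins A.
Proof.
pose m2 := measure_function_pushforward__canonical__measure_function_Measure (leb \x mu)%E measurable_ins.
apply: (@obox_unique _ _ (@lebesgue_rV R n.+1) m2); last by move=> k; exact: bigbox_lty.
move=> a b; rewrite /= /pushforward.
have -> : ins @^-1` obox a b =
   `]a ord0 i, b ord0 i[ `*` obox (\row_j a ord0 (lift i j)) (\row_j b ord0 (lift i j)).
  apply/seteqP; split => -[t v] /=.
    move=> H; split; first by have := H i; rewrite ins_at in_itv.
    by move=> j; have := H (lift i j); rewrite ins_lift !mxE.
  rewrite in_itv/= => -[H1 H2] j.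
  case: (unliftP i j) => [k ->|->]; last by rewrite ins_at.
  by rewrite ins_lift; have := H2 k; rewrite !mxE.
rewrite product_measure1E//; last exact: measurable_obox.
rewrite oboxE (@lebesgue_rV_box _ _ (fun j => `]a ord0 j, b ord0 j[%classic)); last by move=> j.
rewrite (bigD1_ord i)//=; congr (_ * _)%E.
rewrite oboxE (@lebesgue_rV_box _ _ (fun j => `](\row_j a ord0 (lift i j)) ord0 j, (\row_j b ord0 (lift i j)) ord0 j[%classic)); last by move=> j.
by apply: eq_bigr => j _; rewrite !mxE.
Qed.

Lemma integral_ins_ge0 (f : 'rV[R]_n.+1 -> \bar R) : measurable_fun setT f ->
  (forall x, 0 <= f x)%E ->
  (\int[@lebesgue_rV R n.+1]_x f x = \int[mu]_v \int[leb]_t f (ins (t, v)))%E.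
Proof.
move=> mf f0.
pose m2 := measure_function_pushforward__canonical__measure_function_Measure (leb \x mu)%E measurable_ins.
rewrite (eq_measure_integral m2); last by move=> A mA _; exact: lebesgue_ins.
rewrite ge0_integral_pushforward//; last exact: measurable_ins.
rewrite preimage_setT fubini_tonelli2//=.
by apply: measurableT_comp => //; exact: measurable_ins.
Qed.

Lemma integrable_ins (f : 'rV[R]_n.+1 -> \bar R) :
  (@lebesgue_rV R n.+1).-integrable setT f ->
  (leb \x mu)%E.-integrable setT (f \o ins).
Proof.
move=> /integrableP[mf foo]; apply/integrableP.
have mfi : measurable_fun setT (f \o ins).
  by apply: measurableT_comp => //; exact: measurable_ins.
split => //; rewrite fubini_tonelli2//=; last exact: measurableT_comp.
have maf : measurable_fun setT (abse \o f) by exact: measurableT_comp.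
have E := integral_ins_ge0 maf (fun x => abse_ge0 _).
by apply: le_lt_trans foo; rewrite le_eqVlt; apply/orP; left; apply/eqP; exact: (esym E).
Qed.

Lemma integral_ins (f : 'rV[R]_n.+1 -> \bar R) :
  (@lebesgue_rV R n.+1).-integrable setT f ->
  (\int[@lebesgue_rV R n.+1]_x f x = \int[mu]_v \int[leb]_t f (ins (t, v)))%E.
Proof.
move=> fi; have fii := integrable_ins fi.
pose m2 := measure_function_pushforward__canonical__measure_function_Measure (leb \x mu)%E measurable_ins.
rewrite (eq_measure_integral m2); last by move=> A mA _; exact: lebesgue_ins.
rewrite integral_pushforward//; last 2 first.
  exact: measurable_ins.
  by have /integrableP[] := fi.
rewrite preimage_setT.
have := integral21_prod_meas1 fii.
by move=> <-.
Qed.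

End insertion.

Section expinv_bounds.
Context {R : realType}.
Implicit Types t : R.

Lemma expinv_ge0 t : 0 <= expinv t.
Proof. by rewrite /expinv/pexpinv; case: ifP => // _; rewrite hornerC mul1r expR_ge0. Qed.

Lemma expinv_gt0 t : 0 < t -> 0 < expinv t.
Proof. by rewrite /expinv/pexpinv => ->; rewrite hornerC mul1r expR_gt0. Qed.

Lemma expinv_le1 t : expinv t <= 1.
Proof.
rewrite /expinv/pexpinv; case: ifP => // t0; rewrite hornerC mul1r.
by rewrite -expR0 ler_expR lerNl oppr0 invr_ge0 ltW.
Qed.

Lemma expinv_cvg1 t : 0 < t -> expinv (k.+1%:R * t) @[k --> \oo] --> (1 : R).
Proof.
move=> t0.
have -> : (fun k => expinv (k.+1%:R * t)) = (fun k => expR (- (t^-1 * harmonic k))).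
  apply/boolp.funext => k; rewrite /expinv/pexpinv mulr_gt0 ?ltr0n// hornerC mul1r.
  by rewrite invfM mulrC.
rewrite -expR0; apply: continuous_cvg; first exact: continuous_expR.
rewrite -oppr0; apply: cvgN; rewrite -[X in _ --> X](mulr0 t^-1).
by apply: cvgMr; exact: cvg_harmonic.
Qed.

End expinv_bounds.

(** * The fundamental lemma of the calculus of variations *)

Section bump.
Context {R : realType} {n : nat}.
Local Notation mu := (@lebesgue_rV R n).
Implicit Types (a b x : 'rV[R]_n) (H : 'rV[R]_n -> R).

(** As [expinv] vanishes on negative numbers and [expinv (k t)] tends to 1 for t > 0, these smooth
    functions with values in [0, 1] converge pointwise to the indicator of the open box. *)
Definition boxbump k a b x : R := \prod_(j < n)
  (expinv (k.+1%:R * (x ord0 j - a ord0 j)) * expinv (k.+1%:R * (b ord0 j - x ord0 j))).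

Lemma bump_ge0 k a b x : 0 <= boxbump k a b x.
Proof. by apply: prodr_ge0 => j _; rewrite mulr_ge0 ?expinv_ge0. Qed.

Lemma bump_le1 k a b x : boxbump k a b x <= 1.
Proof.
apply: prodr_ile1 => j _; rewrite mulr_ge0 ?expinv_ge0//=.
by rewrite mulr_ile1 ?expinv_ge0 ?expinv_le1.
Qed.

Lemma bump_out k a b x : ~ obox a b x -> boxbump k a b x = 0.
Proof.
move=> /existsNP[j /negP]; rewrite negb_and -!leNgt => H.
rewrite /boxbump (bigD1 j)//=; suff -> : expinv (k.+1%:R * (x ord0 j - a ord0 j)) *
  expinv (k.+1%:R * (b ord0 j - x ord0 j)) = 0 :> R by rewrite mul0r.
case/orP: H => H.
  by rewrite [X in X * _]pexpinv_le0 ?mul0r// pmulr_rle0 ?ltr0n// subr_le0.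
by rewrite [X in _ * X]pexpinv_le0 ?mulr0// pmulr_rle0 ?ltr0n// subr_le0.
Qed.

Lemma Ck_bump k a b m : Ck (fun i : 'I_n => delta_mx ord0 i) m (boxbump k a b).
Proof.
apply: Ck_prod => j; apply: CkM; apply: Ck_pexpinv; apply: CkZ; apply: CkD.
- exact: Ck_coord.
- exact: Ck_cst.
- exact: Ck_cst.
- rewrite (_ : (fun y : 'rV[R]_n => _) = fun y => (-1) * y ord0 j).
    by apply: CkZ; exact: Ck_coord.
  by apply/boolp.funext => y; rewrite mulN1r.
Qed.

Lemma continuous_bump k a b : continuous (boxbump k a b).
Proof. exact: (Ck_continuous (Ck_bump k a b 0)). Qed.

Lemma bump_cvg a b x : boxbump k a b x @[k --> \oo] --> (\1_(obox a b) x : R).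
Proof.
rewrite indicE; case: (boolP (x \in obox a b)) => [|].
  rewrite inE => xab; rewrite -[X in _ --> X](_ : \prod_(j < n) (1 * 1) = 1 :> R); last first.
    by rewrite big1// => j _; rewrite mulr1.
  apply: cvg_big => //; first by move=> y; exact: mul_continuous.
  move=> j _; have /andP[H1 H2] := xab j.
  by apply: cvgM; apply: expinv_cvg1; rewrite subr_gt0.
rewrite notin_setE => xab; apply: cvg_near_cst; apply: nearW => k.
exact: bump_out.
Qed.

Lemma obox_sub_cube a b : exists r, obox a b `<=` cube 0 r.
Proof.
exists (\sum_j (`|a ord0 j| + `|b ord0 j|)) => x xab i.
rewrite mxE subr0; have /andP[H1 H2] := xab i.
rewrite (bigD1 i)//=; apply: ler_wpDr; first by apply: sumr_ge0 => j _; rewrite addr_ge0.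
have := ler_norm (- a ord0 i); have := ler_norm (b ord0 i).
have := normr_ge0 (a ord0 i); have := normr_ge0 (b ord0 i).
rewrite normrN ler_norml => *; apply/andP; split; lra.
Qed.

Lemma bump_supp k a b : exists r, forall x, boxbump k a b x != 0 -> cube 0 r x.
Proof.
have [r Hr] := obox_sub_cube a b; exists r => x bx; apply: Hr.
by apply: contrapT => /(bump_out k) b0; rewrite b0 eqxx in bx.
Qed.

Lemma integral_obox_bump H a b : Lloc 1 H ->
  (forall k, \int[mu]_x (H x * boxbump k a b x) = 0) ->
  (\int[mu]_(x in obox a b) (H x)%:E = 0)%E.
Proof.
move=> lH H0.
have [r Hr] := obox_sub_cube a b.
have mH : measurable_fun setT H by case: lH.
have mb k : measurable_fun setT (boxbump k a b).
  by apply: continuous_measurable_rV; exact: continuous_bump.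
have [] := @dominated_convergence _ _ _ mu setT measurableT
  (fun k x => (H x * boxbump k a b x)%:E) (fun x => (H x * \1_(obox a b) x)%:E)
  (fun x => `|H x * \1_(cube 0 r) x|%:E).
- by move=> k; apply/measurable_EFinP; exact: measurable_funM.
- apply/measurable_EFinP; apply: measurable_funM => //.
  by apply: measurable_indic; exact: measurable_obox.
- apply: nearW => x _; apply/fine_cvgP; split; first exact: nearW.
  by apply: cvgMr; exact: bump_cvg.
- have := @integrable_cube_supp R n H (\1_(cube 0 r)) 0 r 1 lH.
  move=> /(_ _ _ _)/integrable_abse; apply.
  + by apply: measurable_indic; exact: measurable_cube.
  + by move=> x; rewrite indicE; case: (_ \in _); rewrite ?normr1 ?normr0.
  + by move=> x; rewrite indicE; case: (boolP (_ \in _)); rewrite ?inE ?eqxx.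
- apply: nearW => x k _; rewrite lee_fin !normrM ler_wpM2l//.
  rewrite (ger0_norm (bump_ge0 _ _ _ _)) ger0_norm ?indicE ?ler0n//.
  case: (boolP (x \in cube 0 r)) => [_|]; first exact: bump_le1.
  rewrite notin_setE => xr; rewrite bump_out//; by move=> /Hr.
move=> _ _.
have -> : (fun k => \int[mu]_x (H x * boxbump k a b x)%:E)%E = (fun=> 0%E).
  apply/boolp.funext => k; have [r' Hr'] := bump_supp k a b.
  transitivity ((\int[mu]_x (H x * boxbump k a b x))%:E); last by rewrite H0.
  rewrite /Rintegral fineK//.
  apply: integrable_fin_num => //.
  apply: (@integrable_cube_supp _ _ _ _ 0 r' 1) => //.
  by move=> x; rewrite ger0_norm ?bump_ge0 ?bump_le1.
move=> /cvg_lim L; transitivity (\int[mu]_x (H x * \1_(obox a b) x)%:E)%E.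
  rewrite [LHS]integral_mkcond; apply: eq_integral => x _.
  by rewrite patchE indicE; case: (_ \in _); rewrite ?mulr1 ?mulr0.
by rewrite -L// lim_cst.
Qed.

(** Inside a fixed large box, where [H] is integrable, the sets over which [H] integrates to 0 form
    a Dynkin system containing the boxes. Hence they are all the measurable sets, and [H] vanishes
    almost everywhere there. *)
Lemma ae_eq0_obox H : Lloc 1 H ->
  (forall a b, (\int[mu]_(x in obox a b) (H x)%:E = 0)%E) ->
  {ae mu, forall x, H x = 0}.
Proof.
move=> lH H0.
have Hint N : mu.-integrable (bigbox N) (EFin \o H).
  have [r Hr] := @obox_sub_cube (const_mx (- N%:R)) (const_mx N%:R).
  apply: (integrableS _ _ Hr) (Lloc1_integrable 0 r lH).
    exact: measurable_cube.
  exact: measurable_obox.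
have mQ N : measurable (@bigbox R n N) by exact: measurable_obox.
have key N A : measurable A -> (\int[mu]_(x in bigbox N `&` A) (H x)%:E = 0)%E.
  move=> mA.
  apply: (dynkin_induction (G := oboxes)
    (P := [set A | (\int[mu]_(x in bigbox N `&` A) (H x)%:E = 0)%E])) => /=.
  - exact: measurable_rV_oboxes.
  - exact: oboxes_setI.
  - by rewrite setIT; exact: H0.
  - move=> B [a [b ->]].
    have [a' [b' E]] : oboxes (bigbox N `&` obox a b).
      by apply: oboxes_setI; eexists; eexists.
    by rewrite /= E; exact: H0.
  - move=> S mS S0.
    have : (\int[mu]_(x in (bigbox N `&` S) `|` (bigbox N `&` ~` S)) (H x)%:E = 0)%E.
      by rewrite -setIUr setUv setIT; exact: H0.
    rewrite integral_setU//; first by rewrite S0 add0e.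
    + exact: measurableI.
    + by apply: measurableI => //; exact: measurableC.
    + by apply/measurable_EFinP; apply: measurable_funTS; case: lH.
    + by apply/disj_setPS => x [[_ ?] [_ ?]].
  - move=> F mF tF F0; rewrite setI_bigcupr integral_bigcup.
    + by apply: eseries0 => k _ _; exact: F0.
    + exact: trivIset_setIl.
    + by move=> k; exact: measurableI.
    + apply: (integrableS (mQ N)) (Hint N) => //.
        by apply: bigcup_measurable => k _; exact: measurableI.
      by move=> x [k _ []].
  - by rewrite -measurable_rV_oboxes.
have ae N : ae_eq mu (bigbox N) (EFin \o H) (cst 0%E).
  apply: integral_ae_eq => // E EQ mE.
  rewrite integral_cst// mul0e; have := key N E mE.
  by rewrite setIidr.
have : {ae mu, forall x N, bigbox N x -> H x = 0}.
  apply: ae_foralln => N; apply: filterS (ae N) => x Hx xN.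
  by have := Hx xN => -[].
apply: filterS => x Hx.
have : setT x by []. rewrite -bigbox_cover => -[N _ xN]; exact: Hx xN.
Qed.

(** The tests are restricted to an explicit family of bumps, so that they can later be multiplied by
    a function of one further coordinate. *)
Lemma ae_eq0_bump H : Lloc 1 H ->
  (forall k a b, \int[mu]_x (H x * boxbump k a b x) = 0) ->
  {ae mu, forall x, H x = 0}.
Proof.
move=> lH H0; apply: ae_eq0_obox => // a b.
by apply: integral_obox_bump => // k.
Qed.

End bump.

Lemma is_derive_congr {R : realType} {V : normedModType R} (f g : V -> R) (x v : V) (a b : R) :
  is_derive x v f a -> f =1 g -> a = b -> is_derive x v g b.
Proof. by move=> D fg <-; exact: is_derive_ext D. Qed.

(** * Second derivatives on level sets *)

Section smooth_ramp.
Context {R : realType}.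
Local Notation leb := (@lebesgue_measure R).
Implicit Types (t p q r : R) (a b f : R -> R).

Lemma smooth1_id : smooth1 (id : R -> R).
Proof.
move=> k; apply: (@Ck_affine _ _ _ _ _ _ (fun=> 1)) => [x|i x h]; first exact: cvg_id.
by [].
Qed.

Lemma smooth1_cst (c : R) : smooth1 (cst c).
Proof. by move=> k; exact: Ck_cst. Qed.

Lemma smooth1D a b : smooth1 a -> smooth1 b -> smooth1 (fun t => a t + b t).
Proof. by move=> ha hb k; exact: CkD. Qed.

Lemma smooth1M a b : smooth1 a -> smooth1 b -> smooth1 (fun t => a t * b t).
Proof. by move=> ha hb k; exact: CkM. Qed.

Lemma smooth1_expinv a : smooth1 a -> smooth1 (fun t => expinv (a t)).
Proof. by move=> ha k; exact: Ck_pexpinv. Qed.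

Lemma is_derive1_affine a (c d t : R) : smooth1 a ->
  is_derive t 1 (fun x => a (c * x + d)) (derive1 a (c * t + d) * c).
Proof.
move=> as1; apply: (@is_derive1_comp _ a (fun x => c * x + d)).
  exact: smooth1_derivable.
have := is_deriveD (is_deriveZ c (is_derive_id t (1:R))) (is_derive_cst d t (1:R)).
by rewrite addr0 [_ *: _]mulr1.
Qed.

Lemma smooth1_affine a (c d : R) : smooth1 a -> smooth1 (fun t => a (c * t + d)).
Proof.
move=> as1 k; elim: k a as1 => [|k IH] a as1.
  split => // t; apply: (@continuous_comp _ _ _ (fun x => c * x + d) a).
    by apply: cvgD; [apply: cvgM; [exact: cvg_cst|exact: cvg_id]|exact: cvg_cst].
  exact: smooth1_continuous.
refine (@Ck_derive _ _ _ _ _ _ (fun _ t => derive1 a (c * t + d) * c) _ _ _).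
- move=> t; apply/differentiable_continuous/derivable1_diffP.
  by have [] := is_derive1_affine c d t as1.
- by move=> _ t; exact: is_derive1_affine.
- by move=> _; apply: CkM; [exact/IH/smooth1_derive1|exact: Ck_cst].
Qed.

(* A smooth step, then smoothings [ramp k p] of [max (t - p) 0] at scale [1 / k.+1] with
   their first two derivatives [rampD] and [rampDD]. *)
Definition sstep t : R := expinv (1 + t) / (expinv (1 + t) + expinv (1 - t)).

Lemma sstep_den t : 0 < expinv (1 + t) + expinv (1 - t).
Proof.
have [t0|t0] := ltP 0 t.
  by rewrite ltr_pwDl ?expinv_ge0// expinv_gt0// addr_gt0.
by rewrite ltr_wpDl ?expinv_ge0// expinv_gt0//; lra.
Qed.

Lemma smooth1_sstep : smooth1 sstep.
Proof.
have sl : smooth1 (fun t : R => expinv (1 + t)).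
  by apply: smooth1_expinv; apply: smooth1D; [exact: smooth1_cst|exact: smooth1_id].
have sr : smooth1 (fun t : R => expinv (1 - t)).
  rewrite (_ : (fun _ => _) = fun t => expinv ((-1) * t + 1)); last first.
    by apply/boolp.funext => t; rewrite mulN1r addrC.
  by apply: (@smooth1_affine expinv); move=> k; apply: Ck_pexpinv; exact: smooth1_id.
apply: smooth1M => // k; apply: CkV => [t|]; first by rewrite gt_eqF// sstep_den.
exact: smooth1D.
Qed.

Lemma sstep_ge0 t : 0 <= sstep t.
Proof. by rewrite divr_ge0 ?expinv_ge0// ltW// sstep_den. Qed.

Lemma sstep_le1 t : sstep t <= 1.
Proof. by rewrite ler_pdivrMr ?sstep_den// mul1r lerDl expinv_ge0. Qed.

Lemma sstep_lo t : t <= -1 -> sstep t = 0.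
Proof. by move=> t1; rewrite /sstep [expinv (1 + t)]pexpinv_le0 ?mul0r//; lra. Qed.

Lemma sstep_hi t : 1 <= t -> sstep t = 1.
Proof.
move=> t1; have := sstep_den t; rewrite /sstep [expinv (1 - t)]pexpinv_le0; last lra.
by rewrite addr0 => ?; rewrite divff// gt_eqF.
Qed.

(** Multiplying the step by [t], rather than integrating it, already gives a smooth function equal
    to max(t, 0) for |t| >= 1. *)
Definition sramp t : R := t * sstep t.

Lemma smooth1_sramp : smooth1 sramp.
Proof. by apply: smooth1M; [exact: smooth1_id|exact: smooth1_sstep]. Qed.

Lemma sramp_approx t : `|sramp t - Num.max t 0| <= 1.
Proof.
rewrite /sramp; have := sstep_ge0 t; have := sstep_le1 t.
have [t1|t1] := leP t (-1).
  by rewrite sstep_lo// mulr0 max_r ?subrr ?normr0//; lra.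
have [t2|t2] := leP 1 t.
  by rewrite sstep_hi// mulr1 max_l ?subrr ?normr0//; lra.
move: (sstep t) => s s1 s0; rewrite ler_norml.
have [t0|t0] := leP t 0; apply/andP; split; nra.
Qed.

Lemma derive1_sramp_hi t : 1 < t -> derive1 sramp t = 1.
Proof.
move=> t1; rewrite derive1E.
rewrite (@near_eq_derive _ _ _ sramp id); first by rewrite derive_id.
near=> x; rewrite /sramp sstep_hi ?mulr1//; apply/ltW; near: x; exact: lt_nbhsr.
Unshelve. all: by end_near. Qed.

Lemma derive1_sramp_lo t : t < -1 -> derive1 sramp t = 0.
Proof.
move=> t1; rewrite derive1E.
rewrite (@near_eq_derive _ _ _ sramp (cst 0)); first by rewrite derive_cst.
near=> x; rewrite /sramp sstep_lo ?mulr0//; apply/ltW; near: x; exact: lt_nbhsl.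
Unshelve. all: by end_near. Qed.

(** A mollifier: it lives in [-1, 1] and has integral 1, but it changes sign. *)
Definition sbump : R -> R := derive1 (derive1 sramp).

Lemma smooth1_sbump : smooth1 sbump.
Proof. by do 2!apply: smooth1_derive1; exact: smooth1_sramp. Qed.

Lemma sbump_out t : 1 < `|t| -> sbump t = 0.
Proof.
rewrite /sbump lter_normr derive1E => /orP[t1|t1].
  rewrite (@near_eq_derive _ _ _ (derive1 sramp) (cst 1)); first by rewrite derive_cst.
  by near=> x; rewrite derive1_sramp_hi//; near: x; exact: lt_nbhsr.
rewrite (@near_eq_derive _ _ _ (derive1 sramp) (cst 0)); first by rewrite derive_cst.
near=> x; rewrite derive1_sramp_lo//; near: x; apply: lt_nbhsl; lra.
Unshelve. all: by end_near. Qed.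

Lemma sbump_bound : exists2 C : R, 0 <= C & forall t, `|sbump t| <= C.
Proof.
have [C [_ HC]] : bounded_set (sbump @` `[(-1), 1]).
  apply: compact_bounded; apply: continuous_compact; last exact: segment_compact.
  by apply: continuous_subspaceT; exact: smooth1_continuous smooth1_sbump.
exists (`|C| + 1); first by rewrite addr_ge0.
move=> t; have [t1|t1] := leP `|t| 1; last by rewrite sbump_out// normr0 addr_ge0.
apply: HC; first by rewrite ltr_pwDr// ler_norm.
by exists t => //; rewrite /= in_itv/= -ler_norml.
Qed.

Definition ramp k p t : R := sramp (k.+1%:R * (t - p)) / k.+1%:R.
Definition rampD k p t : R := derive1 sramp (k.+1%:R * (t - p)).
Definition rampDD k p t : R := k.+1%:R * sbump (k.+1%:R * (t - p)).

Lemma smooth1_ramp k p : smooth1 (ramp k p).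
Proof.
rewrite (_ : ramp k p = fun t => sramp (k.+1%:R * t + (- (k.+1%:R * p))) * k.+1%:R^-1).
  by apply: smooth1M; [apply: smooth1_affine; exact: smooth1_sramp|exact: smooth1_cst].
by apply/boolp.funext => t; rewrite /ramp mulrBr.
Qed.

Lemma is_derive_ramp k p t : is_derive t 1 (ramp k p) (rampD k p t).
Proof.
have D := is_derive1_affine k.+1%:R (- (k.+1%:R * p)) t smooth1_sramp.
apply: (is_derive_congr (is_deriveZ (k.+1%:R^-1 : R) D)).
  move=> x; change (k.+1%:R^-1 * sramp (k.+1%:R * x + (- (k.+1%:R * p))) = ramp k p x).
  by rewrite /ramp mulrBr mulrC.
by rewrite /rampD [LHS]mulrC -mulrA divff ?pnatr_eq0// mulr1 mulrBr.
Qed.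

Lemma is_derive_rampD k p t : is_derive t 1 (rampD k p) (rampDD k p t).
Proof.
have D := is_derive1_affine k.+1%:R (- (k.+1%:R * p)) t (smooth1_derive1 smooth1_sramp).
apply: (is_derive_congr D) => [x|]; first by rewrite /rampD mulrBr.
by rewrite /rampDD mulrC mulrBr.
Qed.

Lemma continuous_rampDD k p : continuous (rampDD k p).
Proof.
have S : smooth1 (fun t => sbump (k.+1%:R * t + (- (k.+1%:R * p))) * k.+1%:R).
  by apply: smooth1M; [apply: smooth1_affine; exact: smooth1_sbump|exact: smooth1_cst].
rewrite (_ : rampDD k p = fun t => sbump (k.+1%:R * t + (- (k.+1%:R * p))) * k.+1%:R).
  exact: smooth1_continuous.
by apply/boolp.funext => t; rewrite /rampDD mulrBr mulrC.
Qed.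

Lemma rampDD_out k p t : k.+1%:R^-1 < `|t - p| -> rampDD k p t = 0.
Proof.
move=> H; rewrite /rampDD sbump_out ?mulr0// normrM ger0_norm//.
by rewrite -ltr_pdivrMl// mulr1.
Qed.

Lemma ramp_approx k p t : `|ramp k p t - Num.max (t - p) 0| <= k.+1%:R^-1.
Proof.
have k0 : 0 < k.+1%:R :> R by rewrite ltr0n.
have -> : Num.max (t - p) 0 = Num.max (k.+1%:R * (t - p)) 0 / k.+1%:R.
  have [h|h] := leP (t - p) 0; first by rewrite max_r ?mul0r// pmulr_rle0.
  by rewrite max_l ?mulr_ge0 ?ltW// mulrAC divff ?mul1r// gt_eqF.
rewrite -mulrBl normrM [X in _ * X]ger0_norm ?invr_ge0// ler_piMl ?invr_ge0//.
exact: sramp_approx.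
Qed.

Lemma ramp_lo k p t : t <= p - 1 -> ramp k p t = 0.
Proof.
move=> tp; rewrite /ramp /sramp sstep_lo ?mulr0 ?mul0r//.
have : 1 <= k.+1%:R :> R by rewrite ler1n.
nra.
Qed.

Lemma ramp_hi k p t : p + 1 <= t -> ramp k p t = t - p.
Proof.
move=> tp; rewrite /ramp /sramp sstep_hi ?mulr1.
  by rewrite mulrAC divff ?mul1r// pnatr_eq0.
have : 1 <= k.+1%:R :> R by rewrite ler1n.
nra.
Qed.

End smooth_ramp.

Section supported_integrals.
Context d (T : measurableType d) (R : realType) (mu : {measure set T -> \bar R}).
Implicit Types (F k : T -> R) (A : set T).

Lemma integrable_supp F k A (b : R) : measurable A -> mu.-integrable A (EFin \o F) ->
  measurable_fun setT k -> (forall y, `|k y| <= b) -> (forall y, ~ A y -> k y = 0) ->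
  mu.-integrable setT (EFin \o (fun y => F y * k y)).
Proof.
move=> mA FA mk kb ks.
rewrite [X in mu.-integrable _ X](_ : _ = (EFin \o (fun y => F y * k y)) \_ A).
  apply/(integrable_mkcond _ mA).
  apply: (@integrableMl _ _ _ mu A mA (EFin \o F) k FA).
    exact: measurable_funTS.
  exists b; split; first exact: num_real.
  by move=> x bx y _; rewrite /= (le_trans (kb y))// ltW.
apply/funext => y; rewrite patchE; case: ifPn => //.
by rewrite notin_setE => yc; rewrite /= ks// mulr0.
Qed.

Lemma Rintegral_supp_bound F k A (b : R) : measurable A -> mu.-integrable A (EFin \o F) ->
  measurable_fun setT k -> (forall y, `|k y| <= b) -> (forall y, ~ A y -> k y = 0) ->
  `|\int[mu]_y (F y * k y)| <= b * \int[mu]_(y in A) `|F y|.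
Proof.
move=> mA FA mk kb ks.
have iFk := integrable_supp mA FA mk kb ks.
apply: (le_trans (le_normr_Rintegral measurableT iFk)).
rewrite -RintegralZl//; last exact: integrable_norm.
rewrite [leRHS]Rintegral_mkcond.
apply: le_Rintegral => //.
- exact: integrable_norm.
- rewrite -restrict_EFin; apply/(integrable_mkcond _ mA).
  rewrite (_ : _ \o _ = fun y => (b%:E * (EFin \o (fun y => `|F y|)%R) y)%E).
    by apply: integrableZl => //; exact: integrable_norm.
  by apply/funext => y /=; rewrite EFinM.
- move=> y _; rewrite patchE; case: ifPn => [_|].
    by rewrite normrM mulrC ler_wpM2r.
  by rewrite notin_setE => yA; rewrite ks// mulr0 normr0.
Qed.

End supported_integrals.

Section line.
Context {R : realType}.
Local Notation leb := (@lebesgue_measure R).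
Implicit Types (t p q r c e : R) (f g W h : R -> R).

Definition locint W := measurable_fun setT W /\
  forall l r, leb.-integrable `[l, r] (EFin \o W).

Lemma locint_continuous f : continuous f -> locint f.
Proof.
move=> cf; split; first exact: continuous_measurable_fun.
move=> l r; apply: continuous_compact_integrable; first exact: segment_compact.
exact: continuous_subspaceT.
Qed.

Lemma locint_cst c : locint (cst c).
Proof. by apply: locint_continuous => t; exact: cvg_cst. Qed.

Lemma locint_integrable W h l r (b : R) : locint W -> measurable_fun setT h ->
  (forall t, `|h t| <= b) -> (forall t, ~ `[l, r]%classic t -> h t = 0) ->
  leb.-integrable setT (EFin \o (fun t => W t * h t)).
Proof.
move=> [mW iW] mh hb hs.
exact: (@integrable_supp _ (measurableTypeR R) R leb _ _ _ _ (measurable_itv `[l, r]) (iW l r) mh hb hs).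
Qed.

Lemma locint_bound W h l r (b : R) : locint W -> measurable_fun setT h ->
  (forall t, `|h t| <= b) -> (forall t, ~ `[l, r]%classic t -> h t = 0) ->
  `|\int[leb]_t (W t * h t)| <= b * \int[leb]_(t in `[l, r]) `|W t|.
Proof.
move=> [mW iW] mh hb hs.
exact: (@Rintegral_supp_bound _ (measurableTypeR R) R leb _ _ _ _ (measurable_itv `[l, r]) (iW l r) mh hb hs).
Qed.

Lemma Rintegral_bound h l r (b : R) : l <= r -> measurable_fun setT h ->
  (forall t, `|h t| <= b) -> (forall t, ~ `[l, r]%classic t -> h t = 0) ->
  `|\int[leb]_t h t| <= b * (r - l).
Proof.
move=> lr mh hb hs.
have := @locint_bound (cst 1) h l r b (locint_cst 1) mh hb hs.
have -> : \int[leb]_t (cst 1 t * h t) = \int[leb]_t h t.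
  by apply: eq_Rintegral => t _; rewrite /= mul1r.
move=> /le_trans; apply.
rewrite (_ : \int[leb]_(t in `[l, r]) _ = r - l)//.
transitivity (\int[leb]_(t in `[l, r]) (1 : R)).
  by apply: eq_Rintegral => t _; rewrite /= normr1.
have E := @lebesgue_measure_itv R `[l, r]; rewrite /= lte_fin in E.
rewrite Rintegral_cst// mul1r; transitivity (fine (if (l < r)%R then r%:E - l%:E else 0)%E).
  by congr fine; exact: E.
by case: ltgtP lr => // -> _; rewrite subrr.
Qed.

Lemma measurable_rampDD k p : measurable_fun setT (rampDD k p : R -> R).
Proof. by apply: continuous_measurable_fun; exact: continuous_rampDD. Qed.

Lemma rampDD_supp k p t (l r : R) : l <= p - k.+1%:R^-1 -> p + k.+1%:R^-1 <= r ->
  ~ `[l, r]%classic t -> rampDD k p t = 0.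
Proof.
move=> lp pr; rewrite /= in_itv/= => /negP; rewrite negb_and -!ltNge => H.
apply: rampDD_out; rewrite lter_normr; apply/orP.
move: lp pr; set w := _^-1 => lp pr.
by case/orP: H => H; [right|left]; lra.
Qed.

Lemma integral_rampDD k p : \int[leb]_t rampDD k p t = 1.
Proof.
have k1 : k.+1%:R^-1 <= 1 :> R by rewrite invf_le1 ?ltr0n// ler1n.
have k1' : 1 <= k.+1%:R :> R by rewrite ler1n.
(* At distance 2 from [p] the rescaled variable is strictly beyond 1 in absolute value, where the
   derivative of [sramp] is known to be 0 or 1. *)
rewrite (_ : \int[leb]_t rampDD k p t = \int[leb]_(t in `[p - 2, p + 2]) rampDD k p t); last first.
  rewrite [RHS]Rintegral_mkcond; apply: eq_Rintegral => t _; rewrite patchE.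
  case: ifPn => //; rewrite notin_setE => H.
  by apply: rampDD_supp H; move: k1; set w := _^-1 => *; lra.
have dD t : derivable (rampD k p) t 1 by have [] := is_derive_rampD k p t.
have cD : continuous (rampD k p).
  by move=> t; apply/differentiable_continuous/derivable1_diffP.
rewrite /Rintegral (@continuous_FTC2 _ _ (rampD k p)).
- rewrite /rampD derive1_sramp_hi ?derive1_sramp_lo/= ?subr0//; nra.
- lra.
- by apply: continuous_subspaceT; exact: continuous_rampDD.
- split; first by move=> t _; exact: dD.
    exact/cvg_at_right_filter/cD.
  exact/cvg_at_left_filter/cD.
- by move=> t _; rewrite derive1E; have [_ ->] := is_derive_rampD k p t.
Qed.

(** Since [rampDD] changes sign, the error is [e] times a bound of its L^1 norm: width 2/(k+1) times
    height (k+1) sup |sbump|, which does not depend on [k]. *)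
Lemma rampDD_mollifier : exists2 C : R, 0 <= C & forall f k p c e, continuous f -> 0 <= e ->
  (forall t, `|t - p| <= k.+1%:R^-1 -> `|f t - c| <= e) ->
  `|\int[leb]_t (f t * rampDD k p t) - c| <= C * e.
Proof.
have [C C0 HC] := @sbump_bound R.
exists (2 * C); first by rewrite mulr_ge0.
move=> f k p c e cf e0 fe.
have k0 : 0 < k.+1%:R :> R by rewrite ltr0n.
set w : R := k.+1%:R^-1.
have w0 : 0 < w by rewrite invr_gt0.
have wk : w * k.+1%:R = 1 by rewrite mulVf// gt_eqF.
have supp t : ~ `[p - w, p + w]%classic t -> rampDD k p t = 0.
  by apply: rampDD_supp; exact: lexx.
have kb t : `|rampDD k p t| <= k.+1%:R * C.
  by rewrite /rampDD normrM (ger0_norm (ltW k0)) ler_wpM2l// ltW.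
have mr := measurable_rampDD k p.
have i1 := locint_integrable (locint_continuous cf) mr kb supp.
have i2 := locint_integrable (locint_cst c) mr kb supp.
have -> : c = \int[leb]_t (c * rampDD k p t).
  rewrite RintegralZl ?integral_rampDD ?mulr1//.
  have := locint_integrable (locint_cst 1) mr kb supp.
  by apply: eq_integrable => // t _; rewrite /= mul1r.
rewrite -RintegralB//.
rewrite (_ : 2 * C * e = (e * (k.+1%:R * C)) * ((p + w) - (p - w))); last first.
  rewrite (_ : p + w - (p - w) = 2 * w); last by ring.
  transitivity (2 * C * e * (w * k.+1%:R)); first by rewrite wk mulr1.
  by move: (k.+1%:R : R) => K; ring.
apply: Rintegral_bound; first lra.
- apply: measurable_funB; apply: measurable_funM => //; exact: continuous_measurable_fun.
- move=> t; rewrite -mulrBl normrM.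
  have [tp|tp] := leP `|t - p| w.
    by apply: ler_pM => //; exact: fe.
  by rewrite rampDD_out// normr0 mulr0 !mulr_ge0// ltW.
- by move=> t /supp ->; rewrite !mulr0 subrr.
Qed.

End line.

(** * Hat functions and their smoothings *)

Section tent.
Context {R : realType}.
Local Notation leb := (@lebesgue_measure R).
Implicit Types (t p q r c e N : R) (f g W h : R -> R).

(* A divided difference: it turns the ramps at [p], [q], [r] into a hat function, and it
   annihilates functions affine in the knot. *)
Definition second_diff (B : R -> R -> R) p q r t : R :=
  (r - q) * B p t - (r - p) * B q t + (q - p) * B r t.

Definition pospart p t : R := Num.max (t - p) 0.

(** For p < q < r this is the piecewise linear hat on [p, r] with height (r - q) (q - p) at [q].
    Left unnormalised, it involves no division by differences of knots, so it varies continuously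
    with them. *)
Definition hat p q r t : R := second_diff pospart p q r t.

Definition tent k p q r t : R := second_diff (ramp k) p q r t.

Definition tentDD k p q r t : R := second_diff (rampDD k) p q r t.

Lemma smooth1_second_diff (B : R -> R -> R) p q r : (forall p, smooth1 (B p)) ->
  smooth1 (second_diff B p q r).
Proof.
move=> Bs k; apply: CkD; last by apply: CkZ; exact: Bs.
apply: CkD; first by apply: CkZ; exact: Bs.
rewrite (_ : (fun t => _) = fun t => (- (r - p)) * B q t).
  by apply: CkZ; exact: Bs.
by apply/boolp.funext => t; rewrite mulNr.
Qed.

Lemma smooth1_tent k p q r : smooth1 (tent k p q r).
Proof. by apply: smooth1_second_diff => p'; exact: smooth1_ramp. Qed.

Lemma is_derive_second_diff (B D : R -> R -> R) p q r t :
  (forall p, is_derive t 1 (B p) (D p t)) ->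
  is_derive t 1 (second_diff B p q r) (second_diff D p q r t).
Proof.
move=> BD.
have D1 := is_deriveZ (r - q) (BD p).
have D2 := is_deriveZ (r - p) (BD q).
have D3 := is_deriveZ (q - p) (BD r).
exact: (is_deriveD (is_deriveB D1 D2) D3).
Qed.

Lemma derive1_tent k p q r : derive1 (derive1 (tent k p q r)) = tentDD k p q r.
Proof.
have -> : derive1 (tent k p q r) = second_diff (rampD k) p q r.
  apply/boolp.funext => t; rewrite derive1E.
  by have [] := @is_derive_second_diff (ramp k) (rampD k) p q r t
     (fun p => is_derive_ramp k p t).
apply/boolp.funext => t; rewrite derive1E.
by have [] := @is_derive_second_diff (rampD k) (rampDD k) p q r t
     (fun p => is_derive_rampD k p t).
Qed.

Lemma pospart_lip p p' t : `|pospart p t - pospart p' t| <= `|p - p'|.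
Proof.
rewrite /pospart; have := ler_norm (p - p'); have := ler_norm (p' - p); rewrite distrC.
rewrite ler_norml; set d := `|p' - p| => H1 H2.
have [h1|h1] := leP (t - p) 0; have [h2|h2] := leP (t - p') 0;
  apply/andP; split; lra.
Qed.

Lemma pospart_le p t : 0 <= pospart p t <= `|t| + `|p|.
Proof.
rewrite /pospart; have := ler_norm t; have := ler_norm (- p); rewrite normrN.
by have [h|h] := leP (t - p) 0; have := normr_ge0 t; have := normr_ge0 p;
  move=> *; apply/andP; split; lra.
Qed.

Lemma second_diff_supp (B : R -> R -> R) p q r N :
  (forall p t, t <= p - 1 -> B p t = 0) -> (forall p t, p + 1 <= t -> B p t = t - p) ->
  `|p| <= N -> `|q| <= N -> `|r| <= N ->
  forall t, ~ `[- (N + 1), N + 1]%classic t -> second_diff B p q r t = 0.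
Proof.
move=> Blo Bhi; rewrite !ler_norml => /andP[p1 p2] /andP[q1 q2] /andP[r1 r2] t.
rewrite /= in_itv/= => /negP; rewrite negb_and -!ltNge => /orP[H|H]; rewrite /second_diff.
  by rewrite !Blo ?mulr0 ?subrr ?addr0//; lra.
rewrite !Bhi; [ring|lra..].
Qed.

Lemma tent_supp k p q r N : `|p| <= N -> `|q| <= N -> `|r| <= N ->
  forall t, ~ `[- (N + 1), N + 1]%classic t -> tent k p q r t = 0.
Proof. by apply: second_diff_supp => p' t; [exact: ramp_lo|exact: ramp_hi]. Qed.

Lemma hat_supp p q r N : `|p| <= N -> `|q| <= N -> `|r| <= N ->
  forall t, ~ `[- (N + 1), N + 1]%classic t -> hat p q r t = 0.
Proof.
by apply: second_diff_supp => p' t tp; rewrite /pospart;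
  have [h|h] := leP (t - p') 0 => //; lra.
Qed.

Lemma continuous_hat p q r : continuous (hat p q r).
Proof.
have cp p' : continuous (pospart p').
  move=> t; apply: (@continuous_max _ _ (fun x => x - p') (cst 0) t); last exact: cvg_cst.
  by apply: cvgB; [exact: cvg_id|exact: cvg_cst].
move=> t; apply: cvgD; last by apply: cvgM; [exact: cvg_cst|exact: cp].
by apply: cvgB; (apply: cvgM; [exact: cvg_cst|exact: cp]).
Qed.

Lemma prod_approx (a a' m m' D w : R) : `|a - a'| <= w -> `|m' - m| <= w ->
  `|a'| <= D -> `|m| <= D -> `|a' * m' - a * m| <= 2 * D * w.
Proof.
move=> aw mw aD mD.
have -> : a' * m' - a * m = a' * (m' - m) - (a - a') * m by ring.
apply: (le_trans (ler_normB _ _)); rewrite !normrM.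
have := ler_pM (normr_ge0 _) (normr_ge0 _) aD mw.
have := ler_pM (normr_ge0 _) (normr_ge0 _) aw mD.
lra.
Qed.

(** The difference consists of three products of a knot difference and a ramp. All factors are
    bounded by 2N + 2 and change by at most 2w: two knots move in the first factor, one knot moves
    and the ramp is smoothed in the second. *)
Lemma tent_approx k p q r p' q' r' N : let w := k.+1%:R^-1 in 0 <= N ->
  `|p| <= N -> `|q| <= N -> `|r| <= N ->
  `|p - p'| <= w -> `|q - q'| <= w -> `|r - r'| <= w ->
  forall t, `|t| <= N + 2 ->
  `|tent k p' q' r' t - hat p q r t| <= 3 * (2 * (2 * N + 2) * (2 * w)).
Proof.
move=> w N0 pN qN rN pw qw rw t tN.
have w1 : w <= 1 by rewrite invf_le1 ?ltr0n// ler1n.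
have coef (a b a' b' : R) : `|a| <= N -> `|b| <= N -> `|a - a'| <= w -> `|b - b'| <= w ->
    `|(a - b) - (a' - b')| <= 2 * w /\ `|a' - b'| <= 2 * N + 2.
  rewrite !ler_norml => /andP[? ?] /andP[? ?] /andP[? ?] /andP[? ?].
  by split; apply/andP; split; lra.
have val (a a' : R) : `|a| <= N -> `|a - a'| <= w ->
    `|ramp k a' t - pospart a t| <= 2 * w /\ `|pospart a t| <= 2 * N + 2.
  move=> aN aw; split.
    rewrite (_ : _ - _ = (ramp k a' t - pospart a' t) + (pospart a' t - pospart a t)); last ring.
    apply: (le_trans (ler_normD _ _)).
    have := ramp_approx k a' t; have := pospart_lip a' a t.
    by rewrite -/(pospart a' t) -/w (distrC a') => *; lra.
  have /andP[m0 m1] := pospart_le a t.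
  by rewrite ger0_norm//; lra.
have term (a b c a' b' c' : R) : `|a| <= N -> `|b| <= N -> `|c| <= N ->
    `|a - a'| <= w -> `|b - b'| <= w -> `|c - c'| <= w ->
    `|(a' - b') * ramp k c' t - (a - b) * pospart c t| <= 2 * (2 * N + 2) * (2 * w).
  move=> aN bN cN aw bw cw.
  have [h1 h2] := coef _ _ _ _ aN bN aw bw.
  by have [h3 h4] := val _ _ cN cw; exact: prod_approx.
have t1 := term _ _ _ _ _ _ rN qN pN rw qw pw.
have t2 := term _ _ _ _ _ _ rN pN qN rw pw qw.
have t3 := term _ _ _ _ _ _ qN pN rN qw pw rw.
rewrite /tent /hat /second_diff.
move: t1 t2 t3; rewrite !ler_norml => /andP[? ?] /andP[? ?] /andP[? ?].
by apply/andP; split; lra.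
Qed.

End tent.

Section second_derivative_on_line.
Context {R : realType}.
Local Notation leb := (@lebesgue_measure R).
Implicit Types (t p q r c e N : R).
Variables (g W : R -> R).
Hypotheses (cg : continuous g) (locW : locint W).
(* Rational knots, so that one null set of lines will serve all of them. *)
Hypothesis weakW : forall (p q r : rat) k,
  \int[leb]_t (g t * tentDD k (ratr p) (ratr q) (ratr r) t) =
  \int[leb]_t (W t * tent k (ratr p) (ratr q) (ratr r) t).

Lemma continuous_tent k p q r : continuous (tent k p q r).
Proof. by apply: smooth1_continuous; exact: smooth1_tent. Qed.

Lemma rampDD_integrable (f : R -> R) k p : continuous f ->
  leb.-integrable setT (EFin \o (fun t => f t * rampDD k p t)).
Proof.
move=> cf; have [C C0 HC] := @sbump_bound R.
apply: (@locint_integrable _ _ _ (p - k.+1%:R^-1) (p + k.+1%:R^-1) (k.+1%:R * C)).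
- exact: locint_continuous.
- exact: measurable_rampDD.
- by move=> t; rewrite /rampDD normrM ger0_norm// ler_wpM2l.
- by move=> t; apply: rampDD_supp; exact: lexx.
Qed.

Lemma integral_tentDD k p q r : \int[leb]_t (g t * tentDD k p q r t) =
  (r - q) * \int[leb]_t (g t * rampDD k p t) - (r - p) * \int[leb]_t (g t * rampDD k q t)
  + (q - p) * \int[leb]_t (g t * rampDD k r t).
Proof.
have i1 p' a : leb.-integrable setT (EFin \o (fun t => a * (g t * rampDD k p' t))).
  rewrite (_ : _ \o _ = fun t => (a%:E * (EFin \o (fun t => (g t * rampDD k p' t)%R)) t)%E).
    by apply: integrableZl => //; exact: rampDD_integrable.
  by apply/boolp.funext => t /=; rewrite EFinM.
rewrite -!RintegralZl//; try exact: rampDD_integrable.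
rewrite -RintegralB// -RintegralD//; last first.
  rewrite (_ : _ \o _ = fun t => ((EFin \o (fun t => (r - q) * (g t * rampDD k p t))%R) t
     - (EFin \o (fun t => (r - p) * (g t * rampDD k q t))%R) t)%E).
    by apply: integrableB.
  by apply/boolp.funext => t /=; rewrite EFinB.
apply: eq_Rintegral => t _; rewrite /tentDD/second_diff.
by move: (rampDD k p t) (rampDD k q t) (rampDD k r t) (g t) => a b d f; ring.
Qed.

Lemma absB_approx (a b a' b' w N : R) : w <= 1 -> `|a| <= N -> `|b| <= N ->
  `|a - a'| <= w -> `|b - b'| <= w -> `|a' - b'| <= 2 * N + 2.
Proof.
rewrite !ler_norml => ? /andP[? ?] /andP[? ?] /andP[? ?] /andP[? ?].
by apply/andP; split; lra.
Qed.

Lemma abs_approx (a a' w N : R) : w <= 1 -> `|a| <= N -> `|a - a'| <= w -> `|a'| <= N + 1.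
Proof.
by rewrite !ler_norml => ? /andP[? ?] /andP[? ?]; apply/andP; split; lra.
Qed.

Lemma rat_approx (a w : R) : 0 < w -> exists a' : rat, `|a - ratr a'| <= w.
Proof.
move=> w0; have /rat_in_itvoo[a'] : a - w < a + w by lra.
by rewrite in_itv/= => /andP[? ?]; exists a'; rewrite ler_norml; apply/andP; split; lra.
Qed.

Lemma three_terms (A B D x y z c M E : R) : `|A| <= M -> `|B| <= M -> `|D| <= M ->
  `|x - c| <= E -> `|y - c| <= E -> `|z - c| <= E -> A - B + D = 0 ->
  `|A * x - B * y + D * z| <= 3 * M * E.
Proof.
move=> AM BM DM xc yc zc ABD.
have -> : A * x - B * y + D * z = A * (x - c) - B * (y - c) + D * (z - c).
  apply/eqP; rewrite -subr_eq0; apply/eqP.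
  by transitivity ((A - B + D) * c); [ring|rewrite ABD mul0r].
apply: (le_trans (ler_normD _ _)).
apply: (le_trans (lerD (ler_normB _ _) (lexx _))); rewrite !normrM.
have := ler_pM (normr_ge0 _) (normr_ge0 _) AM xc.
have := ler_pM (normr_ge0 _) (normr_ge0 _) BM yc.
have := ler_pM (normr_ge0 _) (normr_ge0 _) DM zc.
lra.
Qed.

(* The second derivative of the hat is a combination of Dirac masses at [p], [q], [r]
   with weights of sum 0, so it cannot see a function equal to [c] at the three knots. *)
Lemma hat_integral0 p q r c : g p = c -> g q = c -> g r = c ->
  \int[leb]_t (W t * hat p q r t) = 0.
Proof.
move=> gp gq gr; have [C C0 HC] := @rampDD_mollifier R.
pose N := `|p| + `|q| + `|r|.
have [pN qN rN] : [/\ `|p| <= N, `|q| <= N & `|r| <= N].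
  by rewrite /N; split; have := normr_ge0 p; have := normr_ge0 q; have := normr_ge0 r;
    move=> *; lra.
have N0 : 0 <= N by exact: le_trans pN.
have D0 : 0 <= 2 * N + 2 by rewrite addr_ge0// mulr_ge0.
(* The knots lie within [N], the rational ones within N + 1, and the ramps leave their limiting form
   at most 1 further, hence N + 2. In [K] the first summand pays for replacing the hat by the tent,
   the second for evaluating [g] through mollifiers. *)
pose L := \int[leb]_(t in `[- (N + 2), N + 2]) `|W t|.
pose K := 3 * (2 * (2 * N + 2) * 2) * L + 3 * (2 * N + 2) * C.
have L0 : 0 <= L by apply: Rintegral_ge0.
have K0 : 0 <= K by rewrite addr_ge0// !mulr_ge0.
suff main e : 0 < e -> `|\int[leb]_t (W t * hat p q r t)| <= K * e.
  apply/eqP; rewrite -normr_le0; apply/ler_addgt0Pl => e e0; rewrite addr0.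
  have eK : 0 < e / (K + 1) by rewrite divr_gt0// ltr_wpDl.
  apply: (le_trans (main _ eK)); rewrite mulrCA ler_piMr ?(ltW e0)//.
  by rewrite ler_pdivrMr ?mul1r ?lerDl// ltr_wpDl.
move=> e0.
(* The radius is twice 1/(k+1): once for the distance of the rational knot from [a], once for the
   width of the mollifier placed at it. *)
have near_c a : g a = c -> \forall k \near \oo,
    forall t, `|t - a| <= 2 * (k.+1%:R : R)^-1 -> `|g t - c| <= e.
  move=> ga; have : g x @[x --> a] --> g a by exact: cg.
  move=> /cvgrPdist_le/(_ _ e0)/nbhs_ballP[d /= d0 dP].
  have d20 : 0 < d / 2 by rewrite divr_gt0.
  have := near_infty_natSinv_lt (PosNum d20); apply: filterS => k /= kd t td.
  rewrite -ga distrC; apply: dP.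
  by rewrite /ball/= distrC (le_lt_trans td)//; move: kd; rewrite ltr_pdivlMr// mulrC.
have : \forall k \near \oo, let w : R := k.+1%:R^-1 in
   [/\ forall t, `|t - p| <= 2 * w -> `|g t - c| <= e,
    forall t, `|t - q| <= 2 * w -> `|g t - c| <= e,
    forall t, `|t - r| <= 2 * w -> `|g t - c| <= e & w <= e].
  near=> k; split; near: k; try exact: near_c.
  by have := near_infty_natSinv_lt (PosNum e0); apply: filterS => k /= /ltW.
move=> [k _ /(_ k (leqnn k))] /=.
set w := k.+1%:R^-1 => -[Hp Hq Hr we].
have w0 : 0 < w by rewrite invr_gt0.
have w1 : w <= 1 by rewrite invf_le1 ?ltr0n// ler1n.
have ratw (a : R) := rat_approx a w0.
have [p' pp'] := ratw p; have [q' qq'] := ratw q; have [r' rr'] := ratw r.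
have moll (a a' : R) : `|a - a'| <= w ->
    (forall t, `|t - a| <= 2 * w -> `|g t - c| <= e) ->
    `|\int[leb]_t (g t * rampDD k a' t) - c| <= C * e.
  move=> aw Ha; apply: HC => // [|t tw]; first exact: ltW.
  apply: Ha; rewrite (_ : t - a = (t - a') - (a - a')); last ring.
  apply: (le_trans (ler_normB _ _)).
  by rewrite (_ : 2 * w = w + w) ?lerD// mulr2n mulrDl mul1r.
have mp := moll _ _ pp' Hp; have mq := moll _ _ qq' Hq; have mr := moll _ _ rr' Hr.
have coef (a b a' b' : R) := @absB_approx a b a' b' w N w1.
have int0 : `|\int[leb]_t (W t * tent k (ratr p') (ratr q') (ratr r') t)| <=
    3 * (2 * N + 2) * C * e.
  rewrite -weakW integral_tentDD -[3 * _ * C * e]mulrA.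
  apply: (three_terms (coef _ _ _ _ rN qN rr' qq') (coef _ _ _ _ rN pN rr' pp')
    (coef _ _ _ _ qN pN qq' pp') mp mq mr).
  by move: (ratr p' : R) (ratr q' : R) (ratr r' : R) => P Q S; ring.
have N2 (a a' : R) := @abs_approx a a' w N w1.
have tsupp t : ~ `[- (N + 2), N + 2]%classic t -> tent k (ratr p') (ratr q') (ratr r') t = 0.
  move=> H; apply: (@tent_supp _ _ _ _ _ (N + 1)); [exact: N2 pN pp'|exact: N2 qN qq'|exact: N2 rN rr'|].
  by rewrite -addrA.
have hsupp t : ~ `[- (N + 2), N + 2]%classic t -> hat p q r t = 0.
  move=> H; apply: (@hat_supp _ _ _ _ (N + 1)); try by rewrite (le_trans _ (_ : N <= N + 1)) ?lerDl.
  by rewrite -addrA.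
have approx t : `|tent k (ratr p') (ratr q') (ratr r') t - hat p q r t| <=
    3 * (2 * (2 * N + 2) * (2 * w)).
  have [tN|tN] := leP `|t| (N + 2); first exact: tent_approx.
  have H : ~ `[- (N + 2), N + 2]%classic t by rewrite /= in_itv/= -ler_norml; apply/negP; rewrite -ltNge.
  by rewrite tsupp// hsupp// subrr normr0 !mulr_ge0// ltW.
have mt : measurable_fun setT (tent k (ratr p') (ratr q') (ratr r') : R -> R).
  by apply: continuous_measurable_fun; exact: continuous_tent.
have mh : measurable_fun setT (hat p q r : R -> R).
  by apply: continuous_measurable_fun; exact: continuous_hat.
have bnd (f : R -> R) : continuous f -> (forall t, ~ `[- (N + 2), N + 2]%classic t -> f t = 0) ->
    leb.-integrable setT (EFin \o (fun t => W t * f t)).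
  move=> cf fs.
  have [D HD] : exists D, forall t, `|f t| <= D.
    have [D [_ HD]] : bounded_set (f @` `[- (N + 2), N + 2]).
      apply: compact_bounded; apply: continuous_compact; last exact: segment_compact.
      exact: continuous_subspaceT.
    exists (`|D| + 1) => t.
    have [tN|tN] := pselect (`[- (N + 2), N + 2]%classic t); last by rewrite fs// normr0 addr_ge0.
    by apply: HD; [rewrite ltr_pwDr// ler_norm|exists t].
  apply: (@locint_integrable _ _ _ (- (N + 2)) (N + 2) D) => //.
  exact: continuous_measurable_fun.
have it := bnd _ (@continuous_tent k (ratr p') (ratr q') (ratr r')) tsupp.
have ih := bnd _ (@continuous_hat _ p q r) hsupp.
have diff : `|\int[leb]_t (W t * tent k (ratr p') (ratr q') (ratr r') t) -
    \int[leb]_t (W t * hat p q r t)| <= 3 * (2 * (2 * N + 2) * (2 * w)) * L.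
  rewrite -RintegralB//.
  rewrite (_ : Rintegral _ _ _ = \int[leb]_t (W t *
    (tent k (ratr p') (ratr q') (ratr r') t - hat p q r t))); last first.
    by apply: eq_Rintegral => t _; rewrite mulrBr.
  apply: locint_bound => //; first exact: measurable_funB.
  by move=> t tN; rewrite tsupp// hsupp// subrr.
move: diff int0; move: (\int[leb]_t (W t * tent _ _ _ _ t)) (\int[leb]_t (W t * hat p q r t)).
move=> x y diff int0.
have -> : y = x - (x - y) by ring.
apply: (le_trans (ler_normB _ _)); rewrite /K.
move: (L) L0 diff => l l0 diff.
have : 3 * (2 * (2 * N + 2) * (2 * w)) * l <= 3 * (2 * (2 * N + 2) * 2) * l * e.
  rewrite (_ : 3 * (2 * (2 * N + 2) * (2 * w)) * l = 3 * (2 * (2 * N + 2) * 2) * l * w); last ring.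
  by rewrite ler_wpM2l// !mulr_ge0.
move: `|x| `|x - y| int0 diff => X Y iX dY lY.
by rewrite mulrDl addrC lerD// (le_trans dY).
Unshelve. all: by end_near.
Qed.

End second_derivative_on_line.

Section hat_bounds.
Context {R : realType}.
Local Notation leb := (@lebesgue_measure R).
Implicit Types (t p q r : R).

Lemma hat_left p q r t : p < q -> q < r -> p <= t -> t <= q -> hat p q r t = (r - q) * (t - p).
Proof.
move=> pq qr pt tq; rewrite /hat/second_diff/pospart.
rewrite (max_idPl _) ?subr_ge0// (max_idPr _) ?subr_le0// (max_idPr _) ?subr_le0 ?(le_trans tq (ltW qr))//.
by rewrite !mulr0 subr0 addr0.
Qed.

Lemma hat_right p q r t : p < q -> q < r -> q <= t -> t <= r -> hat p q r t = (q - p) * (r - t).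
Proof.
move=> pq qr qt tr; rewrite /hat/second_diff/pospart.
rewrite (max_idPl _) ?subr_ge0 ?(le_trans (ltW pq) qt)// (max_idPl _) ?subr_ge0// (max_idPr _) ?subr_le0//.
by ring.
Qed.

Lemma hat_out p q r t : p < q -> q < r -> ~ `[p, r]%classic t -> hat p q r t = 0.
Proof.
move=> pq qr; rewrite /= in_itv/= => /negP; rewrite negb_and -!ltNge => /orP[/ltW tp|/ltW rt].
  rewrite /hat/second_diff/pospart !(max_idPr _) ?subr_le0 ?mulr0 ?subrr ?addr0//.
    by rewrite (le_trans tp)// (le_trans (ltW pq))// ltW.
  by rewrite (le_trans tp)// ltW.
rewrite /hat/second_diff/pospart !(max_idPl _) ?subr_ge0//; first by ring.
  by rewrite (le_trans _ rt)// ltW.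
by rewrite (le_trans _ rt)// ltW// (lt_trans pq).
Qed.

Lemma hat_range p q r t : p < q -> q < r -> 0 <= hat p q r t <= (r - q) * (q - p).
Proof.
move=> pq qr; have [tpr|tpr] := pselect (`[p, r]%classic t); last first.
  by rewrite hat_out// lexx mulr_ge0// subr_ge0 ltW.
move: tpr; rewrite /= in_itv/= => /andP[pt tr].
have [tq|/ltW qt] := leP t q.
  by rewrite hat_left//; apply/andP; split; nra.
by rewrite hat_right//; apply/andP; split; nra.
Qed.

Lemma hat_mid p q r t : p < q -> q < r -> (p + q) / 2 <= t <= (q + r) / 2 ->
  (r - q) * (q - p) / 2 <= hat p q r t.
Proof.
move=> pq qr /andP[h1 h2]; have [tq|/ltW qt] := leP t q.
  rewrite hat_left//; last by lra.
  nra.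
rewrite hat_right//; last by lra.
nra.
Qed.

Lemma hat_measurable p q r : measurable_fun setT (hat p q r).
Proof. by apply: continuous_measurable_fun; exact: continuous_hat. Qed.

Lemma hat_integrable (W : R -> R) p q r : locint W -> p < q -> q < r ->
  leb.-integrable setT (EFin \o (fun t => W t * hat p q r t)).
Proof.
move=> lW pq qr; apply: (@locint_integrable _ _ _ p r ((r - q) * (q - p))) => //.
- exact: hat_measurable.
- by move=> t; have /andP[h0 h1] := hat_range t pq qr; rewrite ger0_norm.
- by move=> t; exact: hat_out.
Qed.

Lemma integral_itv_cst (l r b : R) : l <= r -> \int[leb]_(t in `[l, r]) b = b * (r - l).
Proof.
move=> lr; have E := @lebesgue_measure_itv R `[l, r]; rewrite /= lte_fin in E.
rewrite Rintegral_cst//; congr (_ * _).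
transitivity (fine (if (l < r)%R then r%:E - l%:E else 0)%E).
  by congr fine; exact: E.
by case: ltgtP lr => // -> _; rewrite subrr.
Qed.

(** Over the segment between the midpoints of [p, q] and [q, r], of length (r - p)/2, the hat is at
    least half its height. This yields half of the true integral. *)
Lemma integral_hat_ge p q r : p < q -> q < r ->
  (r - q) * (q - p) * (r - p) / 4 <= \int[leb]_t hat p q r t.
Proof.
move=> pq qr.
set l1 := (p + q) / 2; set r1 := (q + r) / 2.
have lr : l1 <= r1 by rewrite /l1 /r1; lra.
have -> : (r - q) * (q - p) * (r - p) / 4 = \int[leb]_(t in `[l1, r1]) ((r - q) * (q - p) / 2).
  rewrite integral_itv_cst// (_ : r1 - l1 = (r - p) / 2); last by rewrite /l1 /r1; lra.
  by field.
rewrite Rintegral_mkcond; apply: le_Rintegral => //.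
- rewrite -restrict_EFin; apply/(@integrable_mkcond _ (measurableTypeR R) R leb _ _ (measurable_itv `[l1, r1])).
  exact: (locint_cst _).2.
- have := hat_integrable (locint_cst 1) pq qr.
  by apply: eq_integrable => // t _; rewrite /= mul1r.
- move=> t _; rewrite patchE; case: ifPn => [|_].
    by rewrite inE/= in_itv/= => tlr; exact: hat_mid.
  by have /andP[] := hat_range t pq qr.
Qed.

End hat_bounds.

Section vanishing_on_level_sets.
Context {R : realType}.
Local Notation leb := (@lebesgue_measure R).
Implicit Types (t p q r c e N : R).
Variables (g W : R -> R).
Hypotheses (cg : continuous g) (locW : locint W).
Hypothesis weakW : forall (p q r : rat) k,
  \int[leb]_t (g t * tentDD k (ratr p) (ratr q) (ratr r) t) =
  \int[leb]_t (W t * tent k (ratr p) (ratr q) (ratr r) t).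

Lemma locint_sub_cst c : locint (fun t => W t - c).
Proof.
have [mW iW] := locW; split; first exact: measurable_funB.
move=> l r; rewrite (_ : _ \o _ = fun t => ((EFin \o W) t - (EFin \o cst c) t)%E); last first.
  by apply/boolp.funext.
by apply: integrableB => //; exact: (locint_cst c).2.
Qed.

(** Since [W] integrates to 0 against the hat, W(t) times the integral of the hat equals minus the
    integral of (W - W(t)) times the hat. The hat is at most its height and its integral at least
    height (r - p)/4, so the height cancels. *)
Lemma level_bound (p q r t c : R) : g p = c -> g q = c -> g r = c -> p < q -> q < r ->
  `|W t| * (r - p) <= 4 * \int[leb]_(x in `[p, r]) `|W x - W t|.
Proof.
move=> gp gq gr pq qr.
have h0 := hat_integral0 cg locW weakW gp gq gr.
set D := (r - q) * (q - p).
have D0 : 0 < D by rewrite mulr_gt0// subr_gt0.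
have i1 := hat_integrable (locint_sub_cst (W t)) pq qr.
have i2 : leb.-integrable setT (EFin \o hat p q r).
  by have := hat_integrable (locint_cst 1) pq qr; apply: eq_integrable => // x _; rewrite /= mul1r.
have i3 : leb.-integrable setT (EFin \o (fun x => W t * hat p q r x)).
  exact: (hat_integrable (locint_cst (W t)) pq qr).
have E : \int[leb]_x ((W x - W t) * hat p q r x) = - (W t * \int[leb]_x hat p q r x).
  rewrite -RintegralZl// -[RHS]add0r -[X in _ = X - _]h0 -RintegralB//; last exact: hat_integrable.
  by apply: eq_Rintegral => x _; rewrite mulrBl.
have B : `|\int[leb]_x ((W x - W t) * hat p q r x)| <= D * \int[leb]_(x in `[p, r]) `|W x - W t|.
  apply: (locint_bound (locint_sub_cst (W t)) (hat_measurable p q r)).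
    by move=> x; have /andP[h1 h2] := hat_range x pq qr; rewrite ger0_norm.
  by move=> x; exact: hat_out.
have L := integral_hat_ge pq qr.
move: B L; rewrite E normrN normrM -/D.
move: (\int[leb]_x hat p q r x) (\int[leb]_(x in `[p, r]) `|W x - W t|) => I J B L.
have rp0 : 0 < r - p by rewrite subr_gt0 (lt_trans pq).
have I0 : 0 <= I by apply: le_trans L; rewrite divr_ge0// mulr_ge0// ltW.
rewrite (ger0_norm I0) in B.
rewrite -(ler_pM2l D0) mulrCA [leRHS]mulrCA.
have := ler_wpM2l (normr_ge0 (W t)) L.
move: `|W t| B => w B; nra.
Qed.

(** Sorting the three points makes them the knots of a hat. As [x1] is the farther one, the base of
    the hat has length at least |x1 - t| and stays within that distance of [t], so it is comparable
    to a ball centred at [t]. *)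
Lemma three_sorted (t x1 x2 c : R) : g t = c -> g x1 = c -> g x2 = c ->
  x1 != t -> x2 != t -> `|x2 - t| < `|x1 - t| ->
  exists p q r, [/\ g p = c, g q = c, g r = c & p < q] /\
    [/\ q < r, `|x1 - t| <= r - p, t - `|x1 - t| <= p & r <= t + `|x1 - t|].
Proof.
move=> gt g1 g2; rewrite !neq_lt => /orP[x1t|x1t] /orP[x2t|x2t].
- rewrite !ltr0_norm ?subr_lt0// => x21.
  by exists x1, x2, t; split; split => //; lra.
- rewrite (ltr0_norm (_ : x1 - t < 0)) ?subr_lt0// gtr0_norm ?subr_gt0// => x21.
  by exists x1, t, x2; split; split => //; lra.
- rewrite (gtr0_norm (_ : 0 < x1 - t)) ?subr_gt0// ltr0_norm ?subr_lt0// => x21.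
  by exists x2, t, x1; split; split => //; lra.
- rewrite !gtr0_norm ?subr_gt0// => x21.
  by exists t, x2, x1; split; split => //; lra.
Qed.

(** With b = |x1 - t|, the ball of radius 2b contains [p, r] and has measure 4b, while |W(t)| b is
    at most 4 times the integral over [p, r]; hence 16. *)
Lemma level_bound_near (t x1 x2 c : R) : g t = c -> g x1 = c -> g x2 = c ->
  x1 != t -> x2 != t -> `|x2 - t| < `|x1 - t| ->
  (`|W t|%:E <= 16%:E * davg W t (2 * `|x1 - t|)%R)%E.
Proof.
move=> gt g1 g2 x1t x2t x21.
have [p [q [r [[gp gq gr pq] [qr]]]]] := three_sorted gt g1 g2 x1t x2t x21.
set b := `|x1 - t| => brp pb rb.
have b0 : 0 < b by rewrite normr_gt0 subr_eq0.
have := level_bound t gp gq gr pq qr.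
pose I := \int[leb]_(x in `[p, r]) `|W x - W t|; rewrite -/I => IW.
have IE : (I%:E = \int[leb]_(x in `[p, r]) `|W x - W t|%:E)%E.
  rewrite /I /Rintegral fineK//; apply: integrable_fin_num => //.
  by apply: integrable_norm; exact: (locint_sub_cst (W t)).2.
have sub : `[p, r]%classic `<=` ball t (2 * b).
  move=> x; rewrite /= in_itv/= => /andP[px xr]; rewrite /ball/=.
  by rewrite ltr_norml; apply/andP; split; lra.
rewrite /davg /iavg lebesgue_measure_ball; last by rewrite mulr_ge0// ltW.
set J := (\int[leb]_(x in ball _ _) _)%E.
have IJ : (I%:E <= J)%E.
  rewrite IE; apply: ge0_subset_integral => //.
  - exact: measurable_ball.
  - apply/measurable_EFinP; apply: measurableT_comp => //; apply: measurable_funTS.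
    by case: (locint_sub_cst (W t)).
have c0 : 0 < 2 * b *+ 2 by rewrite pmulrn_lgt0// mulr_gt0.
rewrite inver gt_eqF//.
apply: (@le_trans _ _ (16%:E * ((2 * b *+ 2)^-1%R%:E * I%:E))%E); last first.
  by rewrite lee_pmul2l// lee_pmul2l ?lte_fin ?invr_gt0.
rewrite -!EFinM lee_fin.
have bW : `|W t| * b <= 4 * I by apply: le_trans IW; rewrite ler_wpM2l.
rewrite mulrCA ler_pdivlMl// mulr2n.
by move: (`|W t|) (I) bW => w i; lra.
Qed.

Lemma level_limit_point (t c : R) : g t = c -> lebesgue_pt W t ->
  (forall d, 0 < d -> exists x, [/\ g x = c, x != t & `|x - t| < d]) -> W t = 0.
Proof.
move=> gt Wt lim.
apply/eqP; rewrite -normr_le0; apply/ler_addgt0Pl => e e0; rewrite addr0.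
have e16 : 0 < e / 16 by rewrite divr_gt0.
have : \forall h \near 0^'+, (davg W t h < (e / 16)%:E)%E.
  have := Wt; rewrite /lebesgue_pt => /fine_cvgP[fin].
  move=> /cvgrPdist_lt/(_ _ e16); move: fin; apply: filterS2 => h hfin.
  rewrite sub0r normrN => H; rewrite -(fineK hfin) lte_fin.
  exact: le_lt_trans (ler_norm _) H.
move=> /nbhs_ballP[d /= d0 dP].
have d20 : 0 < d / 2 by rewrite divr_gt0.
have [x1 [g1 x1t x1d]] := lim _ d20.
have b0 : 0 < `|x1 - t| by rewrite normr_gt0 subr_eq0.
have [x2 [g2 x2t x2d]] := lim _ b0.
have := level_bound_near gt g1 g2 x1t x2t x2d.
have : (davg W t (2 * `|x1 - t|)%R < (e / 16)%:E)%E.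
  apply: dP; last by rewrite mulr_gt0.
  by rewrite /ball/= sub0r normrN ger0_norm ?mulr_ge0//; lra.
move=> Hd Hb; rewrite -lee_fin (le_trans Hb)//.
apply: (@le_trans _ _ (16%:E * (e / 16)%:E)%E); first by rewrite lee_pmul2l// ltW.
by rewrite -EFinM lee_fin; lra.
Qed.

(** Each isolated point is the only point of [E] in some interval with rational ends, and there are
    countably many such intervals. *)
Lemma countable_isolated (E : set R) :
  countable [set t | E t /\ exists2 d, 0 < d & forall x, E x -> `|x - t| < d -> x = t].
Proof.
pose F (ab : rat * rat) := [set t | [/\ E t, ratr ab.1 < t < ratr ab.2 &
  forall x, E x -> ratr ab.1 < x < ratr ab.2 -> x = t]].
apply: (@sub_countable _ _ _ (\bigcup_ab F ab)); last first.
  apply: bigcup_countable => [|[a b] _]; first exact: countableP.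
  have [->|/set0P[t [Et tab tu]]] := eqVneq (F (a, b)) set0; first exact: countable0.
  apply: (@sub_countable _ _ _ [set t]) => //; apply: subset_card_le.
  by move=> x [Ex xab xu] /=; exact: tu.
apply: subset_card_le => t [Et [d d0 td]].
have /rat_in_itvoo[a] : t - d < t by rewrite gtrBl.
rewrite in_itv/= => /andP[a1 a2].
have /rat_in_itvoo[b] : t < t + d by rewrite ltrDl.
rewrite in_itv/= => /andP[b1 b2].
exists (a, b) => //; split => //=; first by rewrite a2.
move=> x Ex /andP[ax xb]; apply: td => //.
by rewrite ltr_norml; apply/andP; split; lra.
Qed.

Lemma ae_eq0_level (c : R) : {ae leb, forall t, g t = c -> W t = 0}.
Proof.
have [mW iW] := locW.
have leW : {ae leb, forall t, lebesgue_pt W t}.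
  apply: lebesgue_differentiation; split => //; first exact: openT.
  move=> K _ cK.
  have [M [_ HM]] := compact_bounded cK.
  have KM : K `<=` `[- (`|M| + 1), `|M| + 1].
    move=> x Kx; rewrite /= in_itv/= -ler_norml; apply: (HM (`|M| + 1)) => //.
    by rewrite ltr_pwDr// ler_norm.
  have /integrableP[_] := iW (- (`|M| + 1)) (`|M| + 1).
  apply: le_lt_trans; apply: ge0_subset_integral => //.
  - exact: compact_measurable.
  - by apply/measurable_EFinP; apply: measurableT_comp => //; exact: measurable_funTS.
pose S := [set t | g t = c /\ exists2 d, 0 < d & forall x, g x = c -> `|x - t| < d -> x = t].
have cS : countable S by exact: (countable_isolated (fun t => g t = c)).
have nS : {ae leb, forall t, ~ S t}.
  exists S; split.
  - by apply: countable_measurable => // t; exact: measurable_set1.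
  - exact: countable_lebesgue_measure0.
  - by move=> t /= /contrapT.
move: leW nS; apply: (@filterS2 _ _ (ae_filter_ringOfSetsType leb)) => t lt nSt gt.
apply: (level_limit_point gt lt) => d d0.
apply: contrapT => H; apply: nSt; split => //; exists d => // x gx xd.
apply/eqP; apply: contrapT => /negP xt; apply: H.
by exists x; split.
Qed.

End vanishing_on_level_sets.

(** * Slicing a locally integrable function along lines parallel to an axis *)

Section line_integrals.
Context {R : realType} {n : nat} (i : 'I_n.+1).
Local Notation leb := (@lebesgue_measure R).
Local Notation mu := (@lebesgue_rV R n).
Local Notation mu1 := (@lebesgue_rV R n.+1).
Implicit Types (F : 'rV[R]_n.+1 -> R) (a : R -> R) (b : 'rV[R]_n -> R) (v : 'rV[R]_n).

Definition rowproj (y : 'rV[R]_n.+1) : 'rV[R]_n := \row_j y ord0 (lift i j).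

Lemma rowproj_ins t v : rowproj (ins i (t, v)) = v.
Proof. by apply/rowP => j; rewrite mxE ins_lift. Qed.

Lemma measurable_rowproj : measurable_fun setT rowproj.
Proof.
apply: measurable_fun_rV => j; under eq_fun do rewrite mxE.
exact: measurable_coord.
Qed.

Lemma cube_ins (r t : R) v : cube 0 r (ins i (t, v)) <-> `|t| <= r /\ cube 0 r v.
Proof.
split => [H|[tr vr] j].
  split; first by have := H i; rewrite ins_at mxE subr0.
  by move=> j; have := H (lift i j); rewrite ins_lift !mxE.
case: (unliftP i j) => [k ->|->]; last by rewrite ins_at mxE subr0.
by rewrite ins_lift; have := vr k; rewrite !mxE.
Qed.

Lemma measurable_ins_line v : measurable_fun [set: measurableTypeR R] (fun t => ins i (t, v)).
Proof.
apply: (@measurableT_comp _ _ _ _ _ _ (ins i) _ (fun t => (t, v))); first exact: measurable_ins.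
by apply: measurable_fun_pair => //; exact: measurable_id.
Qed.

(** A weak equation tested with products a(t) b(v) is an identity between such functions of [v],
    tested with [b]. *)
Definition lineint F a v : R := \int[leb]_t (F (ins i (t, v)) * a t).

Section one_kernel.
Variables (F : 'rV[R]_n.+1 -> R) (a : R -> R) (r0 C : R).
Hypotheses (lF : Lloc 1 F) (ma : measurable_fun setT a) (aC : forall t, `|a t| <= C)
  (as0 : forall t, r0 < `|t| -> a t = 0).

Lemma integrable_line_kernel b (r B : R) : measurable_fun setT b -> (forall v, `|b v| <= B) ->
  (forall v, ~ cube 0 r v -> b v = 0) ->
  mu1.-integrable setT (EFin \o (fun y => F y * (a (y ord0 i) * b (rowproj y)))).
Proof.
move=> mb bB bs; pose r1 := Num.max r0 r.
have B0 : 0 <= B by apply: le_trans (bB 0).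
apply: (integrable_supp (A := cube 0 r1) (b := C * B)) => //.
- exact: measurable_cube.
- exact: Lloc1_integrable.
- apply: measurable_funM; first exact: (measurableT_comp ma (measurable_coord i)).
  exact: (measurableT_comp mb measurable_rowproj).
- by move=> y; rewrite normrM ler_pM.
- move=> y yr; have [ar|ar] := leP `|y ord0 i| r0; last by rewrite as0// mul0r.
  rewrite bs ?mulr0// => vr; apply: yr => j.
  case: (unliftP i j) => [k ->|->].
    by have := vr k; rewrite !mxE => /le_trans; apply; rewrite le_max lexx orbT.
  by rewrite mxE subr0 (le_trans ar)// le_max lexx.
Qed.

Lemma lineint_ae b (r B : R) : measurable_fun setT b -> (forall v, `|b v| <= B) ->
  (forall v, ~ cube 0 r v -> b v = 0) ->
  {ae mu, forall v, (\int[leb]_t (F (ins i (t, v)) * (a t * b v))%:E = (lineint F a v * b v)%:E)%E}.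
Proof.
move=> mb bB bs; have iF := integrable_ins i (integrable_line_kernel mb bB bs).
have := ae_integrable2 iF; apply: filterS => v /= iv.
have {}iv : leb.-integrable setT (EFin \o (fun t => F (ins i (t, v)) * (a t * b v))).
  by apply: eq_integrable iv => // t _; rewrite /= ins_at rowproj_ins.
(* Fubini gives integrability of the slice only after multiplication by [b v]. Where this factor is
   0 both sides vanish; elsewhere it can be divided out. *)
have [b0|b0] := eqVneq (b v) 0.
  by rewrite b0 mulr0; under eq_integral do rewrite mulr0 mulr0; exact: integral0.
have E : (\int[leb]_t (F (ins i (t, v)) * (a t * b v)) = lineint F a v * b v)%R.
  rewrite /lineint mulrC -RintegralZl//; first by apply: eq_Rintegral => t _; ring.
  rewrite (_ : _ \o _ = fun t => ((b v)^-1%:E * (EFin \o (fun t => (F (ins i (t, v)) * (a t * b v))%R)) t)%E).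
    exact: integrableZl.
  by apply/boolp.funext => t /=; rewrite -EFinM; congr (_ %:E); field.
by rewrite -E /Rintegral fineK//; exact: integrable_fin_num.
Qed.

Lemma integral_lineint_ext b (r B : R) : measurable_fun setT b -> (forall v, `|b v| <= B) ->
  (forall v, ~ cube 0 r v -> b v = 0) -> measurable_fun setT (lineint F a) ->
  (\int[mu]_v (lineint F a v * b v)%:E = \int[mu1]_y (F y * (a (y ord0 i) * b (rowproj y)))%:E)%E.
Proof.
move=> mb bB bs ml; have iF := integrable_line_kernel mb bB bs.
have mG := measurable_fubini_G (integrable_ins i iF).
rewrite (integral_ins i iF); apply: ae_eq_integral => //.
- by apply/measurable_EFinP; apply: measurable_funM.
- have := lineint_ae mb bB bs; apply: filterS => v Hv _ /=; rewrite -Hv.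
  by apply: eq_integral => t _; rewrite ins_at rowproj_ins.
Qed.

(** As [F] is only locally integrable, Fubini is applied to [F] cut off by the indicator of a cube
    in [v]. This gives measurability on each cube, and the cubes exhaust the space. *)
Lemma measurable_lineint : measurable_fun setT (lineint F a).
Proof.
have cov : \bigcup_N cube 0 N%:R = [set: 'rV[R]_n].
  rewrite -subTset => x _; have : setT x by [].
  rewrite -bigbox_cover => -[N _ xN]; exists N => // j.
  by have := xN j; rewrite !mxE subr0 -ltr_norml => /ltW.
rewrite -cov; apply/measurable_fun_bigcup => [N|N]; first exact: measurable_cube.
pose b := \1_(cube 0 N%:R) : 'rV[R]_n -> R.
have mb : measurable_fun setT b by apply: measurable_indic; exact: measurable_cube.
have bB v : `|b v| <= 1 by rewrite /b indicE; case: (_ \in _); rewrite ?normr1 ?normr0.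
have bs v : ~ cube 0 N%:R v -> b v = 0.
  by move=> vN; rewrite /b indicE memNset.
have mG := measurable_fubini_G (integrable_ins i (integrable_line_kernel mb bB bs)).
have mfG := measurableT_comp (@fine_measurable R setT measurableT) mG.
apply: (eq_measurable_fun (fine \o fubini_G leb ((EFin \o (fun y => F y * (a (y ord0 i) * b (rowproj y)))) \o ins i))).
  move=> v; rewrite inE => vN; rewrite /= /fubini_G /lineint /Rintegral; congr fine.
  by apply: eq_integral => t _; rewrite /= ins_at rowproj_ins /b indicE mem_set// mulr1.
exact: measurable_funTS.
Qed.

Lemma integral_lineint b (r B : R) : measurable_fun setT b -> (forall v, `|b v| <= B) ->
  (forall v, ~ cube 0 r v -> b v = 0) ->
  \int[mu]_v (lineint F a v * b v) = \int[mu1]_y (F y * (a (y ord0 i) * b (rowproj y))).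
Proof.
move=> mb bB bs; rewrite /Rintegral; congr fine.
by apply: integral_lineint_ext bs measurable_lineint.
Qed.

Lemma Lloc1_lineint : Lloc 1 (lineint F a).
Proof.
split; first exact: measurable_lineint.
move=> K cK; have mK : measurable K.
  by apply: closed_measurable_rV; apply: compact_closed => //; exact: norm_hausdorff.
have [r Kr] : exists r, K `<=` cube 0 r.
  have [M [_ HM]] := compact_bounded cK.
  exists (`|M| + 1) => y Ky j; rewrite mxE subr0.
  have := HM (`|M| + 1) _ y Ky; rewrite ltr_pwDr ?ler_norm// => /(_ isT).
  apply: le_trans; change (`|y ord0 j| <= mx_norm y); rewrite mx_normrE.
  exact: (le_trans _ (le_bigmax _ (fun ij => `|y ij.1 ij.2|) (ord0, j))).
pose b := \1_(cube 0 r) : 'rV[R]_n -> R.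
have mb : measurable_fun setT b by apply: measurable_indic; exact: measurable_cube.
have bB v : `|b v| <= 1 by rewrite /b indicE; case: (_ \in _); rewrite ?normr1 ?normr0.
have bs v : ~ cube 0 r v -> b v = 0.
  by move=> vN; rewrite /b indicE memNset.
have iF := integrable_ins i (integrable_line_kernel mb bB bs).
have mlb : measurable_fun setT (fun v => `|lineint F a v * b v|%:E).
  apply/measurable_EFinP; apply: measurableT_comp => //.
  by apply: measurable_funM => //; exact: measurable_lineint.
have fin := (integrable21ltyP _ _ (measurable_int _ iF)).1 iF.
apply: le_lt_trans fin; apply: (@le_trans _ _ (\int[mu]_v `|lineint F a v * b v|%:E)%E).
  rewrite [leLHS]integral_mkcond; apply: ge0_le_integral => //.
  - by move=> v _; rewrite patchE; case: ifP => // _; rewrite lee_fin powR_ge0.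
  - apply/(measurable_restrictT _ mK); apply/measurable_EFinP.
    under eq_fun do rewrite powRr1//.
    by apply: measurable_funTS; apply: measurableT_comp => //; exact: measurable_lineint.
  - move=> v _; rewrite patchE; case: ifPn => [|_]; last by rewrite lee_fin.
    rewrite inE => /Kr vr; rewrite lee_fin powRr1// /b indicE mem_set// mulr1//.
apply: ae_ge0_le_integral => //.
- by move=> v _; exact: integral_ge0.
- have mA := measurableT_comp (@abse_measurable R setT) (measurable_int _ iF).
  exact: (measurable_fun_fubini_tonelli_G _ mA (fun x => abse_ge0 _)).
have := lineint_ae mb bB bs; apply: filterS => v Hv _.
rewrite -abse_EFin -Hv (le_trans (le_abse_integral _ _ _))//.
  apply/measurable_EFinP.
  have mv := measurable_ins_line v.
  apply: measurable_funM; first by apply: measurableT_comp mv; case: lF.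
  by apply: measurable_funM.
rewrite le_eqVlt; apply/orP; left; apply/eqP; apply: eq_integral => t _.
by rewrite /= ins_at rowproj_ins.
Qed.

End one_kernel.

End line_integrals.

Lemma Lloc1B {R : realType} {n : nat} (f g : 'rV[R]_n -> R) :
  Lloc 1 f -> Lloc 1 g -> Lloc 1 (fun x => f x - g x).
Proof.
move=> [mf fK] [mg gK]; split; first exact: measurable_funB.
move=> K cK; have mK : measurable K.
  by apply: closed_measurable_rV; apply: compact_closed => //; exact: norm_hausdorff.
have fi (h : 'rV[R]_n -> R) : measurable_fun setT h ->
    (\int[lebesgue_rV n]_(x in K) ((`|h x| `^ 1)%:E) < +oo)%E ->
    (lebesgue_rV n).-integrable K (EFin \o h).
  move=> mh hK; apply/integrableP; split.
    by apply/measurable_EFinP; exact: measurable_funTS.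
  apply: le_lt_trans hK; rewrite le_eqVlt; apply/orP; left; apply/eqP.
  by apply: eq_integral => x _; rewrite powRr1.
have /integrableP[_] := integrableB mK (fi _ mf (fK _ cK)) (fi _ mg (gK _ cK)).
apply: le_lt_trans; rewrite le_eqVlt; apply/orP; left; apply/eqP.
by apply: eq_integral => x _; rewrite powRr1.
Qed.

(** * From weak second derivatives on R^n to almost every line *)

Section vanishing_weak_second_derivative.
Context {R : realType} {n : nat} (i : 'I_n.+1).
Local Notation leb := (@lebesgue_measure R).
Local Notation mu := (@lebesgue_rV R n).
Local Notation mu1 := (@lebesgue_rV R n.+1).
Local Notation e := (fun i : 'I_n.+1 => delta_mx ord0 i : 'rV[R]_n.+1).

(** Along direction [i] the bump in the other coordinates is constant, so derivatives in that
    direction fall on [a] alone. *)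
Definition cylinder (a : R -> R) k (l r : 'rV[R]_n) (y : 'rV[R]_n.+1) : R :=
  a (y ord0 i) * boxbump k l r (rowproj i y).

Lemma Ck_bump_proj m k (l r : 'rV[R]_n) : Ck e m (fun y => boxbump k l r (rowproj i y)).
Proof.
apply: Ck_prod => j.
rewrite (_ : (fun y => _) = fun y : 'rV[R]_n.+1 =>
   expinv (k.+1%:R * (y ord0 (lift i j) + (- l ord0 j))) *
   expinv (k.+1%:R * (r ord0 j + (-1) * y ord0 (lift i j)))); last first.
  by apply/boolp.funext => y; rewrite mxE mulN1r.
apply: CkM; apply: Ck_pexpinv; apply: CkZ; apply: CkD.
- exact: Ck_coord.
- exact: Ck_cst.
- exact: Ck_cst.
- by apply: CkZ; exact: Ck_coord.
Qed.

Lemma is_derive_bump_proj k (l r : 'rV[R]_n) y :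
  is_derive y (delta_mx ord0 i) (fun y => boxbump k l r (rowproj i y)) 0.
Proof.
apply: is_derive_line => h; rewrite mulr0 add0r; congr (boxbump _ _ _ _).
by apply/rowP => j; rewrite !mxE eqxx /= [lift i j == i]eq_sym (negbTE (neq_lift _ _)) mulr0 add0r.
Qed.

Lemma is_derive_cylinder (a : R -> R) k l r y : smooth1 a ->
  is_derive y (delta_mx ord0 i) (cylinder a k l r) (cylinder (derive1 a) k l r y).
Proof.
move=> sa; apply: (is_derive_congr (is_deriveM (is_derive_comp_coord i i y sa)
  (is_derive_bump_proj k l r y))) => //.
by rewrite /cylinder eqxx mulr1 scaler0 add0r [LHS]mulrC.
Qed.

Lemma pderivs2_cylinder (a : R -> R) k l r y : smooth1 a ->
  pderivs [:: i; i] (cylinder a k l r) y = cylinder (derive1 (derive1 a)) k l r y.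
Proof.
move=> sa; rewrite /pderivs/=.
have -> : 'D_(delta_mx ord0 i) (cylinder a k l r) = cylinder (derive1 a) k l r.
  by apply/boolp.funext => z; have [] := is_derive_cylinder k l r z sa.
by have [] := is_derive_cylinder k l r y (smooth1_derive1 sa).
Qed.

Lemma cylinder_supp (a : R -> R) k l r (N : R) y : obox l r `<=` cube 0 N ->
  (forall t, N < `|t| -> a t = 0) -> cylinder a k l r y != 0 -> cube 0 N y.
Proof.
move=> lrN aN; rewrite mulf_eq0 negb_or => /andP[a0 b0] j.
case: (unliftP i j) => [k' ->|->]; last first.
  by rewrite mxE subr0 leNgt; apply/negP => /aN a0'; rewrite a0' eqxx in a0.
have : obox l r (rowproj i y).
  by apply: contrapT => /(bump_out k) b0'; rewrite b0' eqxx in b0.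
by move=> /lrN/(_ k'); rewrite !mxE.
Qed.

Lemma test_function_cylinder (a : R -> R) k l r (N : R) : smooth1 a ->
  (forall t, N < `|t| -> a t = 0) -> test_function (cylinder a k l r).
Proof.
move=> sa aN; have [N' H] := obox_sub_cube l r.
have lrN : obox l r `<=` cube 0 (Num.max N N').
  by move=> x /H Hx j; rewrite (le_trans (Hx j))// le_max lexx orbT.
apply: (@test_function_cube _ _ _ 0 (Num.max N N')).
  apply: Ck_smooth => m; apply: CkM; last exact: Ck_bump_proj.
  exact: Ck_comp_coord.
move=> x; apply: cylinder_supp => // t tN; apply: aN.
by apply: le_lt_trans tN; rewrite le_max lexx.
Qed.

Lemma bounded_supp (a : R -> R) (N : R) : continuous a -> (forall t, N < `|t| -> a t = 0) ->
  exists C, forall t, `|a t| <= C.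
Proof.
move=> ca aN.
have [D [_ HD]] : bounded_set (a @` `[- N, N]).
  apply: compact_bounded; apply: continuous_compact; last exact: segment_compact.
  exact: continuous_subspaceT.
exists (`|D| + 1) => t.
have [tN|tN] := leP `|t| N; last by rewrite aN// normr0 addr_ge0.
by apply: HD; [rewrite ltr_pwDr// ler_norm|exists t => //=; rewrite in_itv/= -ler_norml].
Qed.

Variables (u w : 'rV[R]_n.+1 -> R).
Hypotheses (cu : continuous u) (weak : weak_derivative [:: i; i] u w).

(** Testing the weak derivative with cylinders shows that the difference of the two sides, as a
    function of [v], integrates to 0 against every [boxbump]; the fundamental lemma then applies in
    the remaining variables. *)
Lemma weak_on_lines (a : R -> R) (N : R) : smooth1 a -> (forall t, N < `|t| -> a t = 0) ->
  (forall t, N < `|t| -> derive1 (derive1 a) t = 0) ->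
  {ae mu, forall v, lineint i u (derive1 (derive1 a)) v = lineint i w a v}.
Proof.
move=> sa aN a2N; have [lu lw Hw] := weak.
have sa2 := smooth1_derive1 (smooth1_derive1 sa).
have ca := smooth1_continuous sa; have ca2 := smooth1_continuous sa2.
have [C aC] := bounded_supp ca aN; have [C2 a2C] := bounded_supp ca2 a2N.
have ma := continuous_measurable_fun ca; have ma2 := continuous_measurable_fun ca2.
have l1 := Lloc1_lineint i lw ma aC aN.
have l2 := Lloc1_lineint i lu ma2 a2C a2N.
have : {ae mu, forall v, lineint i u (derive1 (derive1 a)) v - lineint i w a v = 0}.
  apply: (ae_eq0_bump (Lloc1B l2 l1)) => k l r.
  have mb : measurable_fun setT (boxbump k l r) by exact: (continuous_measurable_rV (@continuous_bump _ _ k l r)).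
  have bB v : `|boxbump k l r v| <= 1 by rewrite ger0_norm ?bump_ge0 ?bump_le1.
  have [N' H] := obox_sub_cube l r.
  have bs v : ~ cube 0 N' v -> boxbump k l r v = 0 by move=> vN; apply: bump_out => /H.
  have ib (L : 'rV[R]_n -> R) : Lloc 1 L -> mu.-integrable setT (EFin \o (fun v => L v * boxbump k l r v)).
    move=> lL; apply: (integrable_supp (A := cube 0 N') (b := 1)) => //.
      exact: measurable_cube.
    exact: Lloc1_integrable.
  transitivity (\int[mu]_x (lineint i u (derive1 (derive1 a)) x * boxbump k l r x) -
                \int[mu]_x (lineint i w a x * boxbump k l r x)).
    rewrite -RintegralB//; [|exact: ib|exact: ib].
    by apply: eq_Rintegral => x _; rewrite mulrBl.
  rewrite (integral_lineint i lu ma2 a2C a2N mb bB bs) (integral_lineint i lw ma aC aN mb bB bs).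
  apply/eqP; rewrite subr_eq0; apply/eqP.
  have := Hw _ (test_function_cylinder k l r sa aN).
  rewrite expr2 mulrN1 opprK mul1r => <-.
  by apply: eq_Rintegral => x _; rewrite pderivs2_cylinder.
by apply: filterS => v /eqP; rewrite subr_eq0 => /eqP.
Qed.

Lemma weak_on_lines_tent : {ae mu, forall v, forall (p q r : rat) k,
  lineint i u (tentDD k (ratr p) (ratr q) (ratr r)) v =
  lineint i w (tent k (ratr p) (ratr q) (ratr r)) v}.
Proof.
have one (p q r : rat) k : {ae mu, forall v,
    lineint i u (tentDD k (ratr p) (ratr q) (ratr r)) v =
    lineint i w (tent k (ratr p) (ratr q) (ratr r)) v}.
  pose N : R := `|ratr p| + `|ratr q| + `|ratr r|.
  have pN : `|ratr p| <= N by rewrite /N -addrA lerDl addr_ge0.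
  have qN : `|ratr q| <= N by rewrite /N addrAC lerDr addr_ge0.
  have rN : `|ratr r| <= N by rewrite /N lerDr addr_ge0.
  rewrite -derive1_tent; apply: (@weak_on_lines _ (N + 1)).
  - exact: smooth1_tent.
  - move=> t tN; apply: (tent_supp k pN qN rN); rewrite /= in_itv/= -ler_norml.
    by apply/negP; rewrite -ltNge.
  - move=> t tN; rewrite derive1_tent /tentDD /second_diff.
    have k1 : k.+1%:R^-1 <= 1 :> R by rewrite invf_le1 ?ltr0n// ler1n.
    have out a : `|a| <= N -> rampDD k a t = 0.
      move=> aN; apply: rampDD_out; rewrite (le_lt_trans k1)//.
      have := ler_normD (t - a) a; rewrite subrK => H.
      by rewrite -(ltrD2r N) addrC (lt_le_trans tN)// (le_trans H)// lerD.
    by rewrite !out// !mulr0 subrr addr0.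
(* The quadruples (p, q, r, k) are enumerated by [pickle], so that the exceptional sets of lines
   form a countable union. *)
pose Q : nat -> 'rV[R]_n -> Prop := fun m v =>
  if unpickle m is Some (p, q, r, k) then
    lineint i u (tentDD k (ratr (p:rat)) (ratr (q : rat)) (ratr (r:rat))) v =
    lineint i w (tent k (ratr p) (ratr q) (ratr r)) v
  else True.
have : {ae mu, forall v m, Q m v}.
  apply: ae_foralln => m; rewrite /Q.
  case: (unpickle m) => [[[[p q] r] k]|]; first exact: one.
  exact: aeW.
apply: filterS => v Hv p q r k; have := Hv (pickle (p, q, r, k)).
by rewrite /Q pickleK.
Qed.

Lemma locint_lines : {ae mu, forall v, locint (fun t => w (ins i (t, v)))}.
Proof.
have [_ lw _] := weak.
have mline v : measurable_fun [set: measurableTypeR R] (fun t => w (ins i (t, v))).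
  by apply: (measurableT_comp lw.1); exact: measurable_ins_line.
have : {ae mu, forall v N, cube 0 N%:R v ->
    leb.-integrable `[- N%:R, N%:R] (EFin \o (fun t => w (ins i (t, v))))}.
  apply: ae_foralln => N.
  have iN : mu1.-integrable setT (EFin \o (fun y => w y * \1_(cube 0 N%:R) y)).
    apply: (integrable_supp (A := cube 0 N%:R) (b := 1)) => //.
    - exact: measurable_cube.
    - exact: Lloc1_integrable.
    - by apply: measurable_indic; exact: measurable_cube.
    - by move=> y; rewrite indicE; case: (_ \in _); rewrite ?normr1 ?normr0.
    - by move=> y yN; rewrite indicE memNset.
  have := ae_integrable2 (integrable_ins i iN); apply: filterS => v Hv vN.
  have {}Hv := @integrableS _ (measurableTypeR R) R leb _ _ _ measurableT (measurable_itv `[- N%:R, N%:R]) (@subsetT _ _) Hv.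
  apply: eq_integrable Hv => // t; rewrite inE/= in_itv/= -ler_norml => tN.
  by rewrite indicE mem_set ?mulr1//; apply/cube_ins.
apply: filterS => v Hv; split; first exact: mline.
move=> l r.
have [N lrN] : exists N : nat, [/\ - N%:R <= l, r <= N%:R & cube 0 N%:R v].
  pose M : R := `|l| + `|r| + \sum_j `|v ord0 j|.
  exists (Num.truncn M).+1.
  have MN : M <= (Num.truncn M).+1%:R by exact/ltW/truncnS_gt.
  have s0 : 0 <= \sum_j `|v ord0 j| by exact: sumr_ge0.
  have lM : `|l| <= M by rewrite /M -addrA lerDl addr_ge0.
  have rM : `|r| <= M by rewrite /M addrAC lerDr addr_ge0.
  split.
  - rewrite lerNl (le_trans _ MN)// (le_trans _ lM)//.
    by rewrite -normrN ler_norm.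
  - by rewrite (le_trans (ler_norm _))// (le_trans rM).
  - move=> j; rewrite mxE subr0 (le_trans _ MN)// /M (bigD1 j)//=.
    by rewrite addrA addrAC lerDr addr_ge0// ?addr_ge0// sumr_ge0.
have [l1 r1 vN] := lrN.
apply: (@integrableS _ (measurableTypeR R) R leb _ _ _ (measurable_itv `[- N%:R, N%:R])
  (measurable_itv `[l, r]) _ (Hv N vN)).
by apply: subset_itv; rewrite bnd_simp.
Qed.

Lemma continuous_ins v : continuous (fun t : R => ins i (t, v)).
Proof.
rewrite (_ : (fun t => _) = fun t : R => t *: delta_mx ord0 i + ins i (0, v)).
  move=> t; apply: cvgD; last exact: cvg_cst.
  by apply: cvgZl; exact: cvg_id.
apply/boolp.funext => t; apply/rowP => j; rewrite !mxE eqxx /=.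
case: (unliftP i j) => [k ->|->]; last by rewrite eqxx mulr1 addr0.
by rewrite eq_sym (negbTE (neq_lift _ _)) mulr0 add0r.
Qed.

(** The set where u = c and w is nonzero is measurable, and on almost every line in direction [i] it
    is null by [ae_eq0_level]. By Tonelli it is null. *)
Lemma weak_second_derivative_level (c : R) : {ae mu1, forall y, u y = c -> w y = 0}.
Proof.
have [lu lw _] := weak.
pose Bad := [set y | u y = c] `&` [set y | w y != 0].
have mBad : measurable Bad.
  apply: measurableI.
    by rewrite -[X in measurable X]setTI; exact: (lu.1 measurableT [set c] (measurable_set1 c)).
  have -> : [set y | w y != 0] = w @^-1` (~` [set 0]).
    by apply/seteqP; split => y /= /eqP.
  rewrite -[X in measurable X]setTI.
  exact: (lw.1 measurableT (~` [set 0]) (measurableC (measurable_set1 0))).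
have mI : measurable_fun setT (fun y => (\1_Bad y : R)%:E).
  by apply/measurable_EFinP; exact: measurable_indic.
have I0 y : (0 <= (\1_Bad y : R)%:E)%E by rewrite lee_fin indicE ler0n.
have Bad0 : mu1 Bad = 0%E.
  have := integral_indic mu1 measurableT mBad; rewrite setIT => <-.
  rewrite (integral_ins_ge0 i mI I0).
  have mIi := measurableT_comp mI (measurable_ins i).
  rewrite -[RHS](integral0 mu setT); apply: ae_eq_integral => //.
    exact: (@measurable_fun_fubini_tonelli_G _ _ _ _ _ leb _ mIi (fun x => I0 _)).
  have := weak_on_lines_tent; move: locint_lines.
  apply: filterS2 => v lv wv _.
  have cv : continuous (fun t => u (ins i (t, v))).
    by move=> t; apply: continuous_comp; [exact: continuous_ins|exact: cu].
  have := ae_eq0_level cv lv wv c => H.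
  rewrite -[RHS](integral0 leb setT); apply: ae_eq_integral => //.
    exact: (measurableT_comp mI (measurable_ins_line i v)).
  apply: (@filterS _ _ (ae_filter_ringOfSetsType leb)) H => t Ht _.
  rewrite indicE; case: (boolP (_ \in _)) => //; rewrite inE => -[/Ht w0 /eqP].
  by rewrite w0.
exists Bad; split => // y /= /not_implyP[uy wy].
by split => //=; apply/eqP.
Qed.

End vanishing_weak_second_derivative.

(** * The integral of a compactly supported derivative *)

Section integral_of_derivative.
Context {R : realType} {n : nat} (i : 'I_n.+1).
Local Notation leb := (@lebesgue_measure R).
Local Notation mu1 := (@lebesgue_rV R n.+1).

Lemma ins_shift (t h : R) v : ins i (h + t, v) = h *: delta_mx ord0 i + ins i (t, v) :> 'rV[R]_n.+1.
Proof.
apply/rowP => j; rewrite !mxE eqxx /=.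
case: (unliftP i j) => [k ->|->]; last by rewrite eqxx mulr1.
by rewrite [lift i k == i]eq_sym (negbTE (neq_lift _ _)) mulr0 add0r.
Qed.

Lemma is_derive_ins (psi : 'rV[R]_n.+1 -> R) v (t c : R) :
  is_derive (ins i (t, v)) (delta_mx ord0 i) psi c ->
  is_derive t 1 (fun t => psi (ins i (t, v))) c.
Proof.
move=> [d1 d2].
have E : (fun h : R => h^-1 *: (((fun t => psi (ins i (t, v))) \o shift t) (h *: (1:R)) -
      psi (ins i (t, v)))) =
    (fun h : R => h^-1 *: ((psi \o shift (ins i (t, v))) (h *: delta_mx ord0 i) - psi (ins i (t, v)))).
  by apply/boolp.funext => h; rewrite /= [h *: 1]mulr1 ins_shift.
by split; [rewrite /derivable E|rewrite -d2 /derive E].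
Qed.

Lemma integral_derive0 (psi Dpsi : 'rV[R]_n.+1 -> R) c (r : R) :
  (forall y, is_derive y (delta_mx ord0 i) psi (Dpsi y)) -> continuous Dpsi ->
  (forall y, psi y != 0 -> cube c r y) -> (forall y, Dpsi y != 0 -> cube c r y) ->
  \int[mu1]_y Dpsi y = 0.
Proof.
move=> pD cD ps Ds.
have [B B0 HB] := continuous_bounded_cube c r cD.
have DB y : `|Dpsi y| <= B.
  have [->|/Ds] := eqVneq (Dpsi y) 0; first by rewrite normr0.
  exact: HB.
have iD : mu1.-integrable setT (EFin \o Dpsi).
  have L1 : Lloc 1 (cst 1 : 'rV[R]_n.+1 -> R) by apply: Lloc1_continuous; exact: cst_continuous.
  have := integrable_cube_supp L1 (continuous_measurable_rV cD) DB Ds.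
  by apply: eq_integrable => // y _; rewrite /= mul1r.
rewrite /Rintegral (integral_ins i iD) (_ : (\int[_]_v _)%E = 0%E)//.
apply: integral0_eq => v _.
(* The segment is longer than the cube by 1 on each side, so [psi] vanishes at its ends; the maximum
   with 0 covers a negative [r]. *)
pose l := c ord0 i - Num.max r 0 - 1; pose rr := c ord0 i + Num.max r 0 + 1.
have m0 : 0 <= Num.max r 0 by rewrite le_max lexx orbT.
have mr : r <= Num.max r 0 by rewrite le_max lexx.
have out (f : 'rV[R]_n.+1 -> R) t : (forall y, f y != 0 -> cube c r y) ->
    t <= l \/ rr <= t -> f (ins i (t, v)) = 0.
  move=> fs tlr; apply/eqP; apply: contrapT => /negP /fs/(_ i); rewrite ins_at => H.
  by move: H tlr; rewrite /l /rr ler_norml => /andP[? ?] [?|?]; lra.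
have lr : l < rr by rewrite /l /rr; lra.
rewrite (_ : (\int[leb]_t _)%E = (\int[leb]_(t in `[l, rr]) (Dpsi (ins i (t, v)))%:E)%E); last first.
  rewrite [RHS]integral_mkcond; apply: eq_integral => t _; rewrite patchE.
  case: ifPn => //; rewrite notin_setE/= in_itv/= => /negP.
  rewrite negb_and -!ltNge => H; rewrite out//.
  by case/orP: H => /ltW; [left|right].
have FD t := is_derive_ins (pD (ins i (t, v))).
have cF : continuous (fun t => psi (ins i (t, v))).
  by move=> t; apply/differentiable_continuous/derivable1_diffP; have [] := FD t.
rewrite (@continuous_FTC2 _ _ (fun t => psi (ins i (t, v)))) //.
- by rewrite !out ?subee//; [left|right].
- apply: continuous_subspaceT => t; apply: continuous_comp; first exact: continuous_ins.
  exact: cD.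
- split; first by move=> t _; have [] := FD t.
    exact/cvg_at_right_filter/cF.
  exact/cvg_at_left_filter/cF.
- by move=> t _; rewrite derive1E; have [_ ->] := FD t.
Qed.

End integral_of_derivative.

(** * Averages *)

Section kernel_bounds.
Context {R : realType}.
Implicit Types (p : {poly R}) (s t : R).

Lemma pexpinv_bounded p : exists2 C : R, 0 <= C & forall t, t <= 1 -> `|pexpinv p t| <= C.
Proof.
have [C C0 HC] := pexpinv_bound p; exists C => // t t1.
have [t0|t0] := leP t 0; first by rewrite pexpinv_le0// normr0.
by rewrite (le_trans (HC _ t1))// ler_piMr// exprn_ile1// ltW.
Qed.

Lemma pexpinv_lipschitz p : exists2 C : R, 0 <= C &
  forall a b, a <= 1 -> b <= 1 -> `|pexpinv p a - pexpinv p b| <= C * `|a - b|.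
Proof.
have [C C0 HC] := pexpinv_bounded (pexpinv_next p); exists C => //.
suff main a b : a < b -> b <= 1 -> `|pexpinv p b - pexpinv p a| <= C * `|b - a|.
  move=> a b a1 b1; have [ab|ab|->] := ltgtP a b.
  - by rewrite distrC (distrC a); exact: main.
  - exact: main.
  - by rewrite !subrr normr0 mulr0.
move=> ab b1.
have [x xab ->] := @MVT R (pexpinv p) (pexpinv (pexpinv_next p)) _ _ ab
  (fun x _ => is_derive_pexpinv p x) (continuous_subspaceT (@continuous_pexpinv R p)).
rewrite normrM ler_wpM2r// HC//; move: xab; rewrite in_itv/= => /andP[_ /ltW xb].
exact: le_trans b1.
Qed.

Context {n : nat}.
Implicit Types x y : 'rV[R]_n.

Lemma rk_bounded p : exists2 C : R, 0 <= C & forall s x y, `|rk p s x y| <= C.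
Proof.
have [C C0 HC] := pexpinv_bounded p; exists C => // s x y.
by apply: HC; exact: rk_arg_le1.
Qed.

(** In each coordinate a difference of squares factors into a term at most [d] and a sum of two
    distances. As [y] is within [s] of one centre and within s + d of the other, that sum is at most
    3s. *)
Lemma sqd_near s d x x' y : 0 <= d -> d <= s -> (forall i, `|x ord0 i - x' ord0 i| <= d) ->
  cube x s y \/ cube x' s y -> `|sqd x y - sqd x' y| <= n%:R * (3 * d * s).
Proof.
move=> d0 ds xx' yc.
rewrite /sqd -sumrB (le_trans (ler_norm_sum _ _ _))//.
have -> : n%:R * (3 * d * s) = \sum_(i < n) (3 * d * s).
  by rewrite sumr_const card_ord mulr_natl.
apply: ler_sum => i _.
have -> : (y ord0 i - x ord0 i) ^+ 2 - (y ord0 i - x' ord0 i) ^+ 2 =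
  (x ord0 i - x' ord0 i) * ((x ord0 i - y ord0 i) + (x' ord0 i - y ord0 i)) by ring.
rewrite normrM; have -> : 3 * d * s = d * (3 * s) by ring.
apply: ler_pM => //.
have := xx' i; rewrite ler_norml => /andP[? ?].
by case: yc => /(_ i); rewrite !ler_norml => /andP[? ?]; apply/andP; split; lra.
Qed.

(** If both bumps vanish at [y] there is nothing to prove; otherwise [y] is close to one of the
    centres and [sqd_near] applies. The bound depends on d/s alone, as scaling dictates. *)
Lemma rk_lipschitz p : exists2 C : R, 0 <= C & forall (s d : R) x x' y, 0 < s -> 0 <= d -> d <= s ->
  (forall i, `|x ord0 i - x' ord0 i| <= d) ->
  `|rk p s x y - rk p s x' y| <= C * (d / s).
Proof.
have [C C0 HC] := pexpinv_lipschitz p; exists (C * (n%:R * 3)); first by rewrite !mulr_ge0.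
move=> s d x x' y s0 d0 ds xx'.
have [/orP yc|/norP[]] := boolP ((rk p s x y != 0) || (rk p s x' y != 0)); last first.
  rewrite !negbK => /eqP-> /eqP->; rewrite subrr normr0 !mulr_ge0// invr_ge0 ltW//.
have {}yc : cube x s y \/ cube x' s y by case: yc => /rk_supp; [left|right]; auto.
rewrite (le_trans (HC _ _ (rk_arg_le1 _ _ _) (rk_arg_le1 _ _ _)))// -mulrA ler_wpM2l//.
have -> : 1 - sqd x y / s ^+ 2 - (1 - sqd x' y / s ^+ 2) = - ((sqd x y - sqd x' y) / s ^+ 2) by ring.
rewrite normrN normrM [X in _ * X]ger0_norm ?invr_ge0 ?sqr_ge0// ler_pdivrMr ?exprn_gt0//.
rewrite (le_trans (sqd_near d0 ds xx' yc))// le_eqVlt; apply/orP; left; apply/eqP.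
by field; rewrite gt_eqF.
Qed.

End kernel_bounds.

Section averages.
Context {R : realType} {n : nat}.
Local Notation mu := (@lebesgue_rV R n).
Implicit Types (u : 'rV[R]_n -> R) (s : R) (x y : 'rV[R]_n).

(** This is A_s(x), for a kernel that is not normalised; its mass enters through the lower bound
    [integral_eta_ge]. *)
Definition avg u s x : R := \int[mu]_y (u y * eta s x y).

Lemma continuous_eta s x : continuous (eta s x).
Proof. exact: (Ck_continuous (CkZ _ (Ck_rk 0 (@p1 R) s x))). Qed.

Lemma continuous_lapk s x : continuous (lapk s x).
Proof.
rewrite (_ : lapk s x = fun y => 4 / s ^+ 4 * (sqd x y * rk p2 s x y) +
    (- (2 * n%:R / s ^+ 2)) * rk p1 s x y); last first.
  by apply/boolp.funext => y; rewrite /lapk; ring.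
apply: (Ck_continuous (k := 0)); apply: CkD; apply: CkZ; last exact: Ck_rk.
by apply: CkM; [exact: Ck_sqd|exact: Ck_rk].
Qed.

Lemma eta_supp s x y : 0 < s -> eta s x y != 0 -> cube x s y.
Proof. by move=> s0; rewrite mulf_eq0 negb_or => /andP[_ /rk_supp]; apply. Qed.

Lemma lapk_supp s x y : 0 < s -> lapk s x y != 0 -> sqd x y < s ^+ 2.
Proof.
move=> s0 l0; rewrite ltNge; apply/negP => ss.
have r0 p : rk p s x y = 0.
  by apply/eqP; apply: contraT => /(rk_supp_sqd s0); rewrite ltNge ss.
by rewrite /lapk !r0 !mulr0 subrr eqxx in l0.
Qed.

Lemma lapk_bounded : exists2 C : R, 0 <= C & forall s x y, 0 < s -> `|lapk s x y| <= C / s ^+ 2.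
Proof.
have [C1 C10 H1] := @rk_bounded R n (@p1 R); have [C2 C20 H2] := @rk_bounded R n (@p2 R).
exists (4 * C2 + 2 * n%:R * C1); first by rewrite addr_ge0 ?mulr_ge0.
move=> s x y s0; have s2 : 0 < s ^+ 2 by rewrite exprn_gt0.
have [->|l0] := eqVneq (lapk s x y) 0; first by rewrite normr0 divr_ge0 ?addr_ge0 ?mulr_ge0// ltW.
have ys := ltW (lapk_supp s0 l0).
rewrite /lapk (le_trans (ler_normB _ _))// [leRHS]mulrDl; apply: lerD.
  have -> : 4 * sqd x y / s ^+ 4 * rk p2 s x y = 4 * rk p2 s x y / s ^+ 2 * (sqd x y / s ^+ 2).
    by field; rewrite gt_eqF.
  rewrite normrM (_ : 4 * C2 / s ^+ 2 = 4 * C2 / s ^+ 2 * 1); last by rewrite mulr1.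
  apply: ler_pM => //; last first.
    by rewrite ger0_norm ?divr_ge0 ?sqd_ge0 ?(ltW s2)// ler_pdivrMr// mul1r.
  rewrite !normrM [X in _ * X]ger0_norm ?invr_ge0 ?(ltW s2)// ler_wpM2r ?invr_ge0 ?(ltW s2)//.
  by rewrite (ger0_norm (_ : 0 <= 4))// ler_wpM2l.
have n0 : 0 <= 2 * n%:R :> R by rewrite mulr_ge0.
rewrite normrM ger0_norm ?divr_ge0 ?(ltW s2)//.
rewrite [leRHS]mulrAC; apply: ler_wpM2l => //.
by rewrite divr_ge0// ltW.
Qed.

Lemma integrable_kernel u (k : 'rV[R]_n -> R) x s : Lloc 1 u -> continuous k ->
  (forall y, k y != 0 -> cube x s y) -> mu.-integrable setT (EFin \o (fun y => u y * k y)).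
Proof.
move=> lu ck ks; have [B B0 HB] := continuous_bounded_cube x s ck.
apply: (integrable_cube_supp (b := B) lu (continuous_measurable_rV ck) _ ks).
by move=> y; have [->|/ks] := eqVneq (k y) 0; [rewrite normr0|exact: HB].
Qed.

(** Differentiation under the integral for t in (s/2, 2s): there the derivative of the integrand is
    dominated by a fixed multiple of |u| on the cube of radius 2s. *)
Lemma is_derive_avg u s x : Lloc 1 u -> 0 < s ->
  is_derive s 1 (fun t => avg u t x) (s * s ^- n * \int[mu]_y (u y * lapk s x y)).
Proof.
move=> lu s0.
have [C C0 HC] := lapk_bounded.
pose f (t : R) y := u y * eta t x y.
have df (t : R) y : 0 < t -> is_derive t 1 (f ^~ y) (u y * (t * t ^- n * lapk t x y)).
  by move=> t0; exact: (is_deriveZ (u y) (is_derive_eta x y t0)).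
pose a := s / 2; pose b := 2 * s.
have a0 : 0 < a by rewrite divr_gt0.
have abs : (`]a, b[%classic : set R) s by rewrite /= in_itv/= /a /b; apply/andP; split; lra.
have pos (t : R) : (`]a, b[%classic : set R) t -> 0 < t.
  by rewrite /= in_itv/= => /andP[/(lt_trans a0)].
have intf (t : R) : (`]a, b[%classic : set R) t -> mu.-integrable setT (EFin \o f t).
  move=> /pos t0; apply: (integrable_kernel lu (@continuous_eta t x) (s := t)).
  by move=> y; exact: eta_supp.
have derf (t : R) y : (`]a, b[%classic : set R) t -> setT y -> derivable (f ^~ y) t 1.
  by move=> /pos t0 _; have [] := df t y t0.
(* [K] multiplies the bounds t <= b, t^(-n) <= a^(-n) and |lapk| <= C/a^2. The existential keeps it
   opaque. *)
have [K KE] : exists K, K = C * b * a ^- n / a ^+ 2 by exists (C * b * a ^- n / a ^+ 2).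
have K0 : 0 <= K.
  rewrite KE.
  by rewrite !mulr_ge0// ?invr_ge0 ?exprn_ge0// ltW// mulr_gt0.
pose G y := `|u y| * (K * \1_(cube x b) y).
have G0 y : 0 <= G y by rewrite /G !mulr_ge0// indicE ler0n.
have mc := measurable_cube x b.
have intG : mu.-integrable setT (EFin \o G).
  have mk : measurable_fun setT (fun y => K * \1_(cube x b) y : R).
    by apply: measurable_funM => //; exact: measurable_indic.
  have kK y : `|K * \1_(cube x b) y| <= K.
    rewrite indicE; case: (_ \in _); rewrite ?mulr1 ?mulr0 ?normr0//.
    by rewrite ger0_norm.
  have ks y : ~ cube x b y -> K * \1_(cube x b) y = 0 by move=> yb; rewrite indicE memNset// mulr0.
  have := integrable_norm (integrable_supp mc (Lloc1_integrable x b lu) mk kK ks).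
  apply: eq_integrable => // y _.
  by rewrite /= normrM [`|K * _|]ger0_norm// mulr_ge0// indicE ler0n.
have Gub (t : R) y : (`]a, b[%classic : set R) t -> setT y -> `|partial1of2 f t y| <= G y.
  move=> tab _; have t0 := pos t tab.
  rewrite partial1of2E; have [_ ->] := df t y t0.
  rewrite /G normrM ler_wpM2l//.
  have [->|l0] := eqVneq (lapk t x y) 0.
    by rewrite mulr0 normr0 mulr_ge0// indicE ler0n.
  move: tab; rewrite /= in_itv/= => /andP[at_ tb].
  have yb : cube x b y.
    by move=> j; rewrite (le_trans (sqd_cube t0 (lapk_supp t0 l0) j))// ltW.
  have inva m : t ^- m <= a ^- m.
    by rewrite lef_pV2 ?posrE ?exprn_gt0// lerXn2r ?nnegrE ?ltW.
  have h3 : `|lapk t x y| <= C / a ^+ 2.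
    by rewrite (le_trans (HC _ _ _ t0))// ler_wpM2l.
  rewrite indicE mem_set// mulr1 !normrM (gtr0_norm t0) ger0_norm ?invr_ge0 ?exprn_ge0 ?(ltW t0)//.
  rewrite (_ : K = b * a ^- n * (C / a ^+ 2)); last by rewrite KE; ring.
  have t0' := ltW t0; have tn0 : 0 <= t ^- n by rewrite invr_ge0 exprn_ge0.
  apply: ler_pM => //; first by rewrite mulr_ge0.
  by apply: ler_pM => //; rewrite ltW.
have mT : measurable [set: 'rV[R]_n] by exact: measurableT.
have D1 := derivable_under_integral mT abs intf derf G0 intG Gub.
have D2 := differentiation_under_integral mT abs intf derf G0 intG Gub.
split; first exact: D1.
rewrite -derive1E; transitivity (\int[mu]_y (partial1of2 f s y)); first exact: D2.
rewrite -RintegralZl//; last first.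
  apply: (integrable_kernel lu (@continuous_lapk s x) (s := s)).
  by move=> y /(lapk_supp s0); exact: sqd_cube.
apply: eq_Rintegral => y _; rewrite partial1of2E; have [_ ->] := df s y s0.
ring.
Qed.

End averages.


(** * Mass of the kernels and averages at small scales *)

Section radial_integrals.
Context {R : realType}.
Implicit Types (s : R).

Lemma pexpinv_p1E (t : R) : pexpinv (@p1 R) t = t ^- 2 * expinv t.
Proof.
rewrite /expinv /pexpinv; case: ifP => t0; last by rewrite mulr0.
rewrite /p1 /pexpinv_next derivC subr0 mulr1 hornerXn hornerC mul1r.
by rewrite exprVn.
Qed.

Lemma expinv_ge_quarter (t : R) : 1 / 4 <= t -> expR (- 4) <= expinv t.
Proof.
move=> t4; have t0 : 0 < t by lra.
rewrite /expinv /pexpinv t0 hornerC mul1r ler_expR lerN2.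
by rewrite -[leRHS]invrK lef_pV2 ?posrE ?invr_gt0//; move: t4; rewrite div1r.
Qed.

Lemma pexpinv_p1_ge (t : R) : 0 <= pexpinv (@p1 R) t.
Proof. by rewrite pexpinv_p1E mulr_ge0 ?expinv_ge0// invr_ge0 sqr_ge0. Qed.

Lemma pexpinv_p1_ge_quarter (t : R) : 1 / 4 <= t -> t <= 1 -> expR (- 4) <= pexpinv (@p1 R) t.
Proof.
move=> t4 t1; have t0 : 0 < t by lra.
rewrite pexpinv_p1E (le_trans (expinv_ge_quarter t4))// ler_peMl ?expinv_ge0//.
by rewrite -[leLHS]invr1 lef_pV2 ?posrE ?exprn_gt0// exprn_ile1// ltW.
Qed.

Section any_dim.
Context {n : nat}.
Local Notation mu := (@lebesgue_rV R n).
Implicit Types (u w : 'rV[R]_n -> R) (x y : 'rV[R]_n).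

Lemma Rintegral_sum m (f : 'I_m -> 'rV[R]_n -> R) :
  (forall i, mu.-integrable setT (EFin \o f i)) ->
  \int[mu]_y (\sum_i f i y) = \sum_i \int[mu]_y f i y.
Proof.
move=> fi; rewrite /Rintegral.
under eq_integral do rewrite -sumEFin.
rewrite integral_sum//.
by rewrite -sum_fine// => i _; apply: integrable_fin_num (fi i).
Qed.

Lemma continuous_pderivs2_rk s x i : 0 < s -> continuous (pderivs [:: i; i] (rk 1 s x)).
Proof. by move=> s0; have [/(_ [:: i; i])[]] := test_function_rk 1 x s0. Qed.

Lemma pderivs2_rk_supp s x i y : 0 < s -> pderivs [:: i; i] (rk 1 s x) y != 0 -> cube x s y.
Proof.
move=> s0; rewrite pderivs2_rk => H; apply: sqd_cube => //; rewrite ltNge; apply/negP => ss.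
have r0 p : rk p s x y = 0.
  by apply/eqP; apply: contraT => /(rk_supp_sqd s0); rewrite ltNge ss.
by move: H; rewrite !r0 !mulr0 subrr eqxx.
Qed.

Lemma eta_ge0 s x y : 0 < s -> 0 <= eta s x y.
Proof.
move=> s0; rewrite /eta mulr_ge0 ?pexpinv_p1_ge// mulr_ge0//.
by rewrite invr_ge0 exprn_ge0// ltW.
Qed.

Lemma rk1_ge0 s x y : 0 <= rk 1 s x y.
Proof. exact: expinv_ge0. Qed.

Lemma integrable_cube_cst c r (k : R) : mu.-integrable (cube c r) (EFin \o cst k).
Proof. by apply: Lloc1_integrable; apply: Lloc1_continuous; exact: cst_continuous. Qed.

Lemma integrable_cube_indic c r : mu.-integrable setT (EFin \o (\1_(cube c r) : _ -> R)).
Proof.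
have L1 : Lloc 1 (cst 1 : 'rV[R]_n -> R) by apply: Lloc1_continuous; exact: cst_continuous.
have := @integrable_cube_supp R n (cst 1) (\1_(cube c r)) c r 1 L1.
have mi : measurable_fun setT (\1_(cube c r) : 'rV[R]_n -> R).
  by apply: measurable_indic; exact: measurable_cube.
move=> /(_ mi) H.
apply: (eq_integrable measurableT (EFin \o (fun y => cst 1 y * \1_(cube c r) y))).
  by move=> y _; rewrite /= mul1r.
apply: H => y; first by rewrite indicE; case: (_ \in _); rewrite ?normr1 ?normr0.
by rewrite indicE; case: (boolP (y \in _)) => [|_]; [rewrite inE|rewrite eqxx].
Qed.

(** One use of n <= 3: on the cube of half-width s/2 the squared distance to the centre is at most n
    s^2/4 <= 3 s^2/4, so the profile is evaluated at 1/4 or more, where exp(-1/t) is at least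
    exp(-4). *)
Lemma sqd_half_cube s x y : (n <= 3)%N -> 0 < s -> cube x (s / 2) y ->
  1 / 4 <= 1 - sqd x y / s ^+ 2.
Proof.
move=> n3 s0 yc.
have : sqd x y <= 3 * (s ^+ 2 / 4).
  apply: (@le_trans _ _ (\sum_(i < n) (s ^+ 2 / 4))).
    apply: ler_sum => i _; have := yc i; rewrite ler_norml => /andP[].
    move: (y ord0 i - x ord0 i) => z ? ?; nra.
  rewrite sumr_const card_ord -[leLHS]mulr_natl; apply: ler_wpM2r; last by rewrite ler_nat.
  by rewrite divr_ge0// sqr_ge0.
have s2 : 0 < s ^+ 2 by rewrite exprn_gt0.
move=> H; have : sqd x y / s ^+ 2 <= 3 / 4.
  rewrite ler_pdivrMr//; move: H; set A := sqd x y; set B := s ^+ 2; lra.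
by move: (sqd x y / _) => q; lra.
Qed.

(** The cube of half-width s/2 has volume exactly s^n. *)
Lemma integral_ge_half_cube s x (k : 'rV[R]_n -> R) c : 0 < s -> 0 <= c -> continuous k ->
  (forall y, 0 <= k y) -> (forall y, k y != 0 -> cube x s y) ->
  (forall y, cube x (s / 2) y -> c <= k y) -> c * s ^+ n <= \int[mu]_y k y.
Proof.
move=> s0 c0 ck k0 ks kc.
have mc := measurable_cube x (s / 2).
have ik : mu.-integrable setT (EFin \o k).
  have L1 : Lloc 1 (cst 1 : 'rV[R]_n -> R) by apply: Lloc1_continuous; exact: cst_continuous.
  have := integrable_kernel L1 ck ks.
  by apply: eq_integrable => // y _; rewrite /= mul1r.
have mcE : mu (cube x (s / 2)) = (s ^+ n)%:E.
  by rewrite lebesgue_cube ?divr_ge0 ?(ltW s0)// mulrCA divff// mulr1.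
have -> : c * s ^+ n = \int[mu]_y (c * \1_(cube x (s / 2)) y).
  rewrite RintegralZl//; last exact: integrable_cube_indic.
  by congr (_ * _); rewrite /Rintegral (integral_indic mu measurableT mc) setIT; exact: (esym (congr1 fine mcE)).
apply: le_Rintegral => //.
  have : mu.-integrable setT (fun y => c%:E * (\1_(cube x (s / 2)) y)%:E)%E.
    by apply: integrableZl => //; exact: integrable_cube_indic.
  by apply: eq_integrable.
move=> y _; rewrite indicE; case: (boolP (y \in _)) => yc; last by rewrite mulr0.
by rewrite mulr1; apply: kc; rewrite inE in yc.
Qed.

Lemma integral_eta_ge s x : (n <= 3)%N -> 0 < s -> 2 * expR (- 4) <= \int[mu]_y eta s x y.
Proof.
move=> n3 s0; have sn : 0 < s ^+ n by rewrite exprn_gt0.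
rewrite -[leLHS](@divfK _ (s ^+ n)) ?gt_eqF//; apply: integral_ge_half_cube => //.
- by rewrite divr_ge0 ?mulr_ge0 ?expR_ge0// ltW.
- exact: continuous_eta.
- by move=> y; exact: eta_ge0.
- by move=> y; exact: eta_supp.
- move=> y yc; rewrite /eta mulrAC; apply: ler_wpM2l; first by rewrite mulr_ge0// invr_ge0 ltW.
  by apply: pexpinv_p1_ge_quarter; [exact: sqd_half_cube|exact: rk_arg_le1].
Qed.

Lemma integral_rk1_ge s x : (n <= 3)%N -> 0 < s -> expR (- 4) * s ^+ n <= \int[mu]_y rk 1 s x y.
Proof.
move=> n3 s0; apply: integral_ge_half_cube => //.
- exact: continuous_rk.
- by move=> y; exact: rk1_ge0.
- by move=> y; exact: rk_supp.
- by move=> y yc; apply: expinv_ge_quarter; exact: sqd_half_cube.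
Qed.

Lemma Rintegral_cube_bound u (k : 'rV[R]_n -> R) x s N b : 0 <= s ->
  0 <= b -> Lloc 1 u -> continuous k -> (forall y, `|k y| <= b) ->
  (forall y, k y != 0 -> cube x s y) -> (forall y, cube x s y -> `|u y| <= N) ->
  `|\int[mu]_y (u y * k y)| <= b * (N * (2 * s) ^+ n).
Proof.
move=> s0 b0 lu ck kb ks uN.
have mc := measurable_cube x s; have iu := Lloc1_integrable x s lu.
have ks' y : ~ cube x s y -> k y = 0 by move=> yc; apply/eqP; apply: contrapT => /negP/ks.
apply: (le_trans (Rintegral_supp_bound mc iu (continuous_measurable_rV ck) kb ks')).
rewrite ler_wpM2l//.
have -> : N * (2 * s) ^+ n = \int[mu]_(y in cube x s) N.
  by rewrite Rintegral_cst//; congr (_ * _); exact: (esym (congr1 fine (lebesgue_cube x s0))).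
apply: le_Rintegral => //; first exact: integrable_norm.
exact: integrable_cube_cst.
Qed.

Lemma avg_bound : exists2 C : R, 0 <= C & forall u x s N, continuous u -> 0 < s ->
  (forall y, cube x s y -> `|u y| <= N) -> `|avg u s x| <= C * N.
Proof.
have [C C0 HC] := @rk_bounded R n (@p1 R).
exists (2 * C * 2 ^+ n) => [|u x s N cu s0 uN].
  by rewrite !mulr_ge0// exprn_ge0.
have sn : 0 < s ^+ n by rewrite exprn_gt0.
have sVn : 0 <= s ^- n by rewrite invr_ge0 ltW.
have -> : 2 * C * 2 ^+ n * N = 2 * s ^- n * C * (N * (2 * s) ^+ n).
  by rewrite exprMn; field; rewrite gt_eqF.
apply: (Rintegral_cube_bound (x := x) (ltW s0)).
- by rewrite !mulr_ge0.
- exact: Lloc1_continuous.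
- exact: continuous_eta.
- move=> y; rewrite /eta normrM ger0_norm ?mulr_ge0//.
  by apply: ler_wpM2l; rewrite ?mulr_ge0.
- by move=> y; exact: eta_supp.
- exact: uN.
Qed.

Lemma cube_nbhs w x : continuous w -> w x = 0 -> forall e : R, 0 < e ->
  exists2 d, 0 < d & forall y, (forall i, `|y ord0 i - x ord0 i| <= d) -> `|w y| <= e.
Proof.
move=> cw wx e e0.
have : \forall y \near x, `|w y| <= e.
  have H : w y @[y --> x] --> (0 : R) by rewrite -[X in _ --> X]wx; exact: cw.
  by move/cvgr0Pnorm_le : H; apply.
move=> /nbhs_ballP[d /= d0 H]; exists (d / 2); first exact: divr_gt0.
move=> y yd; apply: H; split => // i j; rewrite (ord1 i) /ball/= distrC (le_lt_trans (yd _))//.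
by rewrite ltr_pdivrMr// ltr_pMr// ltr1n.
Qed.

(** Values are recovered from averages as s tends to 0. With a kernel whose mass is not known, the
    usable form is for functions vanishing at the centre, which is why constants are subtracted
    below. *)
Lemma avg_vanish w x : continuous w -> w x = 0 -> forall e : R, 0 < e ->
  exists2 d, 0 < d & forall s, 0 < s -> s < d -> `|avg w s x| <= e.
Proof.
have [C C0 HC] := avg_bound.
move=> cw wx e e0.
have e1 : 0 < e / (C + 1) by rewrite divr_gt0// ltr_wpDl.
have [d d0 H] := cube_nbhs cw wx e1.
exists d => // s s0 sd.
apply: (le_trans (HC w x s (e / (C + 1)) cw s0 _)).
  move=> y yc; apply: H => i; apply: le_trans (yc i) _; exact: ltW.
by rewrite mulrCA ler_piMr ?(ltW e0)// ler_pdivrMr ?mul1r ?ltr_wpDl// lerDl.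
Qed.

Lemma avgB_cst u c s x : continuous u -> 0 < s ->
  avg (fun y => u y - c) s x = avg u s x - c * \int[mu]_y eta s x y.
Proof.
move=> cu s0.
have iu : mu.-integrable setT (EFin \o (fun y => u y * eta s x y)).
  apply: (integrable_kernel (Lloc1_continuous cu) (@continuous_eta _ _ s x) (s := s)).
  by move=> y; exact: eta_supp.
have ie : mu.-integrable setT (EFin \o eta s x).
  have L1 : Lloc 1 (cst 1 : 'rV[R]_n -> R) by apply: Lloc1_continuous; exact: cst_continuous.
  have := integrable_kernel L1 (@continuous_eta _ _ s x) (fun y => @eta_supp _ _ s x y s0).
  by apply: eq_integrable => // y _; rewrite /= mul1r.
rewrite -RintegralZl// -RintegralB//; last first.
  have : mu.-integrable setT (fun y => c%:E * (eta s x y)%:E)%E by exact: integrableZl.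
  by apply: eq_integrable.
by apply: eq_Rintegral => y _; rewrite mulrBl.
Qed.

End any_dim.

Section pos_dim.
Context {n : nat}.
Local Notation mu := (@lebesgue_rV R n.+1).

(** Each pure second derivative of the bump integrates to 0 along its own direction. This allows
    subtracting constants from [u] in the equation. *)
Lemma integral_lapk0S s (x : 'rV[R]_n.+1) : 0 < s -> \int[mu]_y lapk s x y = 0.
Proof.
move=> s0.
pose D i (y : 'rV[R]_n.+1) := pderivs [:: i; i] (rk 1 s x) y.
have sm : smooth (rk 1 s x) by have [] := test_function_rk 1 x s0.
have cD i : continuous (D i) by exact: continuous_pderivs2_rk.
have supp1 i y : 'D_(delta_mx ord0 i) (rk 1 s x) y != 0 -> cube x s y.
  have [_ ->] := is_derive_rk 1 s x y i.
  by rewrite mulf_eq0 negb_or => /andP[/(rk_supp s0)].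
have suppD i y : D i y != 0 -> cube x s y by exact: pderivs2_rk_supp.
have iD i : mu.-integrable setT (EFin \o D i).
  have L1 : Lloc 1 (cst 1 : 'rV[R]_n.+1 -> R) by apply: Lloc1_continuous; exact: cst_continuous.
  have := integrable_kernel L1 (cD i) (suppD i).
  by apply: eq_integrable => // y _; rewrite /= mul1r.
transitivity (\int[mu]_y \sum_(i < n.+1) D i y).
  by apply: eq_Rintegral => y _; rewrite -sum_pderivs2_rk.
rewrite Rintegral_sum//; apply: big1 => i _.
apply: (@integral_derive0 _ _ i ('D_(delta_mx ord0 i) (rk 1 s x)) (D i) x s _ (cD i)).
- move=> y; split=> //; have [_ H] := sm [:: i]; exact: H.
- exact: supp1.
- exact: suppD.
Qed.

End pos_dim.

Lemma integral_lapk0 n s (x : 'rV[R]_n) : 0 < s -> \int[@lebesgue_rV R n]_y lapk s x y = 0.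
Proof.
(* In dimension 0 there is no direction to integrate along, but the kernel itself is 0: its distance
   is an empty sum and its factor n is 0. *)
case: n x => [|n] x s0; last exact: integral_lapk0S.
apply: (etrans (y := \int[@lebesgue_rV R 0]_y (0 : R))); last by rewrite /Rintegral integral0.
by apply: eq_Rintegral => y _; rewrite /lapk /sqd big_ord0 !mulr0 !mul0r subrr.
Qed.
End radial_integrals.


(** * Interior estimates *)

Section rough_sources.
Context {R : realType} {n : nat}.
Local Notation mu := (@lebesgue_rV R n).
Implicit Types (u F : 'rV[R]_n -> R) (s : R) (x y : 'rV[R]_n).

(** Cauchy-Schwarz on the cube, in the form z <= l z^2/2 + 1/(2l) integrated with l = sqrt(V)/P,
    which makes both terms equal to P sqrt(V)/2, where V is the volume. *)
Lemma l2_cube F (P : R) c s : 0 < s -> 0 < P -> measurable_fun setT F ->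
  (\int[mu]_y (F y ^+ 2)%:E <= (P ^+ 2)%:E)%E ->
  mu.-integrable (cube c s) (EFin \o F) /\
  \int[mu]_(y in cube c s) `|F y| <= P * Num.sqrt ((2 * s) ^+ n).
Proof.
move=> s0 P0 mF FP; have mc := measurable_cube c s.
have mF2 : measurable_fun setT (fun y => F y ^+ 2) by exact: measurable_funX.
have iq : mu.-integrable setT (EFin \o (fun y => F y ^+ 2)).
  apply/integrableP; split; first exact/measurable_EFinP.
  apply: (@le_lt_trans _ _ (P ^+ 2)%:E); last exact: ltry.
  apply: le_trans FP; rewrite le_eqVlt; apply/orP; left; apply/eqP.
  by apply: eq_integral => y _; rewrite /= ger0_norm// sqr_ge0.
have iqc : mu.-integrable (cube c s) (EFin \o (fun y => F y ^+ 2)).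
  exact: integrableS iq.
have icst (k : R) : mu.-integrable (cube c s) (EFin \o cst k) by exact: integrable_cube_cst.
pose V := (2 * s) ^+ n; have V0 : 0 < V by rewrite exprn_gt0// mulr_gt0.
have VE : \int[mu]_(y in cube c s) (1 : R) = V.
  rewrite Rintegral_cst// mul1r.
  exact: (congr1 fine (lebesgue_cube c (ltW s0))).
have sV0 : 0 < Num.sqrt V by rewrite sqrtr_gt0.
have iF : mu.-integrable (cube c s) (EFin \o F).
  have i1 : mu.-integrable (cube c s) (EFin \o (fun y => 1 + F y ^+ 2)).
    have := integrableD mc (icst 1) iqc.
    by apply: eq_integrable => // y _; rewrite /= EFinD.
  apply: le_integrable i1 => //; first by apply/measurable_EFinP; exact: measurable_funTS.
  move=> y _; rewrite /= lee_fin [leRHS]ger0_norm ?addr_ge0 ?sqr_ge0//.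
  by rewrite ler_norml; move: (F y) => z; apply/andP; split; nra.
split => //.
pose l := Num.sqrt V / P; have l0 : 0 < l by rewrite divr_gt0.
have iqP : \int[mu]_(y in cube c s) (F y ^+ 2) <= P ^+ 2.
  rewrite -lee_fin; rewrite /Rintegral fineK ?integrable_fin_num//.
  apply: le_trans FP; apply: ge0_subset_integral => //; first exact/measurable_EFinP.
  by move=> y _; rewrite lee_fin sqr_ge0.
have iqb : mu.-integrable (cube c s) (EFin \o (fun y => l / 2 * F y ^+ 2)).
  have : mu.-integrable (cube c s) (fun y => (l / 2)%:E * (F y ^+ 2)%:E)%E by exact: integrableZl.
  by apply: eq_integrable.
apply: (@le_trans _ _ (\int[mu]_(y in cube c s) (l / 2 * F y ^+ 2 + (2 * l)^-1))).
  apply: le_Rintegral => //; first exact: integrable_norm.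
    have := integrableD mc iqb (icst (2 * l)^-1).
    by apply: eq_integrable => // y _; rewrite /= EFinD.
  move=> y _; have := sqr_ge0 (l * `|F y| - 1).
  have -> : F y ^+ 2 = `|F y| ^+ 2 by rewrite real_normK ?num_real.
  move: `|F y| => z Hz; rewrite -subr_ge0.
  have -> : l / 2 * z ^+ 2 + (2 * l)^-1 - z = (l * z - 1) ^+ 2 / (2 * l) by field; rewrite gt_eqF.
  by rewrite divr_ge0// mulr_ge0// ltW.
rewrite RintegralD//; last exact: icst.
rewrite RintegralZl//.
have -> : \int[mu]_(y in cube c s) (2 * l)^-1 = (2 * l)^-1 * V.
  rewrite Rintegral_cst//; congr (_ * _); exact: (congr1 fine (lebesgue_cube c (ltW s0))).
have -> : P * Num.sqrt V = l / 2 * P ^+ 2 + (2 * l)^-1 * V.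
  have VV : V = Num.sqrt V ^+ 2 by rewrite sqr_sqrtr// ltW.
  rewrite [X in _ + _ * X]VV /l; move: (Num.sqrt V) sV0 => q q0.
  by field; rewrite !gt_eqF.
by rewrite lerD2r ler_wpM2l// divr_ge0// ltW.
Qed.

(* [N] bounds the first source pointwise, [P] the second one in L^2. *)
Definition source_bound F1 F2 (N P : R) := [/\ measurable_fun setT F1, measurable_fun setT F2,
  forall y, `|F1 y| <= N & (\int[mu]_y (F2 y ^+ 2)%:E <= (P ^+ 2)%:E)%E].

Lemma source_integrable F1 F2 N P c s : 0 < s -> 0 < P -> source_bound F1 F2 N P ->
  mu.-integrable (cube c s) (EFin \o (fun y => F1 y + F2 y)).
Proof.
move=> s0 P0 [mF1 mF2 F1N F2P]; have mc := measurable_cube c s.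
have [i2 _] := l2_cube c s0 P0 mF2 F2P.
have i1 : mu.-integrable (cube c s) (EFin \o F1).
  apply: le_integrable (integrable_cube_cst c s N) => //.
    by apply/measurable_EFinP; exact: measurable_funTS.
  by move=> y _; rewrite /= lee_fin (le_trans (F1N y))// ler_norm.
have := integrableD mc i1 i2; by apply: eq_integrable => // y _; rewrite /= EFinD.
Qed.

Lemma source_kernel_bound F1 F2 N P (k : 'rV[R]_n -> R) b c s : 0 < s -> 0 < P -> 0 <= b ->
  source_bound F1 F2 N P -> continuous k -> (forall y, `|k y| <= b) ->
  (forall y, k y != 0 -> cube c s y) ->
  `|\int[mu]_y ((F1 y + F2 y) * k y)| <= b * (N * (2 * s) ^+ n + P * Num.sqrt ((2 * s) ^+ n)).
Proof.
move=> s0 P0 b0 FB ck kb ks; have mc := measurable_cube c s.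
have ks' y : ~ cube c s y -> k y = 0 by move=> yc; apply/eqP; apply: contrapT => /negP/ks.
have iF := source_integrable c s0 P0 FB.
apply: (le_trans (Rintegral_supp_bound mc iF (continuous_measurable_rV ck) kb ks')).
case: FB => mF1 mF2 F1N F2P.
have [i2 F2b] := l2_cube c s0 P0 mF2 F2P.
rewrite ler_wpM2l//.
apply: (@le_trans _ _ (\int[mu]_(y in cube c s) (N + `|F2 y|))).
  apply: le_Rintegral => //; first exact: integrable_norm.
    have := integrableD mc (integrable_cube_cst c s N) (integrable_norm i2).
    by apply: eq_integrable => // y _; rewrite /= EFinD.
  by move=> y _; rewrite (le_trans (ler_normD _ _))// lerD2r.
rewrite RintegralD//; [|exact: integrable_cube_cst|exact: integrable_norm].
apply: lerD F2b; rewrite Rintegral_cst// le_eqVlt; apply/orP; left; apply/eqP.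
congr (_ * _); exact: (congr1 fine (lebesgue_cube c (ltW s0))).
Qed.

(** The bounded source contributes s^(1-n) s^n = s, the L^2 source s^(1-n) s^(n/2), which is at most
    s^(-1/2) because n <= 3 and s <= 1. The support has radius 2s in order to admit differences of
    two bumps with nearby centres. *)
Lemma scaled_kernel_bound F1 F2 N P (k : 'rV[R]_n -> R) b c s : (n <= 3)%N ->
  0 < s -> s <= 1 -> 0 <= N -> 0 < P -> 0 <= b ->
  source_bound F1 F2 N P -> continuous k -> (forall y, `|k y| <= b) ->
  (forall y, k y != 0 -> cube c (2 * s) y) ->
  `|s * s ^- n * \int[mu]_y ((F1 y + F2 y) * k y)| <= 4 ^+ n * b * (N * s + P / Num.sqrt s).
Proof.
move=> n3 s0 s1 N0 P0 b0 FB ck kb ks.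
have s20 : 0 < 2 * s by rewrite mulr_gt0.
have sn0 : 0 < s ^+ n by rewrite exprn_gt0.
have c0 : 0 <= s * s ^- n by rewrite mulr_ge0 ?invr_ge0 ?(ltW sn0) ?(ltW s0).
rewrite normrM ger0_norm//.
apply: (le_trans (ler_wpM2l c0 (source_kernel_bound s20 P0 b0 FB ck kb ks))).
have -> : (2 * (2 * s)) ^+ n = 4 ^+ n * s ^+ n :> R by rewrite -exprMn; congr (_ ^+ _); ring.
rewrite mulrCA [4 ^+ n * b]mulrC -[leRHS]mulrA; apply: (ler_wpM2l b0).
rewrite !mulrDr; apply: lerD.
  rewrite le_eqVlt; apply/orP; left; apply/eqP; field; by rewrite gt_eqF.
have q0 : 0 < Num.sqrt s by rewrite sqrtr_gt0.
have q1 : Num.sqrt s <= 1 by rewrite -sqrtr1 ler_wsqrtr.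
have sE : s = Num.sqrt s ^+ 2 by rewrite sqr_sqrtr// ltW.
have f1 : 1 <= 4 ^+ n :> R by rewrite exprn_ege1// (ler_nat _ 1 4).
have -> : Num.sqrt (4 ^+ n * s ^+ n) = Num.sqrt (4 ^+ n) * Num.sqrt s ^+ n.
  rewrite sqrtrM ?exprn_ge0//; congr (_ * _).
  by rewrite [in LHS]sE -exprM mulnC exprM sqrtr_sqr ger0_norm// exprn_ge0// ltW.
have g1 : Num.sqrt (4 ^+ n) <= 4 ^+ n :> R.
  rewrite -[leRHS]ger0_norm ?exprn_ge0// -sqrtr_sqr ler_wsqrtr// expr2 ler_peMl// (le_trans _ f1).
have g0 : 0 <= Num.sqrt (4 ^+ n) :> R by exact: sqrtr_ge0.
set q := Num.sqrt s in q0 q1 sE *.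
have qn0 : 0 < q ^+ n by rewrite exprn_gt0.
(* With q = sqrt(s) the power is q^(2-n) = (q^3/q^n)/q, and q^3 <= q^n since q <= 1 and n <= 3. *)
have -> : s * s ^- n * (P * (Num.sqrt (4 ^+ n) * q ^+ n)) =
   Num.sqrt (4 ^+ n) * (P * (q ^+ 3 / q ^+ n / q)).
  rewrite sE -exprM mulnC exprM; move: (Num.sqrt (4 ^+ n)) => z.
  by field; rewrite !gt_eqF//.
apply: ler_pM => //.
  by rewrite !mulr_ge0// ?invr_ge0 ?exprn_ge0// ltW.
apply: ler_wpM2l; first exact: ltW.
rewrite ler_piMl ?invr_ge0 ?(ltW q0)// ler_pdivrMr// mul1r.
by apply: ler_wiXn2l => //; rewrite ltW.
Qed.

End rough_sources.


(** * Integrating bounds on derivatives *)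

Section derivative_comparison.
Context {R : realType}.

(** By the mean value theorem applied to g - f. With an explicit primitive [g] of the bound, the
    derivative of an average in [s] is never integrated itself. *)
Lemma derive_compare (f df g dg : R -> R) (a b : R) : a <= b ->
  (forall t : R, a <= t <= b -> is_derive t 1 f (df t)) ->
  (forall t, a <= t <= b -> is_derive t 1 g (dg t)) ->
  (forall t, a <= t <= b -> df t <= dg t) -> f b - f a <= g b - g a.
Proof.
rewrite le_eqVlt => /predU1P[-> *|ab Df Dg fg]; first by rewrite !subrr.
have Dh t : a <= t <= b -> is_derive t 1 (g - f) (dg t - df t).
  by move=> tab; exact: (is_deriveB (Dg t tab) (Df t tab)).
have [||c] := @MVT R (g - f) (fun t => dg t - df t) a b ab.
- by move=> t; rewrite in_itv/= => /andP[? ?]; apply: Dh; rewrite !ltW.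
- apply: derivable_within_continuous => t; rewrite in_itv/= => tab.
  by have [] := Dh t tab.
rewrite in_itv/= => /andP[ac cb] H.
have : 0 <= (g - f) b - (g - f) a.
  by rewrite H mulr_ge0 ?subr_ge0 ?(ltW ab)// fg// !ltW.
rewrite /GRing.sub_fun/= -[(g - f) b]/(g b - f b) -[(g - f) a]/(g a - f a).
by move: (g b) (g a) (f b) (f a) => *; lra.
Qed.

Lemma derive_compare_norm (f df g dg : R -> R) (a b : R) : a <= b ->
  (forall t : R, a <= t <= b -> is_derive t 1 f (df t)) ->
  (forall t, a <= t <= b -> is_derive t 1 g (dg t)) ->
  (forall t, a <= t <= b -> `|df t| <= dg t) -> `|f b - f a| <= g b - g a.
Proof.
move=> ab Df Dg fg; rewrite ler_norml; apply/andP; split.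
  have := @derive_compare (- f) (fun t => - df t) g dg a b ab
    (fun t tab => is_deriveN (Df t tab)) Dg.
  rewrite -[(- f) b]/(- f b) -[(- f) a]/(- f a) => H.
  suff : - f b - - f a <= g b - g a by move: (g b) (g a) (f b) (f a) => *; lra.
  by apply: H => t tab; have := fg t tab; rewrite ler_norml => /andP[? _]; rewrite lerNl.
apply: (derive_compare ab Df Dg) => t tab.
by rewrite (le_trans (ler_norm _))// fg.
Qed.

Lemma is_derive_sqrt2 (t K : R) : 0 < t ->
  is_derive t 1 (fun t => 2 * K * Num.sqrt t) (K / Num.sqrt t).
Proof.
move=> t0; have s0 : Num.sqrt t != 0 by rewrite gt_eqF// sqrtr_gt0.
have := is_deriveZ (2 * K) (is_derive1_sqrt t0).
by move=> D; apply: (is_derive_eq D); rewrite /GRing.scale/=; field.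
Qed.

Lemma is_derive_sqrtV2 (t K : R) : 0 < t ->
  is_derive t 1 (fun t => - (2 * K / Num.sqrt t)) (K / (t * Num.sqrt t)).
Proof.
move=> t0; have s0 : Num.sqrt t != 0 by rewrite gt_eqF// sqrtr_gt0.
have := is_deriveN (is_deriveZ (2 * K) (is_deriveV (f := Num.sqrt) s0 (is_derive1_sqrt t0))).
move=> D; apply: (is_derive_eq D); rewrite /GRing.scale/=.
have tE : t = Num.sqrt t ^+ 2 by rewrite sqr_sqrtr// ltW.
rewrite [X in _ = _ / (X * _)]tE; field.
by rewrite s0.
Qed.

End derivative_comparison.

(** * The Hoelder bound at a given scale *)

Section holder.
Context {R : realType} {n : nat}.
Local Notation mu := (@lebesgue_rV R n).
Implicit Types (u F : 'rV[R]_n -> R) (s : R) (x y : 'rV[R]_n).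

(* The equation [Laplacian u = F], tested against the bumps [rk 1 s x] only. *)
Definition poisson u F := forall s x, 0 < s ->
  \int[mu]_y (u y * lapk s x y) = \int[mu]_y (F y * rk 1 s x y).

Lemma poissonB_cst u F c : continuous u -> poisson u F -> poisson (fun y => u y - c) F.
Proof.
move=> cu uF s x s0; rewrite -uF//.
have supp y : lapk s x y != 0 -> cube x s y by move=> /(lapk_supp s0); exact: sqd_cube.
have iu := integrable_kernel (Lloc1_continuous cu) (@continuous_lapk _ _ s x) supp.
have L1 : Lloc 1 (cst 1 : 'rV[R]_n -> R) by apply: Lloc1_continuous; exact: cst_continuous.
have il : mu.-integrable setT (EFin \o lapk s x).
  have := integrable_kernel L1 (@continuous_lapk _ _ s x) supp.
  by apply: eq_integrable => // y _; rewrite /= mul1r.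
transitivity (\int[mu]_y (u y * lapk s x y) - c * \int[mu]_y lapk s x y).
  rewrite -RintegralZl// -RintegralB//; last first.
    have : mu.-integrable setT (fun y => c%:E * (lapk s x y)%:E)%E by exact: integrableZl.
    by apply: eq_integrable.
  by apply: eq_Rintegral => y _; rewrite mulrBl.
by rewrite integral_lapk0// mulr0 subr0.
Qed.

Lemma source_rk_integrable F1 F2 N P s x : 0 < s -> 0 < P -> source_bound F1 F2 N P ->
  mu.-integrable setT (EFin \o (fun y => (F1 y + F2 y) * rk 1 s x y)).
Proof.
move=> s0 P0 FB; have [C C0 HC] := @rk_bounded R n 1.
apply: (integrable_supp (measurable_cube x s) (source_integrable x s0 P0 FB) _ (HC s x)).
  by apply: continuous_measurable_rV; exact: continuous_rk.
by move=> y yc; apply/eqP; apply: contrapT => /negP/(rk_supp s0).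
Qed.

Lemma cube_sub2 s x : 0 < s -> cube x s `<=` cube x (2 * s).
Proof. by move=> s0 y yc i; rewrite (le_trans (yc i))//; lra. Qed.

Lemma cube_near s d x y z : d <= s -> (forall i, `|x ord0 i - y ord0 i| <= d) ->
  cube y s z -> cube x (2 * s) z.
Proof.
move=> ds xy zc i; have := zc i; have := xy i; rewrite !ler_norml => /andP[? ?] /andP[? ?].
by apply/andP; split; lra.
Qed.

Lemma rkB_supp p s d x y z : 0 < s -> d <= s -> (forall i, `|x ord0 i - y ord0 i| <= d) ->
  rk p s x z - rk p s y z != 0 -> cube x (2 * s) z.
Proof.
move=> s0 ds xy H.
have [x0|/(rk_supp s0)] := eqVneq (rk p s x z) 0; last exact: cube_sub2.
move: H; rewrite x0 sub0r oppr_eq0 => /(rk_supp s0); exact: (cube_near ds xy).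
Qed.

(** The path from a pointwise value to scale l: [a], [b] are averages at a tiny scale, [c] is the
    value times the mass of the kernel, [p] and [q] are the differences of averages at scales d and
    l. *)
Let chain_le (a b c p q Y Z e : R) : `|a| <= e / 2 -> `|b - c| <= e / 2 ->
  `|p - (a - b)| <= Y -> `|q - p| <= Y -> `|q| <= Z -> `|c| <= Z + 2 * Y + e.
Proof.
rewrite !ler_norml => /andP[? ?] /andP[? ?] /andP[? ?] /andP[? ?] /andP[? ?].
by apply/andP; split; lra.
Qed.

(** The scale [l] is quantified after [C], since the bound is used twice: with l = e/M for the
    supremum and with l = e for the second claim. *)
Definition holder_constant (C : R) := forall u F1 F2 (N P M l d : R) x y,
  0 <= N -> 0 < P -> 0 < d -> d <= l -> l <= 1 ->
  continuous u -> source_bound F1 F2 N P -> poisson u (fun y => F1 y + F2 y) ->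
  (forall y, `|u y| <= M) -> (forall i, `|x ord0 i - y ord0 i| <= d) ->
  `|u x - u y| <= C * (M * Num.sqrt (d / l) + (N * (l * Num.sqrt l) + P) * Num.sqrt d).

(** D(t) is the difference of the averages at [x] and [y]. At scale l it is small because [eta] is
    Lipschitz in its centre. Between d and l the two bumps nearly cancel, so |D'| is of order d
    t^(-3/2); below d they are estimated separately, so |D'| is of order t^(-1/2). Both ranges
    contribute sqrt(d). As t tends to 0, D(t) approaches u(x) - u(y) times the mass of the
    kernel. *)
Lemma holder_scale : (n <= 3)%N -> exists2 C : R, 0 <= C & holder_constant C.
Proof.
move=> n3.
have [C1 C10 H1] := @rk_bounded R n 1.
have [C2 C20 H2] := @rk_lipschitz R n 1.
have [C3 C30 H3] := @rk_lipschitz R n (@p1 R).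
pose m0 : R := 2 * expR (- 4); have m00 : 0 < m0 by rewrite mulr_gt0// expR_gt0.
pose K0 : R := 4 ^+ n * (2 * C1 + C2); pose K1 : R := 4 ^+ n * C3.
have f0 : 0 <= 4 ^+ n :> R by rewrite exprn_ge0.
have K00 : 0 <= K0 by rewrite mulr_ge0// addr_ge0// mulr_ge0.
have K10 : 0 <= K1 by rewrite mulr_ge0.
exists ((4 * K0 + 4 * K1) / m0); first by apply: divr_ge0; [apply: addr_ge0; exact: mulr_ge0|exact: ltW].
move=> u F1 F2 N P M l d x y N0 P0 d0 dl l1 cu FB uF uM xy.
have l0 : 0 < l by exact: lt_le_trans dl.
have M0 : 0 <= M by exact: le_trans (uM x).
pose F z := F1 z + F2 z.
(* Normalised to vanish at [x], so that the averages there tend to 0 and the mass of the kernel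
   matters at [y] only. *)
pose w z := u z - u x.
have cw : continuous w by move=> z; apply: (@continuousB _ _ _ u (cst (u x)) z (cu z)); exact: cst_continuous.
have wF : poisson w F by exact: poissonB_cst.
have wx : w x = 0 by rewrite /w subrr.
have w2M z : `|w z| <= 2 * M.
  rewrite /w (le_trans (ler_normB _ _))//; have := uM z; have := uM x.
  by move: `|u x| `|u z| => *; lra.
pose D t := avg w t x - avg w t y.
pose dD t := t * t ^- n * \int[mu]_z (F z * (rk 1 t x z - rk 1 t y z)).
have DD (t : R) : 0 < t -> is_derive t 1 D (dD t).
  move=> t0; have Lw := Lloc1_continuous cw.
  have := is_deriveB (is_derive_avg x Lw t0) (is_derive_avg y Lw t0).
  move=> H; apply: (is_derive_eq H); rewrite /dD !wF// -mulrBr; congr (_ * _).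
  rewrite -RintegralB//; [|exact: source_rk_integrable FB|exact: source_rk_integrable FB].
  by apply: eq_Rintegral => z _; rewrite mulrBr.
pose K := K0 * (N * (l * Num.sqrt l) + P).
have sl0 : 0 < Num.sqrt l by rewrite sqrtr_gt0.
have NlP0 : 0 <= N * (l * Num.sqrt l) + P by rewrite addr_ge0 ?(ltW P0)// !mulr_ge0// ltW.
(* For t <= l one has t <= l sqrt(l)/sqrt(t), so both sources obey one bound of order 1/sqrt(t). *)
have base (t : R) : 0 < t -> t <= l ->
    N * t + P / Num.sqrt t <= (N * (l * Num.sqrt l) + P) / Num.sqrt t.
  move=> t0 tl; have st0 : 0 < Num.sqrt t by rewrite sqrtr_gt0.
  rewrite mulrDl lerD2r -mulrA ler_wpM2l// ler_pdivlMr//.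
  by apply: ler_pM; [exact: ltW|exact: sqrtr_ge0|exact: tl|exact: ler_wsqrtr].
have crk (t : R) (z : 'rV[R]_n) : continuous (rk 1 t z) by exact: continuous_rk.
have crkB (t : R) : continuous (fun z => rk 1 t x z - rk 1 t y z).
  by move=> z; apply: (@continuousB _ _ _ (rk 1 t x) (rk 1 t y)); exact: crk.
have far (t : R) : 0 < t -> t <= l -> `|dD t| <= K / Num.sqrt t.
  move=> t0 tl; have t1 := le_trans tl l1.
  have one z : `|t * t ^- n * \int[mu]_z' (F z' * rk 1 t z z')| <=
      4 ^+ n * C1 * (N * t + P / Num.sqrt t).
    apply: (scaled_kernel_bound (c := z) n3 t0 t1 N0 P0 C10 FB (crk t z) (H1 t z)).
    by move=> z' /(rk_supp t0); exact: cube_sub2.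
  have -> : dD t = t * t ^- n * (\int[mu]_z' (F z' * rk 1 t x z')) -
     t * t ^- n * (\int[mu]_z' (F z' * rk 1 t y z')).
    rewrite -mulrBr -RintegralB//; [|exact: source_rk_integrable FB|exact: source_rk_integrable FB].
    by congr (_ * _); apply: eq_Rintegral => z _; rewrite mulrBr.
  rewrite (le_trans (ler_normB _ _))//.
  apply: (le_trans (lerD (one x) (one y))).
  have -> : 4 ^+ n * C1 * (N * t + P / Num.sqrt t) + 4 ^+ n * C1 * (N * t + P / Num.sqrt t) =
    4 ^+ n * (2 * C1) * (N * t + P / Num.sqrt t) by ring.
  rewrite /K -[leRHS]mulrA.
  apply: ler_pM; [by rewrite !mulr_ge0|by rewrite addr_ge0 ?mulr_ge0 ?invr_ge0 ?sqrtr_ge0 ?(ltW P0) ?(ltW t0)| |exact: base].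
  by rewrite /K0 ler_wpM2l// lerDl.
have near (t : R) : d <= t -> t <= l -> `|dD t| <= K * d / (t * Num.sqrt t).
  move=> dt tl; have t0 := lt_le_trans d0 dt; have t1 := le_trans tl l1.
  have C2d : 0 <= C2 * (d / t) by rewrite !mulr_ge0// ?invr_ge0 ltW.
  apply: (le_trans (scaled_kernel_bound (c := x) n3 t0 t1 N0 P0 C2d FB (crkB t) _ _)).
  - by move=> z; apply: (H2 t d x y z t0 (ltW d0) dt xy).
  - by move=> z; exact: (rkB_supp t0 dt xy).
  have st0 : 0 < Num.sqrt t by rewrite sqrtr_gt0.
  have -> : K * d / (t * Num.sqrt t) = K0 * (d / t) * ((N * (l * Num.sqrt l) + P) / Num.sqrt t).
    by rewrite /K; field; rewrite !gt_eqF.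
  apply: ler_pM; [by rewrite mulr_ge0|by rewrite addr_ge0 ?mulr_ge0 ?invr_ge0 ?sqrtr_ge0 ?(ltW P0) ?(ltW t0)| |exact: base].
  rewrite [leLHS]mulrA; apply: ler_wpM2r; first by rewrite divr_ge0 ?(ltW d0) ?(ltW t0).
  by apply: ler_wpM2l => //; rewrite lerDr mulr_ge0.
have K0' : 0 <= K by rewrite mulr_ge0.
have sd0 : 0 < Num.sqrt d by rewrite sqrtr_gt0.
have step1 : `|D l - D d| <= 2 * K * Num.sqrt d.
  apply: (le_trans (@derive_compare_norm R D dD (fun t => - (2 * (K * d) / Num.sqrt t))
    (fun t => K * d / (t * Num.sqrt t)) d l dl _ _ _)).
  - by move=> t /andP[dt _]; apply: DD; exact: lt_le_trans dt.
  - by move=> t /andP[dt _]; apply: is_derive_sqrtV2; exact: lt_le_trans dt.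
  - by move=> t /andP[dt tl]; exact: near.
  have dE : d = Num.sqrt d ^+ 2 by rewrite sqr_sqrtr// ltW.
  have -> : 2 * (K * d) / Num.sqrt d = 2 * K * Num.sqrt d.
    by rewrite [X in K * X]dE; field; rewrite gt_eqF.
  rewrite opprK gerDr oppr_le0; apply: divr_ge0; last exact: ltW.
  by apply: mulr_ge0 => //; apply: mulr_ge0 => //; exact: ltW.
have step2 (t : R) : 0 < t -> t <= d -> `|D d - D t| <= 2 * K * Num.sqrt d.
  move=> t0 td.
  apply: (le_trans (@derive_compare_norm R D dD (fun t => 2 * K * Num.sqrt t)
    (fun t => K / Num.sqrt t) t d td _ _ _)).
  - by move=> t' /andP[tt' _]; apply: DD; exact: lt_le_trans tt'.
  - by move=> t' /andP[tt' _]; apply: is_derive_sqrt2; exact: lt_le_trans tt'.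
  - by move=> t' /andP[tt' t'd]; apply: far; [exact: lt_le_trans tt'|exact: le_trans dl].
  by rewrite gerBl; apply: mulr_ge0; [exact: mulr_ge0|exact: sqrtr_ge0].
have step3 : `|D l| <= 4 * K1 * (M * (d / l)).
  have ln0 : 0 < l ^+ n by rewrite exprn_gt0.
  have cE (z : 'rV[R]_n) : continuous (eta l z) by exact: continuous_eta.
  have -> : D l = \int[mu]_z (w z * (eta l x z - eta l y z)).
    have iw z : mu.-integrable setT (EFin \o (fun z' => w z' * eta l z z')).
      apply: (integrable_kernel (Lloc1_continuous cw) (cE z) (s := l)) => z'; exact: eta_supp.
    rewrite /D /avg -RintegralB//.
    by apply: eq_Rintegral => z _; rewrite mulrBr.
  have -> : 4 * K1 * (M * (d / l)) =
     2 * l ^- n * (C3 * (d / l)) * (2 * M * (2 * (2 * l)) ^+ n).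
    have -> : (2 * (2 * l)) ^+ n = 4 ^+ n * l ^+ n :> R by rewrite -exprMn; congr (_ ^+ _); ring.
    by rewrite /K1; field; rewrite !gt_eqF.
  have l20 : 0 <= 2 * l by rewrite mulr_ge0// ltW.
  have a0 : 0 <= 2 * l ^- n by rewrite mulr_ge0// invr_ge0 ltW.
  have etaB z : eta l x z - eta l y z = 2 * l ^- n * (rk (@p1 R) l x z - rk (@p1 R) l y z).
    by rewrite /eta mulrBr.
  apply: (Rintegral_cube_bound (x := x) l20).
  - by rewrite !mulr_ge0// ?invr_ge0 ?(ltW ln0) ?(ltW d0) ?(ltW l0).
  - exact: Lloc1_continuous.
  - by move=> z; apply: (@continuousB _ _ _ (eta l x) (eta l y)); exact: cE.
  - move=> z; rewrite etaB normrM (ger0_norm a0) ler_wpM2l//.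
    exact: (H3 l d x y z l0 (ltW d0) dl xy).
  - move=> z; rewrite etaB mulf_eq0 negb_or => /andP[_]; exact: (rkB_supp l0 dl xy).
  - by move=> z _; exact: w2M.
pose T := 4 * K1 * (M * (d / l)) + 4 * K * Num.sqrt d.
have main : m0 * `|u x - u y| <= T.
  apply/ler_addgt0Pr => e e0.
  have e2 : 0 < e / 2 by rewrite divr_gt0.
  have [d1 d10 S1] := avg_vanish cw wx e2.
  pose wy z := w z - w y.
  have cwy : continuous wy by move=> z; apply: (@continuousB _ _ _ w (cst (w y)) z (cw z)); exact: cst_continuous.
  have wyy : wy y = 0 by rewrite /wy subrr.
  have [d2 d20 S2] := avg_vanish cwy wyy e2.
  pose t := Num.min d (Num.min d1 d2) / 2.
  have mn0 : 0 < Num.min d (Num.min d1 d2) by rewrite !lt_min d0 d10.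
  have t0 : 0 < t by rewrite divr_gt0.
  have tm : t < Num.min d (Num.min d1 d2) by rewrite /t ltr_pdivrMr// ltr_pMr// ltr1n.
  move: tm; rewrite !lt_min => /and3P[td td1 td2].
  have A1 := S1 t t0 td1.
  have A2 := S2 t t0 td2.
  have A3 := step2 t t0 (ltW td).
  have me := integral_eta_ge y n3 t0.
  rewrite avgB_cst// in A2.
  have uxy : `|u x - u y| = `|w y| by rewrite /w distrC.
  rewrite uxy.
  have : m0 * `|w y| <= `|w y * \int[mu]_z eta t y z|.
    rewrite normrM mulrC ler_wpM2l//; exact: le_trans (ler_norm _).
  move/le_trans; apply.
  have -> : T = 4 * K1 * (M * (d / l)) + 2 * (2 * K * Num.sqrt d) by rewrite /T; ring.
  exact: (chain_le A1 A2 A3 step1 step3).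
rewrite mulrAC ler_pdivlMr// mulrC (le_trans main)// /T.
have dl1 : d / l <= Num.sqrt (d / l).
  have dl0 : 0 <= d / l by rewrite divr_ge0// ltW.
  have q1 : Num.sqrt (d / l) <= 1 by rewrite -sqrtr1 ler_wsqrtr// ler_pdivrMr// mul1r.
  by rewrite -[leLHS](sqr_sqrtr dl0) expr2 ler_piMl// sqrtr_ge0.
have Mdl : M * (d / l) <= M * Num.sqrt (d / l) by rewrite ler_wpM2l.
have Md0 : 0 <= M * (d / l) by rewrite !mulr_ge0 ?invr_ge0 ?(ltW d0) ?(ltW l0).
rewrite /K; move: Mdl Md0; have : 0 <= (N * (l * Num.sqrt l) + P) * Num.sqrt d by rewrite mulr_ge0// ltW.
have -> : 4 * (K0 * (N * (l * Num.sqrt l) + P)) * Num.sqrt d =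
   4 * K0 * ((N * (l * Num.sqrt l) + P) * Num.sqrt d) by ring.
move: K00 K10 ((N * _ + P) * _) (M * (d / l)) (M * Num.sqrt _); clear.
move=> K00 K10 Y A B Y0 AB A0.
rewrite mulrDr lerD//.
  apply: (@le_trans _ _ (4 * K1 * B)); first by rewrite ler_wpM2l// mulr_ge0.
  rewrite ler_wpM2r ?(le_trans A0)// lerDr mulr_ge0//.
by rewrite ler_wpM2r// lerDl mulr_ge0.
Qed.

End holder.


(** * The bound on the supremum *)

Section sup_bound.
Context {R : realType} {n : nat}.
Local Notation mu := (@lebesgue_rV R n).
Implicit Types (u F : 'rV[R]_n -> R) (s : R) (x y : 'rV[R]_n).

Lemma well_source_bound u F1 F2 (e M P : R) : 0 < e -> continuous u -> (forall y, `|u y| <= M) ->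
  measurable_fun setT F2 -> (forall y, F1 y = e ^- 2 * (u y ^+ 3 - u y)) ->
  (\int[mu]_y (F2 y ^+ 2)%:E <= (P ^+ 2)%:E)%E ->
  source_bound F1 F2 (e ^- 2 * (M ^+ 3 + M)) P.
Proof.
move=> e0 cu uM mF2 F1E F2P; have e20 : 0 < e ^- 2 by rewrite invr_gt0 exprn_gt0.
have mcu : measurable_fun setT u by exact: continuous_measurable_rV.
split => //.
  rewrite (_ : F1 = fun y => e ^- 2 * (u y ^+ 3 - u y)); last exact/boolp.funext.
  by apply: measurable_funM => //; apply: measurable_funB => //; exact: measurable_funX.
move=> y; rewrite F1E normrM (gtr0_norm e20); apply: ler_wpM2l; first exact: ltW.
rewrite (le_trans (ler_normB _ _))// normrX; apply: lerD => //.
by rewrite lerXn2r// nnegrE (le_trans (normr_ge0 _) (uM y)).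
Qed.

Lemma poissonN u F : continuous u ->
  (forall s x, 0 < s -> mu.-integrable setT (EFin \o (fun y => F y * rk 1 s x y))) ->
  poisson u F -> poisson (fun y => - u y) (fun y => - F y).
Proof.
move=> cu iF uF s x s0.
have supp y : lapk s x y != 0 -> cube x s y by move=> /(lapk_supp s0); exact: sqd_cube.
have iu := integrable_kernel (Lloc1_continuous cu) (@continuous_lapk _ _ s x) supp.
transitivity (-1 * \int[mu]_y (u y * lapk s x y)).
  by rewrite -RintegralZl//; apply: eq_Rintegral => y _; rewrite mulN1r mulNr.
rewrite uF// -RintegralZl//; last exact: iF.
by apply: eq_Rintegral => y _; rewrite mulN1r mulNr.
Qed.

(** A is compared with a t^2/2 - 2b sqrt(t), whose derivative is the assumed lower bound. A starts
    from 0 and ends at a value at most 0, so this function cannot have grown. *)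
Lemma growth_bound (A dA : R -> R) (a b r : R) : 0 < r -> 0 <= a ->
  (forall t : R, 0 < t -> is_derive t 1 A (dA t)) ->
  (forall t, 0 < t -> t <= r -> a * t - b / Num.sqrt t <= dA t) ->
  A r <= 0 -> (forall e : R, 0 < e -> exists2 d, 0 < d & forall t : R, 0 < t -> t < d -> `|A t| <= e) ->
  0 <= b -> a * r ^+ 2 / 2 <= 2 * b * Num.sqrt r.
Proof.
move=> r0 a0 DA dAle Ar A0 b0; apply/ler_addgt0Pr => e e0.
have e2 : 0 < e / 2 by rewrite divr_gt0.
have [d d0 Hd] := A0 _ e2.
(* Since t <= 1 and t <= e/(a + 1), a t^2 <= a t <= e, so the comparison function is at most e/2 at
   [t]. *)
pose t := Num.min (Num.min d r) (Num.min 1 (e / (a + 1))) / 2.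
have a1 : 0 < a + 1 by rewrite ltr_wpDl.
have mn0 : 0 < Num.min (Num.min d r) (Num.min 1 (e / (a + 1))).
  by rewrite !lt_min d0 r0 ltr01 divr_gt0.
have t0 : 0 < t by rewrite divr_gt0.
have : t < Num.min (Num.min d r) (Num.min 1 (e / (a + 1))).
  by rewrite /t ltr_pdivrMr// ltr_pMr// ltr1n.
rewrite !lt_min => /andP[/andP[td tr] /andP[t1 te]].
have Dg (x : R) : 0 < x -> is_derive x 1 (fun t => a / 2 * t ^+ 2 - 2 * b * Num.sqrt t)
    (a * x - b / Num.sqrt x).
  move=> x0; have X2 : is_derive x 1 (fun t : R => a / 2 * t ^+ 2) (a * x).
    have := is_deriveZ (a / 2) (is_deriveX 2 (is_derive_id x (1 : R))).
    by move=> D; apply: (is_derive_eq D); rewrite expr1 /GRing.scale/=; field.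
  exact: (is_deriveB X2 (is_derive_sqrt2 b x0)).
have H : (a / 2 * r ^+ 2 - 2 * b * Num.sqrt r) - (a / 2 * t ^+ 2 - 2 * b * Num.sqrt t) <= A r - A t.
  apply: (@derive_compare R (fun t => a / 2 * t ^+ 2 - 2 * b * Num.sqrt t)
     (fun t => a * t - b / Num.sqrt t) A dA t r (ltW tr)).
  - by move=> x /andP[tx _]; apply: Dg; exact: lt_le_trans tx.
  - by move=> x /andP[tx _]; apply: DA; exact: lt_le_trans tx.
  - by move=> x /andP[tx xr]; apply: dAle => //; exact: lt_le_trans tx.
have At := Hd t t0 td.
have ate : a / 2 * t ^+ 2 <= e / 2.
  have : (a + 1) * t <= e by move: te; rewrite ltr_pdivlMr// mulrC => /ltW.
  have tt : t ^+ 2 <= t by rewrite expr2 ler_piMl// ltW.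
  have := ler_wpM2l a0 tt; have -> : a / 2 * t ^+ 2 = a * t ^+ 2 / 2 by ring.
  rewrite mulrDl mul1r; move: (a * t ^+ 2) (a * t) t0; clear => *; lra.
have bt : 0 <= 2 * b * Num.sqrt t by rewrite !mulr_ge0// sqrtr_ge0.
move: H At ate bt Ar; rewrite ler_norml => + /andP[+ _].
have -> : a * r ^+ 2 / 2 = a / 2 * r ^+ 2 by ring.
move: (a / 2 * _) (a / 2 * _) (2 * b * _) (2 * b * _) (A r) (A t); clear.
by move=> *; lra.
Qed.

(** The quantity compared with [growth_bound] is the average of w = u - M around the maximum point:
    it vanishes in the limit of scale 0 and is nowhere positive, while the large positive source
    near [x] pushes it up. *)
Lemma sup_bound_pos : (n <= 3)%N -> exists2 C : R, 0 <= C &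
  forall u F1 F2 (e L : R) x, 0 < e -> e <= 1 -> 0 < L -> continuous u ->
  poisson u (fun y => F1 y + F2 y) -> measurable_fun setT F2 ->
  (forall y, F1 y = e ^- 2 * (u y ^+ 3 - u y)) ->
  (\int[mu]_y (F2 y ^+ 2)%:E <= ((L / Num.sqrt e) ^+ 2)%:E)%E ->
  (forall y, `|u y| <= u x) -> 3 <= u x -> L <= u x -> u x <= C * L.
Proof.
move=> n3.
have [Ch Ch0 Hh] := @holder_scale R n n3.
have [C1 C10 H1] := @rk_bounded R n 1.
(* Here q = sqrt(k). At distance k l the Hoelder bound is at most C_h q times M + (M + 1/M) + L <=
   4M, and 4 C_h q <= 1/2 brings it below M/2. *)
pose q : R := (8 * (Ch + 1))^-1.
have Ch1 : 0 < Ch + 1 by rewrite ltr_wpDl.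
have q0 : 0 < q by rewrite invr_gt0 mulr_gt0.
have Chq : Ch * (4 * q) <= 1 / 2.
  rewrite /q; have -> : Ch * (4 * (8 * (Ch + 1))^-1) = Ch / (Ch + 1) / 2 by field; rewrite gt_eqF.
  by rewrite ler_wpM2r// ler_pdivrMr// mul1r lerDl.
have q1 : q <= 1.
  by rewrite /q invf_le1 ?mulr_gt0//; move: Ch0; clear; lra.
pose k := q ^+ 2; have k0 : 0 < k by rewrite exprn_gt0.
have k1 : k <= 1 by rewrite exprn_ile1// ltW.
have sk : Num.sqrt k = q by rewrite sqrtr_sqr gtr0_norm.
pose e4 : R := expR (- 4); have e40 : 0 < e4 by exact: expR_gt0.
pose C' : R := 4 ^+ n * C1.
have C'0 : 0 <= C' by rewrite mulr_ge0// exprn_ge0.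
exists (64 * C' / (e4 * k ^+ 2)).
  apply: divr_ge0; first exact: mulr_ge0.
  by apply: mulr_ge0; [exact: ltW|apply: exprn_ge0; exact: ltW].
move=> u F1 F2 e L x e0 e1 L0 cu uF mF2 F1E F2L uM M3 LM.
pose M := u x; rewrite -/M in uM M3 LM *.
have M0 : 0 < M by exact: lt_le_trans M3.
have M1 : 1 <= M by rewrite (le_trans _ M3)// ler1n.
have se0 : 0 < Num.sqrt e by rewrite sqrtr_gt0.
have sM0 : 0 < Num.sqrt M by rewrite sqrtr_gt0.
have sM1 : 1 <= Num.sqrt M by rewrite -[leLHS]sqrtr1 ler_wsqrtr.
(* At this scale N l^2 = M + 1/M and P sqrt(l) <= L, so no power of [e] remains. *)
pose l := e / M; have l0 : 0 < l by rewrite divr_gt0.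
have l1 : l <= 1 by rewrite ler_pdivrMr// mul1r (le_trans e1).
have sl : Num.sqrt l = Num.sqrt e / Num.sqrt M.
  by rewrite /l sqrtrM ?(ltW e0)// sqrtrV// ltW.
pose N := e ^- 2 * (M ^+ 3 + M).
have e20 : 0 < e ^- 2 by rewrite invr_gt0 exprn_gt0.
have N0 : 0 <= N by rewrite mulr_ge0 ?addr_ge0 ?exprn_ge0 ?(ltW M0) ?(ltW e20).
pose P := L / Num.sqrt e; have P0 : 0 < P by rewrite divr_gt0.
have FB : source_bound F1 F2 N P by exact: well_source_bound F2L.
have uM' y : `|u y| <= M by exact: uM.
pose r := k * l; have r0 : 0 < r by rewrite mulr_gt0.
have rl : r <= l by rewrite ler_piMl// ltW.
have r1 : r <= 1 by exact: le_trans l1.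
have sr : Num.sqrt r = q * Num.sqrt l by rewrite /r sqrtrM ?(ltW k0)// sk.
have Psl : P * Num.sqrt l <= L.
  rewrite /P sl (_ : _ * _ = L / Num.sqrt M); last by field; rewrite !gt_eqF.
  by rewrite ler_pdivrMr// ler_peMr// ltW.
have half y : cube x r y -> M / 2 <= u y.
  move=> yr.
  have xy i : `|x ord0 i - y ord0 i| <= r by rewrite distrC.
  have := Hh u F1 F2 N P M l r x y N0 P0 r0 rl l1 cu FB uF uM' xy.
  have -> : r / l = k by rewrite /r mulfK// gt_eqF.
  rewrite sk sr.
  have -> : M * q + (N * (l * Num.sqrt l) + P) * (q * Num.sqrt l) =
      q * (M + N * (l * Num.sqrt l ^+ 2) + P * Num.sqrt l) by ring.
  rewrite sqr_sqrtr ?(ltW l0)//.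
  have -> : N * (l * l) = M + M^-1 by rewrite /N /l; field; rewrite !gt_eqF.
  move=> H.
  have : `|u x - u y| <= M / 2.
    apply: (le_trans H); apply: (@le_trans _ _ (Ch * (4 * q) * M)).
      rewrite -[leRHS]mulrA ler_wpM2l// [4 * q]mulrC -[leRHS]mulrA ler_wpM2l ?(ltW q0)//.
      have : M^-1 <= M by rewrite (le_trans _ M1)// invf_le1.
      by have := le_trans Psl LM; move: (P * _) M^-1 => z z'; clear; lra.
    by rewrite [leRHS]mulrC -[2^-1]div1r ler_wpM2r// ltW.
  by rewrite ler_norml => /andP[_]; rewrite -/M; clear; move: (u y) => z; lra.
(* If z >= M/2 and M >= 3 then z^2 - 1 >= M^2/4 - 1 >= M^2/8, hence z^3 - z >= M^3/16. *)
pose nu := e ^- 2 * (M ^+ 3 / 16).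
have nu0 : 0 < nu by rewrite !mulr_gt0// ?invr_gt0 ?exprn_gt0.
have F1nu y : cube x r y -> nu <= F1 y.
  move=> /half; rewrite F1E /nu => H; apply: ler_wpM2l; first exact: ltW.
  move: H M3; clear; move: (u y) => z; move: M => M Mz M3.
  have h1 : M ^+ 2 / 8 <= z ^+ 2 - 1 by nra.
  have -> : z ^+ 3 - z = z * (z ^+ 2 - 1) by ring.
  have -> : M ^+ 3 / 16 = M / 2 * (M ^+ 2 / 8) by field.
  by apply: ler_pM => //; [lra|nra].
pose w y := u y - M.
have cw : continuous w by move=> z; apply: (@continuousB _ _ _ u (cst M) z (cu z)); exact: cst_continuous.
have wF : poisson w (fun y => F1 y + F2 y) by exact: poissonB_cst.
have wx : w x = 0 by rewrite /w subrr.
have w0 y : w y <= 0 by rewrite /w subr_le0 (le_trans (ler_norm _)).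
have [mF1 _ F1N _] := FB.
(* The sources are separated: F1 enters by its lower bound [nu], and F2 by its L^2 bound with sup
   part 0. *)
have FB1 : source_bound F1 (cst 0) N P.
  split => //.
  by rewrite integral0_eq ?lee_fin ?sqr_ge0// => y _; rewrite expr0n.
have FB2 : source_bound (cst 0) F2 0 P.
  by split => // y; rewrite normr0.
pose dA t := t * t ^- n * \int[mu]_y ((F1 y + F2 y) * rk 1 t x y).
have DA (t : R) : 0 < t -> is_derive t 1 (fun t => avg w t x) (dA t).
  by move=> t0; rewrite /dA -wF//; apply: is_derive_avg => //; exact: Lloc1_continuous.
have dAle (t : R) : 0 < t -> t <= r -> e4 * nu * t - C' * P / Num.sqrt t <= dA t.
  move=> t0 tr; have t1 := le_trans tr r1.
  have tn0 : 0 < t ^+ n by rewrite exprn_gt0.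
  have tt0 : 0 <= t * t ^- n by rewrite mulr_ge0 ?invr_ge0 ?(ltW t0) ?(ltW tn0).
  have i1 := source_rk_integrable x t0 P0 FB1.
  have i2 := source_rk_integrable x t0 P0 FB2.
  have -> : dA t = t * t ^- n * (\int[mu]_y ((F1 y + cst 0 y) * rk 1 t x y)) +
     t * t ^- n * (\int[mu]_y ((cst 0 y + F2 y) * rk 1 t x y)).
    rewrite /dA -mulrDr -RintegralD//; congr (_ * _); apply: eq_Rintegral => y _.
    by rewrite /cst/= addr0 add0r mulrDl.
  apply: lerD.
    have -> : e4 * nu * t = t * t ^- n * (nu * (e4 * t ^+ n)) by field; rewrite gt_eqF.
    apply: (ler_wpM2l tt0).
    have irk : mu.-integrable setT (EFin \o (fun y => rk 1 t x y)).
      have L1 : Lloc 1 (cst 1 : 'rV[R]_n -> R) by apply: Lloc1_continuous; exact: cst_continuous.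
      have := integrable_kernel L1 (@continuous_rk _ _ 1 t x) (fun y => @rk_supp _ _ 1 t x y t0).
      by apply: eq_integrable => // y _; rewrite /= mul1r.
    apply: (@le_trans _ _ (nu * \int[mu]_y rk 1 t x y)).
      by apply: ler_wpM2l; [exact: ltW|exact: integral_rk1_ge].
    rewrite -RintegralZl//; apply: le_Rintegral => //.
      have : mu.-integrable setT (fun y => nu%:E * (rk 1 t x y)%:E)%E by exact: integrableZl.
      by apply: eq_integrable.
    move=> y _; rewrite /cst/= addr0.
    have [->|/(rk_supp t0) yt] := eqVneq (rk 1 t x y) 0; first by rewrite !mulr0.
    apply: ler_wpM2r; first exact: rk1_ge0.
    by apply: F1nu => i; rewrite (le_trans (yt i)).
  have := @scaled_kernel_bound R n (cst 0) F2 0 P (rk 1 t x) C1 x t n3 t0 t1 (lexx 0) P0 C10 FB2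
    (@continuous_rk _ _ 1 t x) (H1 t x).
  move=> /(_ (fun y yt => cube_sub2 t0 (rk_supp t0 yt))).
  by rewrite mul0r add0r mulrA ler_norml => /andP[+ _].
have Ar : avg w r x <= 0.
  rewrite /avg -oppr_ge0 -[X in - X]mul1r -mulNr -RintegralZl//; last first.
    apply: (integrable_kernel (Lloc1_continuous cw) (@continuous_eta _ _ r x) (s := r)).
    by move=> y; exact: eta_supp.
  apply: Rintegral_ge0 => y _; rewrite mulN1r -mulNr mulr_ge0 ?eta_ge0//.
  by rewrite oppr_ge0.
have e4nu : 0 <= e4 * nu by rewrite mulr_ge0 ?(ltW e40) ?(ltW nu0).
have C'P : 0 <= C' * P by rewrite mulr_ge0// ltW.
have := growth_bound r0 e4nu DA dAle Ar (avg_vanish cw wx) C'P.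
(* The powers of [e] cancel here: nu r^2 = k^2 M/16. What remains is linear in M on the left and,
   since P sqrt(l) <= L, linear in L on the right. *)
have -> : e4 * nu * r ^+ 2 / 2 = e4 * k ^+ 2 * M / 32.
  by rewrite /nu /r /l; field; rewrite !gt_eqF.
have -> : 2 * (C' * P) * Num.sqrt r = 2 * C' * (q * (P * Num.sqrt l)) by rewrite sr; ring.
move=> H.
have : e4 * k ^+ 2 * M / 32 <= 2 * C' * L.
  apply: (le_trans H); apply: ler_wpM2l; first by rewrite mulr_ge0.
  apply: (le_trans _ Psl); apply: ler_piMl => //.
  by apply: mulr_ge0; [exact: ltW|exact: sqrtr_ge0].
have ek : 0 < e4 * k ^+ 2 by rewrite mulr_gt0// exprn_gt0.
move=> HH; rewrite mulrAC ler_pdivlMr// [M * _]mulrC; move: HH.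
move: (e4 * k ^+ 2 * M) => z; have -> : 64 * C' * L = 32 * (2 * C' * L) by ring.
by move: (2 * C' * L) => z'; clear; lra.
Qed.

End sup_bound.


(** * The energy *)

Section potential.
Context {R : realType}.
Implicit Types s : R.

Lemma is_derive_double_well s : is_derive s 1 double_well (s ^+ 3 - s).
Proof.
have X2 : is_derive s 1 (fun t : R => t ^+ 2 - 1) (2 * s).
  have := is_deriveB (is_deriveX 2 (is_derive_id s (1 : R))) (is_derive_cst (1 : R) s 1).
  by move=> D; apply: (is_derive_eq D); rewrite expr1 /GRing.scale/= subr0 mulr1.
have D := is_deriveZ (4^-1) (is_deriveX 2 X2).
have {}D : is_derive s 1 (4^-1 *: (fun t : R => t ^+ 2 - 1) ^+ 2) (s ^+ 3 - s).
  by apply: (is_derive_eq D); rewrite /GRing.scale/=; field.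
by apply: is_derive_ext D => t; rewrite /double_well mulrC.
Qed.

Lemma derive1_double_well s : derive1 double_well s = s ^+ 3 - s.
Proof. by rewrite derive1E; have [_ ->] := is_derive_double_well s. Qed.

Lemma continuous_double_well : continuous (@double_well R).
Proof.
move=> s; apply/differentiable_continuous/derivable1_diffP.
by have [] := is_derive_double_well s.
Qed.

(** On [-1/2, 1/2] the integrand (1 - s^2)/sqrt(2) is at least 3/(4 sqrt(2)) >= 1/2. Positivity
    allows cancelling the factor 1/c0 of the energy. *)
Lemma c0_gt0 : 0 < @c0 R.
Proof.
pose f (s : R) : R := Num.sqrt (2 * double_well s).
have cf : continuous f.
  move=> s; apply: continuous_comp; last exact: sqrt_continuous.
  apply: (@continuousM _ _ (cst 2) double_well s); first exact: cst_continuous.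
  exact: continuous_double_well.
have intf (a b : R) : (@lebesgue_measure R).-integrable `[a, b]%classic (EFin \o f).
  apply: continuous_compact_integrable; first exact: segment_compact.
  exact: continuous_subspaceT.
have mf : measurable_fun setT (EFin \o f).
  by apply/measurable_EFinP; exact: continuous_measurable_fun.
pose I1 : set R := `[- (1 / 2), 1 / 2]%classic; pose I2 : set R := `[-1, 1]%classic.
have mI1 : measurable I1 by exact: measurable_itv.
have mI2 : measurable I2 by exact: measurable_itv.
apply: (@lt_le_trans _ _ (1 / 2)) => //.
rewrite /c0 /Rintegral -lee_fin fineK; last first.
  by apply: (@integrable_fin_num _ (measurableTypeR R) R lebesgue_measure); [exact: measurable_itv|exact: intf].
have H1 : (\int[@lebesgue_measure R]_(s in I1) (f s)%:E <=
    \int[@lebesgue_measure R]_(s in I2) (f s)%:E)%E.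
  apply: ge0_subset_integral => //.
  - exact: measurable_funTS.
  - by move=> s _; rewrite lee_fin sqrtr_ge0.
  - by move=> s; rewrite /I1 /I2 /= !in_itv/= => /andP[? ?]; apply/andP; split; lra.
apply: le_trans H1.
have H2 : (\int[@lebesgue_measure R]_(s in I1) (1 / 2)%R%:E = (1 / 2)%R%:E)%E.
  rewrite integral_cst//= /I1 lebesgue_measure_itv/= lte_fin ifT; last by lra.
  by rewrite -EFinD -EFinM; congr EFin; field.
rewrite -[leLHS]H2.
apply: ge0_le_integral => //.
- exact: measurable_funTS.
- move=> s; rewrite /I1 /= in_itv/= => /andP[s1 s2]; rewrite lee_fin.
  have -> : 1 / 2 = Num.sqrt ((1 / 2) ^+ 2) :> R by rewrite sqrtr_sqr ger0_norm.
  rewrite ler_wsqrtr// /double_well.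
  have : s ^+ 2 <= 1 / 4 by nra.
  by have := sqr_ge0 s; move: (s ^+ 2) => z; clear; nra.
Qed.

Lemma limf_esup_lt_right (f : R -> \bar R) (a : \bar R) : (limf_esup f 0^'+ < a)%E ->
  exists2 d : R, 0 < d & forall e : R, 0 < e -> e < d -> (f e <= a)%E.
Proof.
move=> /ereal_inf_lt[_ [V V0 <-] Va].
move: V0 => [d /= d0 dV]; exists d => // e e0 ed.
apply: (le_trans _ (ltW Va)); apply: ereal_sup_ubound; exists e => //.
by apply: dV => //=; rewrite sub0r normrN gtr0_norm.
Qed.

End potential.

Section phase_field.
Context {R : realType}.

Definition sup_constant (n : nat) (C : R) :=
  forall (u F1 F2 : 'rV[R]_n -> R) (e L : R) x, 0 < e -> e <= 1 -> 0 < L -> continuous u ->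
  poisson u (fun y => F1 y + F2 y) -> measurable_fun setT F2 ->
  (forall y, F1 y = e ^- 2 * (u y ^+ 3 - u y)) ->
  (\int[@lebesgue_rV R n]_y (F2 y ^+ 2)%:E <= ((L / Num.sqrt e) ^+ 2)%:E)%E ->
  (forall y, `|u y| <= `|u x|) -> `|u x| <= 3 + L + C * L.

(** The summands 3 and L cover the cases excluded by [sup_bound_pos]. A negative extremum is handled
    by passing to -u, as the nonlinearity u^3 - u is odd. *)
Lemma sup_bound (n : nat) : (n <= 3)%N -> exists2 C : R, 0 <= C & sup_constant n C.
Proof.
move=> n3; have [C C0 HC] := @sup_bound_pos R n n3; exists C => //.
move=> u F1 F2 e L x e0 e1 L0 cu uF mF2 F1E F2L uM.
have CL0 : 0 <= C * L by rewrite mulr_ge0// ltW.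
have [M3|M3] := leP 3 `|u x|; last by move: M3 CL0 L0; move: `|u x| (C * L); clear => *; lra.
have [LM|LM] := leP L `|u x|; last by move: LM CL0 L0; move: `|u x| (C * L); clear => *; lra.
suff : `|u x| <= C * L by move: L0; move: `|u x| (C * L); clear => *; lra.
have [ux0|ux0] := leP 0 (u x).
  rewrite (ger0_norm ux0) in uM M3 LM *.
  by apply: (HC u F1 F2 e L x).
rewrite (ltr0_norm ux0) in uM M3 LM *.
have cNu : continuous (fun y => - u y) by move=> y; exact: (continuousN (cu y)).
apply: (HC (fun y => - u y) (fun y => - F1 y) (fun y => - F2 y) e L x) => //.
- have FB := well_source_bound e0 cu uM mF2 F1E F2L.
  have P0 : 0 < L / Num.sqrt e by rewrite divr_gt0// sqrtr_gt0.
  have := poissonN cu (fun s z s0 => source_rk_integrable z s0 P0 FB) uF.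
  by move=> H s z s0; rewrite H//; apply: eq_Rintegral => y _; rewrite opprD.
- exact: measurableT_comp.
- by move=> y; rewrite F1E -mulrN; congr (_ * _); ring.
- by under eq_integral do rewrite sqrrN.
- by move=> y; rewrite normrN uM.
Qed.

End phase_field.


(** * The weak Laplacian and its equation *)

Section weak_laplacian.
Context {R : realType} {n : nat}.
Local Notation mu := (@lebesgue_rV R n).
Implicit Types (u : 'rV[R]_n -> R).

Lemma wderiv_weak s u : W22loc u -> (size s <= 2)%N -> weak_derivative s u (wderiv s u).
Proof.
move=> [_ H] /H[v uv _]; apply: (@xgetPex _ (cst 0) [set v | weak_derivative s u v]).
by exists v.
Qed.

Lemma Lloc1_wderiv2 u i : W22loc u -> Lloc 1 (wderiv [:: i; i] u).
Proof. by move=> uW; have [] := @wderiv_weak [:: i; i] u uW isT. Qed.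

Lemma measurable_wlaplacian u : W22loc u -> measurable_fun setT (wlaplacian u).
Proof.
move=> uW; rewrite /wlaplacian; apply: measurable_sum => i.
by have [] := Lloc1_wderiv2 i uW.
Qed.

Lemma poisson_wlaplacian u : continuous u -> W22loc u -> poisson u (wlaplacian u).
Proof.
move=> cu uW s x s0.
transitivity (\int[mu]_y \sum_(i < n) (u y * pderivs [:: i; i] (rk 1 s x) y)).
  by apply: eq_Rintegral => y _; rewrite -mulr_sumr sum_pderivs2_rk.
transitivity (\int[mu]_y \sum_(i < n) (wderiv [:: i; i] u y * rk 1 s x y)); last first.
  by apply: eq_Rintegral => y _; rewrite -mulr_suml.
rewrite !Rintegral_sum.
- apply: eq_bigr => i _; have [_ _ H] := @wderiv_weak [:: i; i] u uW isT.
  by rewrite (H _ (test_function_rk 1 x s0)) /= expr2 mulrNN mulr1 mul1r.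
- move=> i; apply: (integrable_kernel (Lloc1_wderiv2 i uW) (@continuous_rk _ _ 1 s x) (s := s)).
  by move=> y; exact: rk_supp.
- move=> i; apply: (integrable_kernel (Lloc1_continuous cu) (@continuous_pderivs2_rk _ _ s x i s0) (x := x) (s := s)).
  by move=> y; exact: (pderivs2_rk_supp s0).
Qed.

End weak_laplacian.

Section energy.
Context {R : realType} {n : nat}.
Local Notation mu := (@lebesgue_rV R n.+1).
Implicit Types (u : 'rV[R]_n.+1 -> R) (Omega : set 'rV[R]_n.+1).

Lemma wlaplacian_level u c : continuous u -> W22loc u ->
  {ae mu, forall y, u y = c -> wlaplacian u y = 0}.
Proof.
move=> cu uW.
have H : {ae mu, forall y, forall i : 'I_n.+1, u y = c -> wderiv [:: i; i] u y = 0}.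
  apply: filter_forall => i.
  exact: (@weak_second_derivative_level R n i u _ cu (@wderiv_weak _ _ [:: i; i] u uW isT) c).
apply: filterS H => y H uy; rewrite /wlaplacian big1// => i _; exact: H.
Qed.

(* Off [Omega] the function is constant, so its Laplacian is carried by [Omega]
   up to a null set and the energy controls the whole equation. *)
Lemma energy_source Omega u (e A : R) : 0 < e -> open Omega -> X_space Omega u ->
  (diffuse_willmore Omega e u <= A%:E)%E ->
  exists F1 F2, [/\ poisson u (fun y => F1 y + F2 y), measurable_fun setT F2,
    forall y, F1 y = e ^- 2 * (u y ^+ 3 - u y) &
    (\int[mu]_y (F2 y ^+ 2)%:E <= (c0 * A / e)%:E)%E].
Proof.
move=> e0 oO [cu uW uO] EA.
have mO : measurable Omega by exact: open_measurable_rV.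
have mu_ : measurable_fun setT u by exact: continuous_measurable_rV.
have ml := measurable_wlaplacian uW.
pose F1 y := e ^- 2 * (u y ^+ 3 - u y).
have mF1 : measurable_fun setT F1.
  by apply: measurable_funM => //; apply: measurable_funB => //; exact: measurable_funX.
pose F2 y := (wlaplacian u y - F1 y) * \1_Omega y.
have mF2 : measurable_fun setT F2.
  by apply: measurable_funM; [exact: measurable_funB|exact: measurable_indic].
exists F1, F2; split => //.
- move=> s x s0; rewrite poisson_wlaplacian// /Rintegral; congr fine.
  have mrk : measurable_fun setT (rk 1 s x).
    by apply: continuous_measurable_rV; exact: continuous_rk.
  apply: ae_eq_integral => //.
  + by apply/measurable_EFinP; exact: measurable_funM.
  + by apply/measurable_EFinP; apply: measurable_funM => //; exact: measurable_funD.
  (* Off Omega both sides vanish almost everywhere: u = -1 is a zero of W', and the Laplacian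
     vanishes on that level set. *)
  apply: filterS (wlaplacian_level (-1) cu uW) => y H _; congr EFin; congr (_ * _).
  rewrite /F2 indicE; have [yO|yO] := boolP (y \in Omega).
    by rewrite mulr1 addrC subrK.
  rewrite mulr0 addr0; rewrite notin_setE in yO.
  have uy := uO y yO; rewrite (H uy) /F1 uy; ring.
pose G y := e^-1 * (e * wlaplacian u y - e^-1 * derive1 double_well (u y)) ^+ 2.
have mG : measurable_fun setT G.
  apply: measurable_funM => //; apply: measurable_funX; apply: measurable_funB.
    exact: measurable_funM.
  apply: measurable_funM => //.
  rewrite (_ : (fun y => derive1 double_well (u y)) = fun y => u y ^+ 3 - u y); last first.
    by apply/boolp.funext => y; rewrite derive1_double_well.
  by apply: measurable_funB => //; exact: measurable_funX.
have G0 y : 0 <= G y by rewrite mulr_ge0 ?invr_ge0 ?sqr_ge0// ltW.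
(* On Omega the energy density is e times F2^2, since (e)^2/e = e after factoring e out of the
   square. *)
have -> : (\int[mu]_y (F2 y ^+ 2)%:E = (e^-1)%:E * \int[mu]_(y in Omega) (G y)%:E)%E.
  rewrite -ge0_integralZl_EFin//; last 3 first.
  - by move=> y _; rewrite lee_fin.
  - by apply/measurable_EFinP; exact: measurable_funTS.
  - by rewrite invr_ge0 ltW.
  rewrite [RHS]integral_mkcond; apply: eq_integral => y _; rewrite patchE /F2 indicE.
  case: ifPn => yO; last by rewrite mulr0 expr0n.
  rewrite mulr1 -EFinM; congr EFin; rewrite /G /F1 derive1_double_well; field.
  by rewrite gt_eqF.
have c00 := @c0_gt0 R.
have -> : (c0 * A / e)%:E = ((e^-1)%:E * (c0 * A)%:E)%E :> \bar R by rewrite -EFinM mulrC.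
apply: lee_wpmul2l; first by rewrite lee_fin invr_ge0 ltW.
have := lee_wpmul2l (ltW c00 : (0 <= (@c0 R)%:E)%E) EA.
by rewrite /diffuse_willmore muleA -EFinM divff ?gt_eqF// mul1e EFinM.
Qed.

End energy.


Section euclidean_norm.
Context {R : realType} {n : nat}.
Implicit Types x y : 'rV[R]_n.

Lemma enormB x y : enorm (x - y) = enorm (y - x).
Proof. by rewrite /enorm; congr Num.sqrt; apply: eq_bigr => i _; rewrite !mxE -sqrrN opprB. Qed.

Lemma enorm_coord x y i : `|x ord0 i - y ord0 i| <= enorm (x - y).
Proof.
rewrite -sqrtr_sqr ler_wsqrtr// (bigD1 i)//= !mxE lerDl.
by apply: sumr_ge0 => j _; exact: sqr_ge0.
Qed.

Lemma enorm_gt0 x y : x != y -> 0 < enorm (x - y).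
Proof.
move=> xy; rewrite lt_neqAle sqrtr_ge0 andbT eq_sym; apply: contra xy => /eqP E.
apply/eqP/rowP => i; apply/eqP; rewrite -subr_eq0 -normr_le0 -E; exact: enorm_coord.
Qed.

Lemma Lnorm_pinfty_le (f : 'rV[R]_n -> R) (B : R) : 0 <= B -> (forall x, `|f x| <= B) ->
  ('N[@lebesgue_rV R n]_+oo [EFin \o f] <= B%:E)%E.
Proof.
move=> B0 fB; rewrite unlock; case: ifP => _; last by rewrite lee_fin.
by apply/ess_supP; apply: aeW => x; rewrite /= lee_fin.
Qed.

End euclidean_norm.

Section main_estimates.
Context {R : realType} {n : nat}.
Local Notation mu := (@lebesgue_rV R n).
Implicit Types (u : 'rV[R]_n -> R) (Omega : set 'rV[R]_n).

(** Off Omega |u| = 1, so a maximum over the compact closure of Omega is global once it is at least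
    1. Otherwise |u| <= 1 everywhere. *)
Lemma argmax_norm_or_le1 Omega u : compact (closure Omega) -> continuous u ->
  (forall x, ~ Omega x -> u x = -1) ->
  (forall y, `|u y| <= 1) \/ (exists x, forall y, `|u y| <= `|u x|).
Proof.
move=> cO cu uO.
have out y : ~ Omega y -> `|u y| = 1 by move=> /uO ->; rewrite normrN1.
have [[z zO]|/set0P/negP] := pselect (closure Omega !=set0); last first.
  rewrite negbK => /eqP O0; left => y; rewrite out// => /subset_closure.
  by rewrite O0.
have cNu : continuous (fun y => `|u y|).
  by move=> y; apply: continuous_comp; [exact: cu|exact: norm_continuous].
have [c _ Hc] := @compact_EVT_max _ _ (fun y => `|u y|) _ (ex_intro _ z zO) cO (continuous_subspaceT cNu).
have in_ y : Omega y -> `|u y| <= `|u c|.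
  by move=> yO; apply: Hc; rewrite inE; exact: subset_closure.
have [c1|c1] := leP 1 `|u c|; [right; exists c|left] => y;
  have [yO|yO] := pselect (Omega y).
- exact: in_.
- by rewrite out.
- by rewrite (le_trans (in_ y yO))// ltW.
- by rewrite out.
Qed.

(** The Hoelder bound at scale l = e and distance d = |x - y|: with N = e^(-2) (B^3 + B) and P =
    L/sqrt(e), each of its three terms is a constant times sqrt(d/e). *)
Lemma holder_eps u F1 F2 (e B L C : R) x y :
  @holder_constant R n C ->
  0 < e -> e <= 1 -> 0 <= B -> 0 < L -> 0 <= C -> continuous u ->
  poisson u (fun y => F1 y + F2 y) -> measurable_fun setT F2 ->
  (forall y, F1 y = e ^- 2 * (u y ^+ 3 - u y)) ->
  (\int[mu]_y (F2 y ^+ 2)%:E <= ((L / Num.sqrt e) ^+ 2)%:E)%E ->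
  (forall y, `|u y| <= B) -> eball x e y ->
  `|u x - u y| <= C * (B + (B ^+ 3 + B) + L) / Num.sqrt e * (enorm (x - y) `^ 2^-1).
Proof.
move=> H e0 e1 B0 L0 C0 cu uF mF2 F1E F2L uB.
rewrite /eball/= => xye; rewrite enormB in xye.
have se0 : 0 < Num.sqrt e by rewrite sqrtr_gt0.
have B30 : 0 <= B ^+ 3 + B by rewrite addr_ge0// exprn_ge0.
(* The Hoelder bound requires a positive distance, so equal points are set apart. *)
have [->|xy] := eqVneq x y.
  rewrite subrr normr0; apply: mulr_ge0; last exact: powR_ge0.
  apply: divr_ge0; last exact: ltW.
  by apply: mulr_ge0 => //; apply: addr_ge0; [exact: addr_ge0|exact: ltW].
have d0 := enorm_gt0 xy.
rewrite (powR12_sqrt (ltW d0)).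
have N0 : 0 <= e ^- 2 * (B ^+ 3 + B) by rewrite mulr_ge0// invr_ge0 exprn_ge0 ?(ltW e0).
have P0 : 0 < L / Num.sqrt e by rewrite divr_gt0.
apply: (le_trans (H u F1 F2 _ _ B e (enorm (x - y)) x y N0 P0 d0 (ltW xye) e1 cu
  (well_source_bound e0 cu uB mF2 F1E F2L) uF uB (enorm_coord x y))).
rewrite sqrtrM ?(ltW d0)// sqrtrV ?(ltW e0)// le_eqVlt; apply/orP; left; apply/eqP.
have eE : e = Num.sqrt e ^+ 2 by rewrite sqr_sqrtr// ltW.
move: (Num.sqrt (enorm _)) => q; move: (Num.sqrt e) se0 eE => r r0 ->.
by field; rewrite gt_eqF.
Qed.

End main_estimates.

Theorem lemma3p1 (R : realType) :
  exists C1 C2 : nat -> \bar R -> R,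
  forall (n : nat) (Omega : set 'rV[R]_n) (u : R -> 'rV[R]_n -> R),
    n = 2%N \/ n = 3%N ->
    open Omega -> compact (closure Omega) ->
    (forall eps : R, 0 < eps -> X_space Omega (u eps)) ->
    let alpha := limf_esup (fun eps => diffuse_willmore Omega eps (u eps)) 0^'+ in
    (alpha < +oo)%E ->
    exists2 eps0 : R, 0 < eps0 &
      forall eps : R, 0 < eps -> eps < eps0 ->
        ('N[@lebesgue_rV R n]_+oo [EFin \o u eps] <= (C1 n alpha)%:E)%E /\
        forall x y, eball x eps y ->
          `|u eps x - u eps y| <=
            C2 n alpha / Num.sqrt eps * (enorm (x - y) `^ 2^-1).
Proof.
(* The constants are chosen as functions of the dimension before Omega and u are given; for n > 3
   they take the dummy value 0. *)
have /choice[Cs HCs] : forall n, exists C : R, (n <= 3)%N -> 0 <= C /\ sup_constant n C.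
  move=> n; have [n3|n3] := boolP (n <= 3)%N; last by exists 0.
  by have [C C0 HC] := @sup_bound R n n3; exists C.
have /choice[Ch HCh] : forall n, exists C : R, (n <= 3)%N -> 0 <= C /\ @holder_constant R n C.
  move=> n; have [n3|n3] := boolP (n <= 3)%N; last by exists 0.
  by have [C C0 HC] := @holder_scale R n n3; exists C.
(* For small [e] the energy is at most alpha + 1, so the L^2 norm of the second source is at most
   L/sqrt(e). The maximum with 1 makes L positive. *)
pose L (a : \bar R) : R := Num.sqrt (Num.max (c0 * (fine a + 1)) 1).
pose B n a : R := 3 + L a + Cs n * L a.
exists B, (fun n a => Ch n * (B n a + (B n a ^+ 3 + B n a) + L a)).
move=> n Omega u n23 oO cO uX alpha alpha_fin.
have n3 : (n <= 3)%N by case: n23 => ->.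
have [Cs0 {}HCs] := HCs n n3; have [Ch0 {}HCh] := HCh n n3.
have L0 : 0 < L alpha by rewrite sqrtr_gt0 lt_max ltr01 orbT.
have L2 : c0 * (fine alpha + 1) <= L alpha ^+ 2.
  by rewrite sqr_sqrtr ?le_max ?lexx// ler01 orbT.
have B3 : 3 <= B n alpha by rewrite /B -addrA lerDl addr_ge0 ?mulr_ge0 ?(ltW L0).
have B0 : 0 <= B n alpha by exact: le_trans B3.
(* The value -oo, whose [fine] is 0, is covered as well. *)
have alpha_lt : (alpha < (fine alpha + 1)%:E)%E.
  case: alpha alpha_fin {L0 L2 B3 B0} => [r _|//|_]; last exact: ltNyr.
  by rewrite lte_fin ltrDl.
have [d d0 Hd] := limf_esup_lt_right alpha_lt.
(* The minimum with 1 provides e <= 1, under which the bounds in powers of the scale hold. *)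
exists (Num.min d 1); first by rewrite lt_min d0 ltr01.
move=> e e0; rewrite lt_min => /andP[ed /ltW e1].
have eX := uX e e0.
have [F1 [F2 [uF mF2 F1E F2L]]] : exists F1 F2,
    [/\ poisson (u e) (fun y => F1 y + F2 y), measurable_fun setT F2,
    forall y, F1 y = e ^- 2 * (u e y ^+ 3 - u e y) &
    (\int[@lebesgue_rV R n]_y (F2 y ^+ 2)%:E <= (c0 * (fine alpha + 1) / e)%:E)%E].
  move: (Hd e e0 ed) eX oO; clear -n23 e0; case: n Omega u alpha n23 => [|n] Omega u alpha.
    by case.
  by move=> _ h1 h2 h3; exact: (energy_source e0 h3 h2 h1).
have {}F2L : (\int[@lebesgue_rV R n]_y (F2 y ^+ 2)%:E <= ((L alpha / Num.sqrt e) ^+ 2)%:E)%E.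
  apply: (le_trans F2L); rewrite lee_fin expr_div_n (sqr_sqrtr (ltW e0)).
  by rewrite ler_wpM2r// invr_ge0 ltW.
have [cu _ uO] := eX.
have uB y : `|u e y| <= B n alpha.
  have [u1|[x ux]] := argmax_norm_or_le1 cO cu uO.
    by rewrite (le_trans (u1 y))// (le_trans _ B3)// ler1n.
  by rewrite (le_trans (ux y))//; exact: (HCs (u e) F1 F2 e).
split; first exact: Lnorm_pinfty_le.
by move=> x y; exact: (holder_eps HCh e0 e1 B0 L0 Ch0 cu uF mF2 F1E F2L uB).
Qed.
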